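(* Let $t,r,e$ be positive integers and let $Z_1,\dots,Z_r$ be (types of) connected $0$-dimensional subschemes of the germ $\mathbf{A}^2_0$ of the affine plane at the origin $0$. Set $m'=\max\{\operatorname{mult}_0(Z_i)\}_{1\le i\le r}$ and $m=\max\{m',2\}$. Assume $$\frac{(t+2)(t+1)}{2}\ \ge\ 1+3e+\sum_{1\le j\le r}\operatorname{length}(Z_j)\qquad\text{and}\qquad e\ \ge\ \frac{(m-1)(t-1)}{2}.$$ Then for a general union $Z\subset\mathbf{P}^2$ of $e$ double points and $r$ subschemes $W_1,\dots,W_r$, with $W_i$ equivalent to $Z_i$ for every $i$, we have $h^1(\mathbf{P}^2,\mathbf{I}_Z(t))=0$.
   Context: The base field is algebraically closed of characteristic $0$. For a point $P$ of a smooth surface $X$ and an integer $d>0$, $dP$ denotes the fat point of multiplicity $d$, i.e. the $0$-dimensional subscheme of $X$ with ideal sheaf $(\mathbf{I}_{P,X})^d$; a double point is a fat point $2P$ (of length $3$). Let $\mathbf{A}^2_0$ be the germ of the affine plane at the origin $0$, let $Z$ be a (non-empty) connected $0$-dimensional subscheme of $\mathbf{A}^2_0$, and let $W$ be a connected $0$-dimensional subscheme of a smooth projective surface $X$ with $P:=W_{red}$. $W$ is equivalent to $Z$ (or has type $Z$) if there is a formal (or étale) isomorphism of the germ $\mathbf{A}^2_0$ with the germ of $X$ at $P$ sending $Z$ onto $W$. The multiplicity $\operatorname{mult}_P(W)$ of $W$ is the minimal integer $d$ such that $W\subset dP$; similarly for $\operatorname{mult}_0(Z)$ (equivalent schemes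 have the same multiplicity). A ''general union'' of $e$ double points and schemes $W_i$ equivalent to $Z_i$ means that the supports are distinct and that the tuple consisting of the double points and the schemes $W_1,\dots,W_r$ is taken in a non-empty Zariski open subset of the (irreducible) parameter space of all such tuples. $\mathbf{I}_Z$ is the ideal sheaf of $Z$ and $\mathbf{I}_Z(t)=\mathbf{I}_Z\otimes\mathcal{O}_{\mathbf{P}^2}(t)$. *)

(* Defs.v *)
From HB Require Import structures.
From mathcomp Require Import all_boot all_order all_algebra.
From mathcomp Require Import boolp.
From mathcomp Require Import mpoly.

Set Implicit Arguments.
Unset Strict Implicit.
Unset Printing Implicit Defensive.

Import GRing.Theory.
Local Open Scope ring_scope.

Definition ideal_exp (R : comNzRingType) (I : {pred R}) (d : nat) : {pred R} :=
  [pred f | `[< exists (n : nat) (a : 'I_n -> R) (g : 'I_n -> 'I_d -> R),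
      (forall i j, g i j \in I) /\ f = \sum_i a i * \prod_j g i j >]].

Definition origin {k : fieldType} : 'I_2 -> k := fun=> 0.

Definition origin_ideal {k : fieldType} : {pred {mpoly k[2]}} :=
  [pred f | f.@[origin] == 0].

(* A non-empty 0-dimensional subscheme of the germ of the plane at the origin
   is a proper ideal I of k[x,y] containing a power of (x,y): such ideals
   correspond bijectively, with the same quotient ring, to the proper ideals of
   finite colength of the local ring, and of k[[x,y]]. *)
Record germ_scheme (k : fieldType) := GermScheme {
  germ_ideal :> {pred {mpoly k[2]}};
  germ_idealP : idealr_closed germ_ideal;
  germ_supportP :
    exists d : nat, {subset ideal_exp origin_ideal d <= germ_ideal}
}.

Section Invariants.
Variables (k : fieldType) (Z : germ_scheme k).

Definition in_fat (d : nat) : bool :=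
  `[< {subset ideal_exp origin_ideal d <= Z} >].

Lemma ex_in_fat : exists d, in_fat d.
Proof. by case: (germ_supportP Z) => d hd; exists d; apply/asboolP. Qed.

Definition mult : nat := ex_minn ex_in_fat.

Definition spans_mod (l : nat) (b : 'I_l -> {mpoly k[2]}) :=
  forall f, exists c : 'I_l -> k, f - \sum_i c i *: b i \in Z.

Definition free_mod (l : nat) (b : 'I_l -> {mpoly k[2]}) :=
  forall c : 'I_l -> k, \sum_i c i *: b i \in Z -> forall i, c i = 0.

Definition basis_mod (l : nat) (b : 'I_l -> {mpoly k[2]}) :=
  spans_mod b /\ free_mod b.

Lemma monomial_in_fat d (m : 'X_{1..2}) :
  (d <= mdeg m)%N -> exists (a : {mpoly k[2]}) (g : 'I_d -> {mpoly k[2]}),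
    (forall j, g j \in origin_ideal) /\ 'X_[m] = a * \prod_j g j.
Proof.
elim: d m => [|d IH] m hm.
  by exists 'X_[m], (fun=> 0); split; [case | rewrite big_ord0 mulr1].
have [i hi] : exists i, m i != 0%N.
  apply/existsP; rewrite -negb_forall; apply/negP => /forallP h0.
  move: hm; rewrite mdegE big1 // => i _.
  by apply/eqP; have := h0 i; case: (m i == 0%N).
have Um : (U_(i) <= m)%MM by rewrite lep1mP.
have [|a [g [hg e]]] := IH (m - U_(i))%MM.
  have := hm; rewrite -{1}(submK Um) mdegD mdeg1; by rewrite addn1.
exists a, (fun j => if unlift ord0 j is Some j' then g j' else 'X_i); split.
  move=> j; case: unliftP => [j' _|_]; first exact: hg.
  by rewrite inE mevalXU.
rewrite big_ord_recl unlift_none mulrCA.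
under eq_bigr do rewrite liftK.
by rewrite -e -mpolyXD addmC submK.
Qed.

Lemma germ0 : 0 \in Z. Proof. by case: (germ_idealP Z). Qed.

Lemma germ_lin a u v : u \in Z -> v \in Z -> a * u + v \in Z.
Proof. by case: (germ_idealP Z) => _ _; apply. Qed.

Lemma germD u v : u \in Z -> v \in Z -> u + v \in Z.
Proof. by move=> hu hv; rewrite -[u]mul1r germ_lin. Qed.

Lemma germM a u : u \in Z -> a * u \in Z.
Proof. by move=> hu; rewrite -[a * u]addr0 germ_lin // germ0. Qed.

Lemma germZ c u : u \in Z -> c *: u \in Z.
Proof. by move=> hu; rewrite -mul_mpolyC germM. Qed.

Lemma germ_sum (I : Type) (s : seq I) (P : pred I) F :
  (forall i, P i -> F i \in Z) -> \sum_(i <- s | P i) F i \in Z.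
Proof.
by move=> h; elim/big_rec: _ => [|i u hi hu]; rewrite ?germ0 ?germD ?h.
Qed.

Lemma in_fat_high d f : in_fat d ->
  (forall m, f@_m != 0 -> (d <= mdeg m)%N) -> f \in Z.
Proof.
move=> /asboolP hd hf; rewrite (mpolyE f) big_seq; apply: germ_sum => m hm.
apply: germZ; apply: hd.
have [|a [g [hg e]]] := @monomial_in_fat d m.
  by apply: hf; rewrite -mcoeff_msupp.
rewrite inE; apply/asboolP; exists 1%N, (fun=> a), (fun=> g); split => //.
by rewrite big_ord1.
Qed.

Lemma ex_spans_mod : exists l, `[< exists b : 'I_l -> _, spans_mod b >].
Proof.
have [d hd] := ex_in_fat.
exists #|{: 'X_{1..2 < d}}|; apply/asboolP.
exists (fun i => 'X_[(enum_val i : 'X_{1..2 < d})]) => f.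
exists (fun i => f@_(enum_val i : 'X_{1..2 < d})).
apply: (in_fat_high hd) => m; apply: contraNT; rewrite -ltnNge => hm.
rewrite linearB linear_sum /= (bigD1 (enum_rank (BMultinom hm))) //=.
rewrite enum_rankK /= mcoeffZ mcoeffX eqxx mulr1 big1 ?addr0 ?subrr //.
move=> i hi; rewrite mcoeffZ mcoeffX; case: eqP => [e|_]; last by rewrite mulr0.
case/eqP: hi; rewrite -[LHS]enum_valK; congr enum_rank; exact: val_inj.
Qed.

Lemma ex_basis_mod : exists l, `[< exists b : 'I_l -> _, basis_mod b >].
Proof.
case: (ex_minnP ex_spans_mod) => l /asboolP [b hb] hmin.
exists l; apply/asboolP; exists b; split => // c hc i; apply/eqP/negPn/negP => ci.
case: l b hb hmin c hc i ci => [|l] b hb hmin c hc i ci; first by case: i ci.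
suff /hmin : `[< exists b : 'I_l -> _, spans_mod b >] by rewrite ltnn.
apply/asboolP; exists (fun j => b (lift i j)) => f.
have [a ha] := hb f.
exists (fun j => a (lift i j) - a i / c i * c (lift i j)).
suff -> : \sum_j (a (lift i j) - a i / c i * c (lift i j)) *: b (lift i j) =
          \sum_j a j *: b j - (a i / c i) *: \sum_j c j *: b j.
  by rewrite opprB addrC -addrA [- _ + f]addrC addrC germD // germZ.
rewrite scaler_sumr -sumrB [RHS](bigD1_ord i) //= scalerA divfK // subrr add0r.
by apply: eq_bigr => j _; rewrite scalerBl scalerA.
Qed.

(* The dimension of k[x,y] / I. *)
Definition length : nat := ex_minn ex_basis_mod.

End Invariants.

Section Plane.
Variable k : fieldType.

(* Homogeneous coordinates x_0, x_1, x_2 on the projective plane; a point is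
   given by a non-zero vector of homogeneous coordinates. *)
Local Notation S := {mpoly k[3]}.

Definition hcomp (d : nat) (F : S) : S := pihomog mdeg d F.

Definition nonzero_vec (p : 'I_3 -> k) := exists i, p i != 0.

Definition same_point (p q : 'I_3 -> k) :=
  exists2 c : k, c != 0 & forall i, p i = c * q i.

Definition point_ideal (p : 'I_3 -> k) : {pred S} :=
  [pred F | `[< forall d, (hcomp d F).@[p] = 0 >]].

Definition fat_point_ideal (d : nat) (p : 'I_3 -> k) : {pred S} :=
  ideal_exp (point_ideal p) d.

(* A polynomial map (x, y) |-> [phi 0 : phi 1 : phi 2], defined near the origin
   and etale there, i.e. an etale (or formal) isomorphism of the germ of the
   affine plane at 0 with the germ of P^2 at [phi(0)]. The determinant of
   (phi, dphi/dx, dphi/dy) at 0 is the Jacobian in homogeneous coordinates;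
   its non-vanishing implies phi(0) != 0. *)
Definition germ_iso (phi : 'I_3 -> {mpoly k[2]}) :=
  \det (\matrix_(i < 3, j < 3)
    ([:: phi i; (phi i)^`M(0); (phi i)^`M(1)]`_j).@[origin]) != 0.

Definition center (phi : 'I_3 -> {mpoly k[2]}) : 'I_3 -> k :=
  fun i => (phi i).@[origin].

(* The homogeneous ideal of the image of Z under a germ isomorphism. *)
Definition image_ideal (Z : germ_scheme k) (phi : 'I_3 -> {mpoly k[2]})
  : {pred S} :=
  [pred F | `[< forall d, hcomp d F \mPo [tuple phi i | i < 3] \in Z >]].

(* W is the homogeneous ideal of a subscheme of P^2 of type Z. Polynomial germ
   isomorphisms suffice, since Z only depends on finite jets. *)
Definition equivalent (Z : germ_scheme k) (W : {pred S}) :=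
  exists2 phi, germ_iso phi & W =i image_ideal Z phi.

(* Sections over D_+(f) of the twist I~(t) of the ideal sheaf attached to the
   homogeneous ideal I, for f homogeneous of degree (msize f).-1: fractions
   F / f^n with F in I homogeneous of degree t + n deg f. *)
Definition section (I : {pred S}) (t : nat) (f : S) (s : {fraction S}) :=
  exists (n : nat) (F : S),
    [/\ F \in I, F \is (t + n * (msize f).-1).-homog
      & s = tofrac F / tofrac f ^+ n].

(* Vanishing of H^1(P^2, I~(t)), computed as Cech cohomology for the affine
   cover D_+(x_0), D_+(x_1), D_+(x_2). *)
Definition H1_eq0 (I : {pred S}) (t : nat) :=
  forall c : 'I_3 -> 'I_3 -> {fraction S},
    (forall i j, section I t ('X_i * 'X_j) (c i j)) ->
    (forall i j l, c i l = c i j + c j l) ->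
  exists2 b : 'I_3 -> {fraction S},
    forall i, section I t 'X_i (b i) & forall i j, c i j = b j - b i.

Definition zariski_open (T : finType) (U : (T -> k) -> Prop) :=
  exists G : {mpoly k[#|T|]} -> Prop, forall a : T -> k,
    U a <-> exists2 g, G g & g.@[fun i => a (enum_val i)] != 0.

Definition jet_poly (m : nat) (b : 'X_{1..2 < m} -> k) : {mpoly k[2]} :=
  \sum_(mo : 'X_{1..2 < m}) b mo *: 'X_[mo].

(* Affine space of parameters: homogeneous coordinates of e points and r
   triples of polynomials in x, y of degree < m. When m >= 2 and m is at least
   the multiplicities of the Z_j, the latter parametrize all germ isomorphisms
   modulo (x,y)^m, hence all schemes of type Z_j (equivalent_trunc below). *)
Definition coords (e r m : nat) : finType :=
  ('I_e * 'I_3 + 'I_r * 'I_3 * 'X_{1..2 < m})%type.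

Section Configurations.
Variables (e r m : nat).
Implicit Types a : coords e r m -> k.

Definition double_center a (i : 'I_e) : 'I_3 -> k := fun l => a (inl (i, l)).

Definition germ_map a (j : 'I_r) : 'I_3 -> {mpoly k[2]} :=
  fun l => jet_poly (fun mo => a (inr (j, l, mo))).

Definition support a (u : 'I_e + 'I_r) : 'I_3 -> k :=
  match u with
  | inl i => double_center a i
  | inr j => center (germ_map a j)
  end.

Definition admissible a :=
  [/\ forall i, nonzero_vec (double_center a i),
      forall j, germ_iso (germ_map a j)
    & forall u v, u != v -> ~ same_point (support a u) (support a v)].

Definition union_ideal (Z : 'I_r -> germ_scheme k) a : {pred S} :=
  [pred F | [forall i, F \in fat_point_ideal 2 (double_center a i)]
         && [forall j, F \in image_ideal (Z j) (germ_map a j)]].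

(* The parameter space is an open subset of an affine space, hence irreducible,
   and maps openly onto the space of tuples of subschemes. *)
Definition for_general_union (Z : 'I_r -> germ_scheme k)
    (Q : {pred S} -> Prop) :=
  exists U, [/\ zariski_open U, exists2 a, admissible a & U a
    & forall a, admissible a -> U a -> Q (union_ideal Z a)].

End Configurations.

(* Replacing a germ isomorphism by its jet modulo (x,y)^m changes neither the
   isomorphism property nor the image of Z. *)
Section Truncation.
Variables (Z : germ_scheme k) (m : nat).

Definition trunc (f : {mpoly k[2]}) : {mpoly k[2]} :=
  jet_poly (fun mo : 'X_{1..2 < m} => f@_mo).

Lemma trunc_coef f mo : (mdeg mo < m)%N -> (trunc f)@_mo = f@_mo.
Proof.
move=> h; rewrite /trunc /jet_poly linear_sum /= (bigD1 (BMultinom h)) //=.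
rewrite mcoeffZ mcoeffX eqxx mulr1 big1 ?addr0 // => i hi.
rewrite mcoeffZ mcoeffX; case: eqP => [E|_]; last by rewrite mulr0.
by case/eqP: hi; apply: val_inj.
Qed.


Lemma eval_origin (f : {mpoly k[2]}) : f.@[origin] = f@_0%MM.
Proof.
elim/mpolyind: f => [|c mo f _ _ IH]; first by rewrite meval0 mcoeff0.
rewrite mevalD mcoeffD IH mevalZ mcoeffZ mcoeffX mevalX; congr (_ * _ + _).
case: eqP => [->|hm]; first by rewrite big1 // => i _; rewrite mnm0E expr0.
have [i hi] : exists i, mo i != 0%N.
  apply/existsP; rewrite -negb_forall; apply/negP => /forallP h.
  by case: hm; apply/mnmP => i; rewrite mnm0E; apply/eqP; exact: h.
by rewrite (bigD1 i) //= /origin expr0n (negbTE hi) mul0r.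
Qed.

Lemma trunc_germ_iso phi : (1 < m)%N -> germ_iso phi -> germ_iso (trunc \o phi).
Proof.
move=> m1; rewrite /germ_iso; congr (\det _ != 0).
apply/matrixP => i j; rewrite !mxE !eval_origin.
case: j => [[|[|[|//]]] hj] /=; rewrite ?mcoeff_mderiv trunc_coef //.
- by rewrite mdeg0 ltnW.
- by rewrite mdegD mdeg0 mdeg1.
- by rewrite mdegD mdeg0 mdeg1.
Qed.

Lemma trunc_image_ideal phi : in_fat Z m ->
  image_ideal Z (trunc \o phi) =i image_ideal Z phi.
Proof.
move=> hm F.
have cong (f : S) : (f \mPo [tuple (trunc \o phi) i | i < 3])
                    - (f \mPo [tuple phi i | i < 3]) \in Z.
  pose ev (psi : 'I_3 -> {mpoly k[2]}) (g : S) := g \mPo [tuple psi i | i < 3].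
  rewrite -/(ev (trunc \o phi) f) -/(ev phi f).
  have evM psi g h : ev psi (g * h) = ev psi g * ev psi h by exact: rmorphM.
  have hM g h : ev (trunc \o phi) g - ev phi g \in Z ->
      ev (trunc \o phi) h - ev phi h \in Z ->
      ev (trunc \o phi) (g * h) - ev phi (g * h) \in Z.
    move=> hg hh; rewrite !evM.
    rewrite -(subrK (ev phi g * ev (trunc \o phi) h) (_ * _)) -addrA.
    rewrite -mulrBl -mulrBr mulrC; apply: germ_lin => //; exact: germM.
  have hX (i : 'I_3) : ev (trunc \o phi) 'X_i - ev phi 'X_i \in Z.
    rewrite /ev !comp_mpolyXU -!tnth_nth !tnth_mktuple /= -opprB -mulN1r; apply: germM.
    apply: (in_fat_high hm) => mo; apply: contraNT; rewrite -ltnNge => h.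
    by rewrite mcoeffB trunc_coef // subrr.
  have hXn (i : 'I_3) n : ev (trunc \o phi) ('X_i ^+ n) - ev phi ('X_i ^+ n) \in Z.
    elim: n => [|n IH]; last by rewrite exprS hM.
    by rewrite expr0 /ev !comp_mpoly1 subrr germ0.
  elim/mpolyind: f => [|c mo f _ _ IH]; first by rewrite /ev !comp_mpoly0 subrr germ0.
  have -> : ev (trunc \o phi) (c *: 'X_[mo] + f) - ev phi (c *: 'X_[mo] + f)
    = c *: (ev (trunc \o phi) 'X_[mo] - ev phi 'X_[mo])
      + (ev (trunc \o phi) f - ev phi f).
    by rewrite /ev !comp_mpolyD !comp_mpolyZ scalerBr opprD addrACA.
  apply: germD => //; apply: germZ; rewrite mpolyXE_id.
  elim/big_rec: _ => [|i u _ IHu]; last by rewrite hM.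
  by rewrite /ev !comp_mpoly1 subrr germ0.
rewrite !inE; apply/asboolP/asboolP => h d.
- have := germD (germM (-1) (cong (hcomp d F))) (h d).
  by rewrite mulN1r opprB subrK.
- by have := germD (cong (hcomp d F)) (h d); rewrite subrK.
Qed.

Lemma in_fat_mult : (mult Z <= m)%N -> in_fat Z m.
Proof.
rewrite /mult; case: ex_minnP => d hd _ ledm; apply/asboolP => f.
rewrite inE => /asboolP [n [a [g [hg ->]]]].
apply: germ_sum => i _; apply: germM; move/asboolP: hd; apply.
rewrite inE; apply/asboolP; exists 1%N.
pose wd := widen_ord ledm.
exists (fun=> \prod_(j < m | (d <= j)%N) g i j), (fun _ j => g i (wd j)).
split=> [_ j|]; first exact: hg.
rewrite big_ord1 (bigID (fun j : 'I_m => (j < d)%N)) /= mulrC; congr (_ * _).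
  by apply: eq_bigl => j; rewrite -leqNgt.
exact: (big_ord_narrow (F := g i) ledm).
Qed.

Lemma equivalent_trunc W : (1 < m)%N -> (mult Z <= m)%N -> equivalent Z W ->
  exists2 b : 'I_3 -> 'X_{1..2 < m} -> k,
    germ_iso (fun l => jet_poly (b l))
    & W =i image_ideal Z (fun l => jet_poly (b l)).
Proof.
move=> m1 /in_fat_mult hm [phi hphi hW].
exists (fun l mo => (phi l)@_mo); first exact: trunc_germ_iso.
by move=> F; rewrite hW -(trunc_image_ideal phi hm).
Qed.

End Truncation.
End Plane.

Arguments for_general_union {k} e {r} m Z Q.

(* Main.v *)
Require Import Defs.
From HB Require Import structures.
From mathcomp Require Import all_boot all_order all_algebra.
From mathcomp Require Import boolp.
From mathcomp Require Import mpoly.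
From mathcomp Require Import zify ring.

Set Implicit Arguments.
Unset Strict Implicit.
Unset Printing Implicit Defensive.

Import GRing.Theory.

(* The monomials of degree t are the lattice points (a, b) with a + b <= t, and
   a scheme of length l gives l functionals on forms, that is, a vector of k^l
   for every lattice point.  Translating the schemes one after the other by
   torus elements with weights a + (t + 1) b and letting the parameter tend to
   0, the functionals of all schemes are independent for some parameters as
   soon as the triangle contains disjoint sets of points, one for each scheme,
   on which the scheme has a greedy basis.

   In generic coordinates the greedy basis of a germ Z occupies the first n_0,
   n_1, ... free points of successive rows, where n_0 <= mult Z and, in
   characteristic 0, n_0 > n_1 > ... until it vanishes: differentiating a
   relation with leading term x^(n_b) y^b along the change of coordinates
   x + eps y gives one with leading term x^(n_b - 1) y^(b + 1).  A suitable germ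
   isomorphism also allows the lengths n_0 - 1, n_1 + 1, n_2, ...; for a double
   point these are (2, 1) and (1, 2).  So it remains to fill the triangle row by
   row with the germs, in decreasing order of n_0.  When the next germ
   overflows the current row by at least two points, double points fill that
   row; a row costs at most (m - 1) / 2 of them, which is the bound on e.

   For generic parameters all functionals are thus independent on the forms of
   degree t.  A Cech cocycle for the cover by the charts x_i != 0 is split by
   separating the monomials according to their degree in x_0, and the
   independence corrects the part with a pole along x_0 = 0 only so that it
   becomes a section of the ideal sheaf. *)

(** * Packing decreasing profiles in a triangle *)

(** The germ isomorphism is (x, y) -> [1 : 1 + x : 1 + y + c x^d], up to the torus. With c = 0 it
    gives the lengths n_0, n_1, ...; with d = n_0 - 1 - n_1 and c outside one bad value it moves one
    point from the first row to the second. The obstacle in the packing is a row that a piece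
    overflows by a single point: the moved point must find room in the row below. Room exists when
    the numbers of taken points drop by at least 2 from one row to the next, and the conditions
    [gaps] keep track of this. They are additive, so it suffices to check them piece by piece.

    The term 1 in the hypothesis on the lengths excludes the classical defective cases, two double
    points on conics and five on quartics, where the lengths just fit but the conditions are
    dependent. *)

Section Packing.
Variables (J : eqType) (lam : J -> nat -> nat).
Implicit Types (l u : nat -> nat) (L : seq J).

Definition shifted l i :=
  match i with 0 => (l 0).-1 | 1 => (l 1).+1 | _ => l i end.

(* Rows of s, s - 1, ... points are left, u i points of the i-th one are already
   taken, and each piece takes lam j i (or shifted (lam j) i) more of them. *)
Inductive packs : nat -> (nat -> nat) -> seq J -> Prop :=
| packs_nil s u : packs s u [::]
| packs_row s u L :
    s < u 0 -> packs s (fun i => u i.+1) L -> packs s.+1 u L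
| packs_normal s u j L : (forall i, lam j i <= s - i - u i) ->
    packs s (fun i => u i + lam j i) L -> packs s u (j :: L)
| packs_shift s u j L : lam j 1 < lam j 0 -> (lam j 0).-1 = s - u 0 ->
    (forall i, shifted (lam j) i <= s - i - u i) ->
    packs s (fun i => u i + shifted (lam j) i) L -> packs s u (j :: L).

Definition strict l := forall i, l i.+1 <= (l i).-1.

(* The drop u i - u i.+1 is at least u i / B i: where the profile is long, the
   next row has room for one point more than the current one. *)
Definition gaps (B : nat -> nat) u :=
  forall i, u i.+1 <= u i <= B i * (u i - u i.+1).

Lemma strict_le l i : strict l -> l i <= l 0 - i.
Proof. by move=> h; elim: i => [|i IH]; [rewrite subn0 | have := h i; lia]. Qed.

Lemma gaps_strict B u : gaps B u -> strict u.
Proof.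
move=> h i; have /andP [h1 h2] := h i.
have [|e] : u i.+1 < u i \/ u i.+1 = u i by lia.
  by lia.
by move: h2; rewrite -e subnn muln0; lia.
Qed.

Lemma gapsD B u l : gaps B u -> gaps B l -> gaps B (fun i => u i + l i).
Proof.
move=> hu hl i; have /andP [h1 h2] := hu i; have /andP [h3 h4] := hl i.
have -> : u i + l i - (u i.+1 + l i.+1) = (u i - u i.+1) + (l i - l i.+1) by lia.
by rewrite mulnDr !leq_add.
Qed.

Lemma strict_gaps B l : strict l -> (forall i, l i <= B i * (l i - l i.+1)) ->
  gaps B l.
Proof. by move=> sl h i; rewrite h andbT; have := sl i; lia. Qed.

Lemma strict_gaps_le B l : strict l -> (forall i, l i <= B i) -> gaps B l.
Proof.
move=> sl h; apply: strict_gaps => // i; have := sl i; have := h i.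
by case: (l i) => // n h1 h2; apply: leq_trans h1 (leq_pmulr _ _); lia.
Qed.

Definition mass N u := \sum_(i < N) u i.

Lemma massD N u l : mass N (fun i => u i + l i) = mass N u + mass N l.
Proof. exact: big_split. Qed.

Lemma mass_behead N u : u N = 0 -> mass N (fun i => u i.+1) + u 0 = mass N u.
Proof.
by move=> h; rewrite /mass addnC -(big_ord_recl N u) big_ord_recr /= h addn0.
Qed.

Lemma mass_shifted N l : 1 < N -> 0 < l 0 -> mass N (shifted l) = mass N l.
Proof.
rewrite /mass; case: N => [|[|N]] // _ h.
rewrite !big_ord_recl /= /bump /= !addnA.
by congr (_ + _); rewrite addn0; lia.
Qed.

Lemma mass_ge2 N u : 1 < N -> u 0 + u 1 <= mass N u.
Proof.
rewrite /mass; case: N => [|[|N]] // _.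
by rewrite !big_ord_recl /= /bump /= addnA addn0 leq_addr.
Qed.

(** Under [gaps (wide s)], a row of more than three points with a single free point has more points
    taken than this bound, so the next row has at least two fewer of them and two free points: the
    room for a shifted piece of width 2. *)
Definition wide s i := maxn 2 (s - 2 - i).

Lemma gaps_wide_behead s u : gaps (wide s.+1) u -> gaps (wide s) (fun i => u i.+1).
Proof.
by move=> h i; have := h i.+1; rewrite /wide; have -> : s.+1 - 2 - i.+1 = s - 2 - i by lia.
Qed.

Lemma pack_small N s u L :
  gaps (wide s) u -> u 0 <= s -> s + 1 < N ->
  (forall j, j \in L -> strict (lam j) /\ 0 < lam j 0 <= 2) ->
  2 * (mass N u + \sum_(j <- L) mass N (lam j) + 1) <= s * s.+1 ->
  packs s u L.
Proof.
have [n] := ubnP (s + size L); elim: n s u L => // n IH s u [|j L].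
  by move=> *; constructor.
move=> hn hu us hN hL area.
have su := gaps_strict hu; have su1 := su 0.
have [s0|c0] := eqVneq (u 0) s.
  case: s => [|s] in hn hu us hN area s0 *; first by lia.
  apply: packs_row; first by lia.
  apply: IH => //; [exact: gaps_wide_behead | lia | lia | ].
  have := mass_behead (N := N) (u := u); have := strict_le N su; nia.
have [sj /andP [j0 j2]] : strict (lam j) /\ 0 < lam j 0 <= 2 by apply: hL; rewrite inE eqxx.
have hL' : forall j', j' \in L -> strict (lam j') /\ 0 < lam j' 0 <= 2.
  by move=> j' hj'; apply: hL; rewrite inE hj' orbT.
have N1 : 1 < N by lia.
have u01 := mass_ge2 u N1; have j01 := mass_ge2 (lam j) N1.
have sj1 := sj 0; have ujs i := strict_le i sj; have us' i := strict_le i su.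
have hn' : s + size L < n by move: hn => /=; lia.
rewrite big_cons in area.
case: (leqP (lam j 0) (s - u 0)) => hc.
  apply: packs_normal.
    move=> i; have := ujs i; have := us' i; lia.
  apply: IH => //; [|lia|by rewrite massD; lia].
  apply: gapsD => //; apply: strict_gaps_le => // i; rewrite /wide; have := ujs i; lia.
have e0 : lam j 0 = 2 by lia.
have e1 : u 0 = s.-1 by lia.
have s2 : 2 <= s by case: (s) e1 area c0 us => [|[|s']] /=; lia.
(* Failure means [u 0 = s - 1] and [u 1 = s - 2], a drop of 1, so [gaps] forces s <= 3. The term 1
   in the area bound excludes s = 2 and s = 3; the latter is the case of two double points on
   conics. *)
have u1 : u 1 + lam j 1 + 2 <= s.
  have [//|h] := leqP (u 1 + lam j 1 + 2) s.
  have l1 : lam j 1 = 1 by lia.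
  have e : u 1 = s - 2 by lia.
  have /andP [_] := hu 0; rewrite /wide => h'.
  have hs : s <= 3.
    have e' : u 0 - u 1 = 1 by lia.
    by rewrite e' in h'; lia.
  have [es|es] : s = 2 \/ s = 3 by lia.
    by rewrite es in e1 e area; lia.
  by rewrite es in e1 e area; lia.
apply: packs_shift; [by lia|by lia| |].
  move=> [|[|i]] /=; [lia|lia|]; have := ujs i.+2; have := us' i.+2; lia.
case: s => [|s] in hn hn' hu us hN area c0 hc e1 s2 u1 *; first by lia.
apply: packs_row; first by move=> /=; lia.
apply: IH => //; [by lia| | by move=> /=; lia | by lia |].
  apply: gapsD; first exact: gaps_wide_behead.
  apply: strict_gaps_le => [[|i]|[|i]] /=; rewrite /wide; [have := ujs 2; lia| by apply: sj | lia|].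
  by have := ujs i.+2; lia.
have hN0 : u N + shifted (lam j) N = 0.
  by have := us' N; case: (N) hN => [|[|N']] //= hN; have := ujs N'.+2; lia.
have := mass_behead (N := N) (u := fun i => u i + shifted (lam j) i) hN0.
by rewrite [in X in _ = X]massD mass_shifted //=; nia.
Qed.

(* The area exceeds that of the double points kept for the remaining rows, so s
   is large. *)
Lemma row_room s m mu : 2 < mu -> mu <= m ->
  3 * ((m - 1) * (s - 2)) + 2 * s + 4 <= s * s.+1 -> m + mu <= s.
Proof.
move=> mu3 mum h; rewrite leqNgt; apply/negP => hs.
have s2 : 2 <= s by case: (s) h => [|[|]] //=; lia.
have [v ev] : exists v, s = v + 2 by exists (s - 2); lia.
have es : s - 2 = v by lia.
rewrite es {}ev in h hs *.
(* With s = v + 2, [h] reads 3 (m - 1) v + 2 <= v^2 + 3 v. Now m - 1 is bounded below by mu - 1 when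
   mu is large against v, and otherwise by v + 2 - mu, which is the negated claim. *)
case: (leqP (v + 7) (3 * mu)) => hv.
  have h1 : (v + 4) * v <= 3 * ((m - 1) * v) by rewrite mulnA leq_mul2r; lia.
  nia.
have h1 : 2 * v * v <= 3 * ((m - 1) * v) by rewrite mulnA leq_mul2r; lia.
nia.
Qed.

(** If [l 0 <= s - 2], then [l i <= wide s i] in every row. Otherwise the area leaves only s = 4 and
    l = (3, 0, ...), which drops to 0 at once. *)
Lemma big_piece_gaps s m l : strict l -> 2 < l 0 -> l 0 <= m ->
  3 * ((m - 1) * (s - 2)) + 2 * (l 0 + l 1) + 2 <= s * s.+1 -> gaps (wide s) l.
Proof.
move=> sl l3 lm h.
case: (leqP (l 0 + 2) s) => hs.
  by apply: strict_gaps_le => // i; have := strict_le i sl; rewrite /wide; lia.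
have s2 : 2 <= s by case: (s) h => [|[|]]; lia.
have [v ev] : exists v, s = v + 2 by exists (s - 2); lia.
have es : s - 2 = v by lia.
rewrite es {}ev in h hs *.
have h1 : v * v <= (m - 1) * v by rewrite leq_mul2r; lia.
have v3 : v < 3 by nia.
case: v => [|[|[|//]]] in h h1 hs es v3 *; [lia|lia|].
have e0 : l 0 = 3 by lia.
have e1 : l 1 = 0 by lia.
apply: strict_gaps => // -[|i]; first by rewrite e0 e1.
suff -> : l i.+1 = 0 by [].
by elim: i => // i IH; have := sl i.+1; rewrite IH; lia.
Qed.

(** The piece overflows the row by one point, so its shifted form completes the row; the drop of 2
    in [u] makes room for the extra point of the second row. *)
Lemma shift_fits B s u l : gaps B u -> strict l -> 0 < l 0 ->
  u 0 + l 0 = s.+1 -> u 1 + 2 <= u 0 -> forall i, shifted l i <= s - i - u i.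
Proof.
move=> /gaps_strict su sl l0 e u2.
have su1 i : u i.+1 <= u 1 - i.
  by elim: i => [|i IH]; [lia | have := su i.+1; lia].
case=> [|[|i]] /=; [lia | have := sl 0; lia |].
by have := su1 i.+1; have := strict_le i.+2 sl; lia.
Qed.

Lemma shift_gaps B u l : strict l -> (forall i, shifted l i.+1 <= B i) ->
  gaps B (fun i => u i.+1) -> gaps B (fun i => u i.+1 + shifted l i.+1).
Proof.
move=> sl hB hu; apply: gapsD => //.
by apply: strict_gaps_le => // -[|i] /=; [have := sl 1; lia | exact: sl].
Qed.

Definition is_double l := [/\ l 0 = 2, l 1 = 1 & forall i, l i.+2 = 0].

Lemma double_strict l : is_double l -> strict l.
Proof. by move=> [h0 h1 h2] [|[|i]]; rewrite ?h0 ?h1 ?h2. Qed.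

Lemma mass_double N l : 1 < N -> is_double l -> mass N l = 3.
Proof.
rewrite /mass; case: N => [|[|N]] // _ [h0 h1 h2].
by rewrite !big_ord_recl /= /bump /= addn0 h0 h1 big1.
Qed.

Lemma sum_mass_double N (ds : seq J) : 1 < N ->
  (forall j, j \in ds -> is_double (lam j)) ->
  \sum_(j <- ds) mass N (lam j) = 3 * size ds.
Proof.
move=> N1; elim: ds => [|d ds IH] h; first by rewrite big_nil.
rewrite big_cons (mass_double N1) ?IH ?mulnS // => [j hj|]; apply: h.
  by rewrite inE hj orbT.
exact: mem_head.
Qed.

(** The bound [gaps (fun=> m)] holds because every piece has width at most m, and gives a drop of 2
    as soon as more than m points of a row are taken. The bound [gaps (wide s)] is maintained for
    [pack_small], which takes over once only pieces of width at most 2 remain. The budget reserves m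
    - 1 halves of a double point for each row of at least three points. *)
Lemma pack_big N m s u Zs ds :
  1 < m -> gaps (fun=> m) u -> gaps (wide s) u -> u 0 <= s -> s + 1 < N ->
  sorted (fun i j => lam j 0 <= lam i 0) Zs ->
  (forall j, j \in Zs -> strict (lam j) /\ 0 < lam j 0 <= m) ->
  (forall j, j \in ds -> is_double (lam j)) ->
  (m - 1) * (s - 2) <= 2 * size ds ->
  2 * (mass N u + \sum_(j <- Zs) mass N (lam j) + 3 * size ds + 1) <= s * s.+1 ->
  exists2 L, perm_eq L (Zs ++ ds) & packs s u L.
Proof.
move=> m2.
have [n] := ubnP (s + size Zs); elim: n s u Zs ds => // n IH s u Zs ds.
move=> hn um us u0s sN sZ hZ hds budget area.
have N1 : 1 < N by lia.
have small : (forall j, j \in Zs -> lam j 0 <= 2) ->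
    exists2 L, perm_eq L (Zs ++ ds) & packs s u L.
  move=> Z2; exists (Zs ++ ds) => //; apply: (@pack_small N) => //.
    move=> j; rewrite mem_cat => /orP [hj|hj].
      by have [? /andP [-> _]] := hZ j hj; split=> //=; exact: Z2.
    by split; [exact/double_strict/hds | have [-> _ _] := hds j hj].
  by rewrite big_cat /= (sum_mass_double N1 hds); lia.
case: Zs => [|z Zs] in hn sZ hZ area small *; first exact: small.
have zle j : j \in z :: Zs -> lam j 0 <= lam z 0.
  rewrite inE => /orP [/eqP -> //|hj].
  have tr : transitive (fun i j => lam j 0 <= lam i 0).
    by move=> a b c /= h1 h2; exact: leq_trans h2 h1.
  by have /allP h := order_path_min tr sZ; exact: h.
case: (leqP (lam z 0) 2) => z2.
  by apply: small => j /zle h; exact: leq_trans h z2.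
move=> {small zle}.
have [sz /andP [_ zm]] := hZ z (mem_head _ _).
have hZ' j : j \in Zs -> strict (lam j) /\ 0 < lam j 0 <= m.
  by move=> hj; apply: hZ; rewrite inE hj orbT.
have sZ' : sorted (fun i j => lam j 0 <= lam i 0) Zs by exact: path_sorted sZ.
have zz := mass_ge2 (lam z) N1; have uu := mass_ge2 u N1.
have szi i := strict_le i sz.
have sui i := strict_le i (gaps_strict us).
have uN : u N = 0 by have := sui N; lia.
have area' := area; rewrite big_cons in area'.
have advance v (Zs' ds' : seq J) :
    size Zs' <= size Zs + 1 -> s > 0 ->
    gaps (fun=> m) (fun i => v i.+1) -> gaps (wide s.-1) (fun i => v i.+1) ->
    v 0 = s -> v 1 < s -> v N = 0 ->
    sorted (fun i j => lam j 0 <= lam i 0) Zs' ->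
    (forall j, j \in Zs' -> strict (lam j) /\ 0 < lam j 0 <= m) ->
    (forall j, j \in ds' -> is_double (lam j)) ->
    (m - 1) * (s.-1 - 2) <= 2 * size ds' ->
    2 * (mass N v + \sum_(j <- Zs') mass N (lam j) + 3 * size ds' + 1) <= s * s.+1 ->
    exists2 L, perm_eq L (Zs' ++ ds') & packs s v L.
  move=> hs s0 vm vw v0 v1 vN hs' hZs' hds' bud ar.
  have [||||||||||L pL kL] := IH s.-1 (fun i => v i.+1) Zs' ds' => //.
  - by move: hn => /=; lia.
  - by lia.
  - by lia.
  - have := mass_behead vN; case: (s) s0 ar v0 => // s' _ /=; nia.
  exists L => //; case: (s) s0 v0 kL => // s' _ v0 kL.
  by apply: packs_row => //; lia.
have spos : 0 < s by case: (s) area => //; lia.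
have behead_m v : gaps (fun=> m) v -> gaps (fun=> m) (fun i => v i.+1) by move=> h i; exact: h.
have [e0|u0] := eqVneq (u 0) s.
  apply: advance => //.
  - by move=> /=; lia.
  - by case: (s) us => // s'; apply: gaps_wide_behead.
  - by have := gaps_strict us 0; lia.
  - by apply: leq_trans budget; rewrite leq_mul2l; lia.
have pm : gaps (fun=> m) (lam z).
  by apply: strict_gaps_le => // i; have := szi i; lia.
case: (leqP (lam z 0) (s - u 0)) => hc.
  have pw : gaps (wide s) (lam z) by apply: (big_piece_gaps (m := m)) => //; lia.
  have [||||||||||L pL kL] := IH s (fun i => u i + lam z i) Zs ds => //.
  - by move: hn => /=; lia.
  - exact: gapsD.
  - exact: gapsD.
  - by lia.
  - by rewrite massD; lia.
  exists (z :: L); first by rewrite /= perm_cons.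
  apply: packs_normal => // i.
  by have := szi i; have := sui i; lia.
(* Fewer than [lam z 0] points of the row are free, so this gives [u 0 > m], hence a drop of at
   least 2 by [step2]. *)
have room : m + lam z 0 <= s by apply: row_room => //; lia.
have step2 v : gaps (fun=> m) v -> m < v 0 -> v 1 + 2 <= v 0.
  move=> hv v0; have /andP [h1 h2] := hv 0.
  have [|h3] := leqP (v 1 + 2) (v 0) => //.
  have h4 : v 0 - v 1 <= 1 by lia.
  by have := leq_mul (leqnn m) h4; lia.
have vanish v : v 0 <= s -> strict v -> v N = 0.
  by move=> v0 sv; have := strict_le N sv; lia.
have shift_step v j (Zs' ds' : seq J) :
    size Zs' <= size Zs + 1 -> strict (lam j) -> 1 < lam j 0 <= m ->
    lam j 0 + 2 <= s ->
    v 0 + lam j 0 = s.+1 -> m < v 0 -> gaps (fun=> m) v -> gaps (wide s) v ->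
    sorted (fun i j => lam j 0 <= lam i 0) Zs' ->
    (forall j, j \in Zs' -> strict (lam j) /\ 0 < lam j 0 <= m) ->
    (forall j, j \in ds' -> is_double (lam j)) ->
    (m - 1) * (s - 3) <= 2 * size ds' ->
    2 * (mass N v + mass N (lam j) + \sum_(j <- Zs') mass N (lam j) + 3 * size ds' + 1)
      <= s * s.+1 ->
    exists2 L, perm_eq L (Zs' ++ ds') & packs s v (j :: L).
  move=> hs sj /andP [j0 jm] js vj mv vm vw hs' hZs' hds' bud ar.
  have v2 := step2 _ vm mv.
  have sji i := strict_le i sj; have sv := gaps_strict vm.
  have [||||||||||||L pL kL] := advance (fun i => v i + shifted (lam j) i) Zs' ds' => //.
  - apply: shift_gaps => //.
    by move=> [|i] /=; [have := sj 0; lia | have := sji i.+2; lia].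
  - apply: shift_gaps => //; last by case: (s) vw => // s'; exact: gaps_wide_behead.
    by move=> [|i] /=; rewrite /wide; [have := sj 0; lia | have := sji i.+2; lia].
  - by move=> /=; lia.
  - by move=> /=; have := sj 0; lia.
  - rewrite (vanish v) //; last by lia.
    by case: (N) sN => [|[|N']] /= hN; [lia|lia|have := sji N'.+2; lia].
  - by apply: leq_trans bud; rewrite leq_mul2l; lia.
  - by rewrite massD mass_shifted; lia.
  exists L => //; apply: packs_shift => //; [by have := sj 0; lia|by lia|].
  by apply: (shift_fits vm) => //; lia.
(* On an overflow by exactly one point, [z] itself is shifted and no double point is spent. *)
have [e0|ne0] := eqVneq (u 0 + lam z 0) s.+1.
  have [|||||||||||||L pL kL] := shift_step u z Zs ds => //; try by lia.
  by exists (z :: L) => //=; rewrite perm_cons.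
(* The [c] free points are taken two at a time, an odd last one by a shifted double point: (c + odd
   c) / 2 double points in all. As [z] overflows by at least two, c <= m - 2, so c + odd c <= m - 1,
   which is what the budget releases between s and s - 1. *)
have fill c v ds' : v 0 + c = s -> m < v 0 -> gaps (fun=> m) v ->
    gaps (wide s) v -> (forall j, j \in ds' -> is_double (lam j)) ->
    (m - 1) * (s - 3) + c + odd c <= 2 * size ds' ->
    2 * (mass N v + \sum_(j <- z :: Zs) mass N (lam j) + 3 * size ds' + 1)
      <= s * s.+1 ->
    exists2 L, perm_eq L ((z :: Zs) ++ ds') & packs s v L.
  have [k] := ubnP c; elim: k c v ds' => // k IHk [|[|c]] v ds' ck v0 mv vm vw dds bud ar.
  - apply: advance => //; try by move=> /=; lia.
    + by case: (s) vw => // s'; exact: gaps_wide_behead.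
    + by have := step2 _ vm mv; lia.
    + by apply: vanish; [lia | exact: gaps_strict vm].
  - case: ds' => [|d ds'] in dds bud ar *; first by move: bud; rewrite muln0 leqn0 !addn_eq0 andbF.
    have dd := dds d (mem_head _ _); have [d0 d1 d2] := dd.
    have dds' j : j \in ds' -> is_double (lam j) by move=> hj; apply: dds; rewrite inE hj orbT.
    have [|||||||||||||L pL kL] := shift_step v d (z :: Zs) ds' => //; rewrite ?d0; try by lia.
    + by move=> /=; lia.
    + exact: double_strict.
    + by move: bud => /=; lia.
    + by rewrite (mass_double N1 dd); move: ar => /=; lia.
    exists (d :: L) => //.
    rewrite -cat_rcons -cats1 -!catA in pL *.
    by rewrite perm_sym perm_catC /= perm_cons perm_catC perm_sym.
  - case: ds' => [|d ds'] in dds bud ar *; first by move: bud; rewrite muln0 leqn0 !addn_eq0 andbF.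
    have dd := dds d (mem_head _ _); have [d0 d1 d2] := dd.
    have sd := double_strict dd.
    have dds' j : j \in ds' -> is_double (lam j) by move=> hj; apply: dds; rewrite inE hj orbT.
    have sv := gaps_strict vm.
    have [||||||||L pL kL] := IHk c (fun i => v i + lam d i) ds' => //.
    + by lia.
    + by lia.
    + by lia.
    + apply: gapsD => //; apply: strict_gaps_le => // i; have := strict_le i sd; lia.
    + apply: gapsD => //; apply: strict_gaps_le => // i; rewrite /wide; have := strict_le i sd; lia.
    + by move: bud => /=; lia.
    + by rewrite massD (mass_double N1 dd); move: ar => /=; lia.
    exists (d :: L).
      by rewrite perm_sym perm_catC /= perm_cons perm_catC perm_sym.
    apply: packs_normal => // i.
    by have := strict_le i sd; have := strict_le i sv; lia.
apply: (fill (s - u 0)) => //; [by lia | by lia |].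
have : (m - 1) * (s - 2) = (m - 1) * (s - 3) + (m - 1).
  by rewrite (_ : s - 2 = (s - 3).+1) ?mulnS 1?addnC //; lia.
by lia.
Qed.
End Packing.

Local Open Scope ring_scope.

(** * Generic widths of a cyclic module over two commuting matrices *)

Definition word (R : nzRingType) l (X Y : 'M[R]_l) (e : 'rV[R]_l) i j :=
  e *m X ^+ i *m Y ^+ j.

Lemma map_word (R S : nzRingType) (f : {rmorphism R -> S}) l (X Y : 'M[R]_l) e i j :
  map_mx f (word X Y e i j) = word (map_mx f X) (map_mx f Y) (map_mx f e) i j.
Proof. by rewrite /word !map_mxM !rmorphXn. Qed.

Lemma mulmx_exprS (R : nzRingType) l (A : 'M[R]_l) i : A ^+ i.+1 = A ^+ i *m A.
Proof. by rewrite exprSr. Qed.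

Lemma mulmx_exprSl (R : nzRingType) l (A : 'M[R]_l) i : A ^+ i.+1 = A *m A ^+ i.
Proof. by rewrite exprS. Qed.

Section CyclicModule.
Variables (F : fieldType) (l N : nat) (X Y : 'M[F]_l) (e : 'rV[F]_l).
Hypothesis XY : X *m Y = Y *m X.
Hypothesis XN : e *m X ^+ N = 0.

Local Notation word := (word X Y e).

Definition rows b : 'M_l := (\sum_(j < b) <<\matrix_(i < N) word i j>>)%MS.

Lemma comm_YX j : X *m Y ^+ j = Y ^+ j *m X.
Proof. by apply: (@commrX _ X Y j); rewrite /GRing.comm -!mulmxE. Qed.

Lemma wordX i j : word i j *m X = word i.+1 j.
Proof. by rewrite /word mulmx_exprS -!mulmxA comm_YX. Qed.

Lemma wordY i j : word i j *m Y = word i j.+1.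
Proof. by rewrite /word mulmx_exprS -!mulmxA. Qed.

Lemma word_high i j : (N <= i)%N -> word i j = 0.
Proof.
move=> h; rewrite /word -(subnKC h) exprD; rewrite -mulmxE mulmxA XN.
by rewrite !mul0mx.
Qed.

Lemma word_rows i j b : (j < b)%N -> (word i j <= rows b)%MS.
Proof.
move=> jb; case: (ltnP i N) => iN; last by rewrite word_high ?sub0mx.
rewrite (submx_trans _ (sumsmx_sup (Ordinal jb) _ (submx_refl _))) //= genmxE.
by rewrite -(rowK (fun i : 'I_N => word i j) (Ordinal iN)) row_sub.
Qed.

Lemma rows_sub b (A : 'M_l) :
  (forall i j, (j < b)%N -> (word i j <= A)%MS) -> (rows b <= A)%MS.
Proof.
move=> h; apply/sumsmx_subP => j _; rewrite genmxE; apply/row_subP => i.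
by rewrite rowK h.
Qed.

Lemma rows_mulX b (v : 'rV_l) : (v <= rows b)%MS -> (v *m X <= rows b)%MS.
Proof.
move=> h; apply: submx_trans (submxMr X h) _.
rewrite sumsmxMr; apply/sumsmx_subP => j _.
rewrite (eqmxMr X (genmxE _)); apply/row_subP => i.
by rewrite row_mul rowK wordX word_rows.
Qed.

Lemma rows_mulY b (v : 'rV_l) : (v <= rows b)%MS -> (v *m Y <= rows b.+1)%MS.
Proof.
move=> h; apply: submx_trans (submxMr Y h) _.
rewrite sumsmxMr; apply/sumsmx_subP => j _.
rewrite (eqmxMr Y (genmxE _)); apply/row_subP => i.
by rewrite row_mul rowK wordY word_rows ?ltnS.
Qed.

Lemma ex_width b : exists n, (word n b <= rows b)%MS.
Proof. by exists N; rewrite word_high ?sub0mx. Qed.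

Definition width b := ex_minn (ex_width b).

Lemma widthP b : (word (width b) b <= rows b)%MS.
Proof. by rewrite /width; case: ex_minnP. Qed.

Lemma width_min b n : (word n b <= rows b)%MS -> (width b <= n)%N.
Proof. by rewrite /width; case: ex_minnP => m _; exact. Qed.

Lemma width_le b : (width b <= N)%N.
Proof. by apply: width_min; rewrite word_high ?sub0mx. Qed.

Lemma word_width b i : (width b <= i)%N -> (word i b <= rows b)%MS.
Proof.
move/subnK <-; elim: (i - width b)%N => [|d IH]; first exact: widthP.
by rewrite addSn -wordX rows_mulX.
Qed.

(** Let i be the least index of a relation. Multiplying by X^(width b - i - 1) moves its term to
    index [width b - 1] and all later terms to indices where [word_width] absorbs them, which
    contradicts the minimality of the width. *)
Lemma word_free b (u : 'I_(width b) -> F) :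
  ((\sum_i u i *: word i b)%R <= rows b)%MS -> forall i, u i = 0.
Proof.
move=> hu i0; apply/eqP/negPn/negP => ui0.
have [i ui imin] := arg_minnP (P := fun i => u i != 0) (fun i => i : nat) ui0.
have shift d : ((\sum_i u i *: word (d + i) b)%R <= rows b)%MS.
  elim: d => [|d IH]; first by under eq_bigr do rewrite add0n.
  have -> : \sum_i u i *: word (d.+1 + i) b = (\sum_i u i *: word (d + i) b) *m X.
    by rewrite mulmx_suml; apply: eq_bigr => k _; rewrite -scalemxAl wordX.
  exact: rows_mulX.
have := shift (width b - i.+1)%N; rewrite (bigD1 i) //=.
set s := \sum_(k | _) _; have hs : (s <= rows b)%MS.
  apply: summx_sub => k ki; have [->|uk] := eqVneq (u k) 0.
    by rewrite scale0r sub0mx.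
  have ik : (i < k)%N by rewrite ltn_neqAle eq_sym (inj_eq val_inj) ki imin.
  apply: scalemx_sub; apply: word_width.
  by rewrite -[X in (X <= _)%N](subnK (ltn_ord i)) leq_add2l.
move=> h; have {}h : (u i *: word (width b - i.+1 + i) b <= rows b)%MS.
  by rewrite -[X in (X <= _)%MS](addrK s) addmx_sub // eqmx_opp.
have /width_min : (word (width b - i.+1 + i) b <= rows b)%MS.
  by rewrite -[word _ _](scalerK ui) scalemx_sub.
by rewrite leqNgt -[X in (_ < X)%N](subnK (ltn_ord i)) addnS ltnS leqnn.
Qed.

(** Modulo the earlier rows, the first [width b] words of row b are free by [word_free] and span the
    row by [word_width]. *)
Lemma rank_rows b : \rank (rows b.+1) = (\rank (rows b) + width b)%N.
Proof.
set R := \matrix_(i < width b) word i b.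
have inj (u : 'rV_(width b)) : (u *m R <= rows b)%MS -> u = 0.
  rewrite mulmx_sum_row => h; apply/rowP => i; rewrite mxE.
  apply: (word_free (u := fun i => u 0 i)).
  by move: h; under eq_bigr do rewrite rowK.
have rR : \rank R = width b.
  apply/eqP; rewrite -[_ == _]/(row_free R) -kermx_eq0; apply/eqP/row_matrixP => i.
  rewrite row0; apply: inj; rewrite -row_mul mulmx_ker row0; exact: sub0mx.
rewrite -rR -mxrank_disjoint_sum.
  apply/eqmx_rank; rewrite /rows big_ord_recr /=.
  apply/andP; split.
    rewrite addsmx_sub addsmxSl genmxE; apply/row_subP => i; rewrite rowK.
    case: (ltnP i (width b)) => h.
      apply: submx_trans (addsmxSr _ _).
      by rewrite -(rowK (fun i : 'I__ => word i b) (Ordinal h)) row_sub.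
    exact: submx_trans (word_width h) (addsmxSl _ _).
  rewrite addsmx_sub addsmxSl; apply/row_subP => i; rewrite rowK.
  have iN : (i < N)%N by exact: leq_trans (ltn_ord i) (width_le b).
  apply: submx_trans (addsmxSr _ _); rewrite genmxE.
  by rewrite -(rowK (fun i : 'I_N => word i b) (Ordinal iN)) row_sub.
apply/eqP; rewrite -submx0; apply/row_subP => i.
set v := row _ _; have : (v <= rows b :&: R)%MS by exact: row_sub.
rewrite sub_capmx => /andP [h1 /submxP [u eu]].
by rewrite eu (inj u) ?mul0mx ?sub0mx // -eu.
Qed.

Lemma sum_width b : (\sum_(j < b) width j)%N = \rank (rows b).
Proof.
elim: b => [|b IH]; first by rewrite /rows !big_ord0 mxrank0.
by rewrite big_ord_recr /= IH rank_rows.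
Qed.

Lemma rowsP b (v : 'rV_l) : (v <= rows b)%MS ->
  exists c : nat -> nat -> F, v = \sum_(j < b) \sum_(i < N) c i j *: word i j.
Proof.
case/sub_sums_genmxP => u ->.
exists (fun i j => if insub j is Some jb then
   if insub i is Some iN then u jb 0 iN else 0 else 0).
apply: eq_bigr => j _; rewrite mulmx_sum_row; apply: eq_bigr => i _.
by rewrite !valK rowK.
Qed.

End CyclicModule.

Lemma char0_natr_inj (F : fieldType) : [pchar F] =i pred0 ->
  injective (fun n : nat => n%:R : F).
Proof.
move=> /pcharf0P h m n; wlog le_mn : m n / (m <= n)%N.
  by move=> H; case: (leqP m n) => [|/ltnW] /H // H' e; rewrite H'.
move=> e; have := h (n - m)%N; rewrite natrB // e subrr eqxx.
by move/esym/eqP => e0; apply/eqP; rewrite eqn_leq le_mn -subn_eq0 e0.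
Qed.

Lemma char0_nonroot (F : fieldType) (p : {poly F}) : [pchar F] =i pred0 ->
  p != 0 -> exists2 x, x != 0 & ~~ root p x.
Proof.
move=> h p0.
have q0 : p * 'X != 0 by rewrite mulf_neq0 // polyX_eq0.
pose rs := [seq i%:R : F | i <- iota 0 (size (p * 'X))].
have : ~~ all (root (p * 'X)) rs.
  apply/negP => ha; have := max_poly_roots q0 ha.
  rewrite map_inj_uniq ?iota_uniq; last exact: char0_natr_inj.
  by rewrite size_map size_iota ltnn => /(_ isT).
case/allPn => x _; rewrite rootM negb_or rootX => /andP [hx x0].
by exists x.
Qed.

Lemma frac_ratio (R : idomainType) (x : {fraction R}) :
  exists n d : R, d != 0 /\ tofrac d * x = tofrac n.
Proof.
elim/quotW: x => r; exists \n_r, \d_r; split; first exact: denom_ratioP.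
apply/eqP; rewrite -[_ * _]/(FracField.mul _ _) !piE.
rewrite /FracField.equivf /FracField.mulf !numden_Ratio ?mulf_neq0 ?oner_eq0 ?denom_ratioP //=.
by rewrite mulr1 mul1r.
Qed.

Lemma frac_common_denom (R : idomainType) (I : finType) (f : I -> {fraction R}) :
  exists2 q : R, q != 0 & exists g : I -> R, forall i, tofrac q * f i = tofrac (g i).
Proof.
have [n /fin_all_exists [d h]] := fin_all_exists (fun i => frac_ratio (f i)).
exists (\prod_i d i); first by apply/prodf_neq0 => i _; case: (h i).
exists (fun i => n i * \prod_(j | j != i) d j) => i; have [_ e] := h i.
by rewrite (bigD1 i) //= !tofracM mulrAC e.
Qed.

Lemma derivmxM (R : comNzRingType) m n p (A : 'M[{poly R}]_(m, n)) (B : 'M_(n, p)) :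
  map_mx deriv (A *m B) = map_mx deriv A *m B + A *m map_mx deriv B.
Proof.
apply/matrixP => i j; rewrite !mxE linear_sum -big_split /=.
by apply: eq_bigr => s _; rewrite derivM !mxE.
Qed.

Section GenericWidth.
Variables (k : fieldType) (l N : nat) (X0 Y : 'M[k]_l) (e : 'rV[k]_l).
Hypothesis char0 : [pchar k] =i pred0.
Hypothesis XY : X0 *m Y = Y *m X0.
Hypothesis nilp : forall i j, (N <= i + j)%N -> word X0 Y e i j = 0.
Hypothesis cyclic : forall V : 'M[k]_l,
  (forall i j, (word X0 Y e i j <= V)%MS) -> (1%:M <= V)%MS.

Local Notation R := {poly k}.
Local Notation K := {fraction R}.

Definition pencil (S : comNzRingType) (f : k -> S) (z : S) :=
  map_mx f X0 + z *: map_mx f Y.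

Let Xp : 'M[R]_l := pencil polyC 'X.
Let Yp : 'M[R]_l := map_mx polyC Y.
Let ep : 'rV[R]_l := map_mx polyC e.
Let wp := word Xp Yp ep.

Lemma pencil_comm (S : comNzRingType) (f : {rmorphism k -> S}) z :
  pencil f z *m map_mx f Y = map_mx f Y *m pencil f z.
Proof.
by rewrite /pencil mulmxDl mulmxDr -!map_mxM XY -scalemxAl -scalemxAr.
Qed.

(** Expanding the power of X0 + z Y produces only words of the same total degree i + j in X0 and
    Y. *)
Lemma pencil_nilp (S : comNzRingType) (f : {rmorphism k -> S}) z i j :
  (N <= i + j)%N -> word (pencil f z) (map_mx f Y) (map_mx f e) i j = 0.
Proof.
move=> hij.
have gen n a b : (N <= n + a + b)%N ->
    map_mx f (word X0 Y e a b) *m pencil f z ^+ n = 0.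
  elim: n a b => [|n IH] a b h; first by rewrite nilp ?map_mx0 ?mul0mx.
  rewrite mulmx_exprSl mulmxA /pencil mulmxDr -map_mxM -scalemxAr -map_mxM.
  rewrite wordX // wordY // mulmxDl -scalemxAl -/(pencil f z) !IH ?scaler0 ?addr0 //.
    by rewrite addnS in h *.
  by rewrite addnS addSn -addnS in h *.
have := gen i 0%N j; rewrite addn0 => /(_ hij) <-.
rewrite /word expr0 mulmx1 map_mxM rmorphXn -!mulmxA; congr (_ *m _).
rewrite !mulmxE; apply: commrX; apply/commr_sym/commrX.
by rewrite /GRing.comm -!mulmxE pencil_comm.
Qed.

Lemma deriv_wp i j : map_mx deriv (wp i j) = i%:R *: wp i.-1 j.+1.
Proof.
have dC m n (A : 'M[k]_(m, n)) : map_mx deriv (map_mx polyC A) = 0.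
  by apply/matrixP => a b; rewrite !mxE derivC.
have dX : map_mx deriv Xp = Yp.
  apply/matrixP => a b; rewrite !mxE derivD derivM !derivC derivX.
  by rewrite add0r mul1r mulr0 addr0.
have XYp : Xp *m Yp = Yp *m Xp by exact: pencil_comm.
have d0 m : map_mx deriv (ep *m Xp ^+ m) = m%:R *: (ep *m Xp ^+ m.-1 *m Yp).
  elim: m => [|m IH]; first by rewrite expr0 mulmx1 dC scale0r.
  rewrite mulmx_exprS mulmxA derivmxM IH dX /=.
  rewrite -scalemxAl -[_ *m Yp *m Xp]mulmxA -XYp mulmxA.
  case: m {IH} => [|m]; first by rewrite scale0r add0r scale1r.
  rewrite /= -[_ *m Xp ^+ m *m Xp]mulmxA -mulmx_exprS.
  by rewrite -{2}[_ *m Yp]scale1r -scalerDl natr1.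
rewrite /wp /word derivmxM d0 -[Yp ^+ j]/(map_mx polyC Y ^+ j) -rmorphXn /= dC mulmx0 addr0.
by rewrite -scalemxAl mulmx_exprSl mulmxA rmorphXn.
Qed.

Local Notation toK := (@tofrac R).

Let XK : 'M[K]_l := map_mx toK Xp.
Let YK : 'M[K]_l := map_mx toK Yp.
Let eK : 'rV[K]_l := map_mx toK ep.

Let XYp : Xp *m Yp = Yp *m Xp. Proof. exact: pencil_comm. Qed.

Let XYK : XK *m YK = YK *m XK. Proof. by rewrite -!map_mxM XYp. Qed.

Let wpK i j : map_mx toK (wp i j) = word XK YK eK i j.
Proof. exact: map_word. Qed.

Let wK_nilp i j : (N <= i + j)%N -> word XK YK eK i j = 0.
Proof. by move=> h; rewrite -wpK /wp (pencil_nilp _ _ h) map_mx0. Qed.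

Let XNK : eK *m XK ^+ N = 0.
Proof. by have := @wK_nilp N 0; rewrite addn0 /word mulmx1 => ->. Qed.

Let XNk : e *m X0 ^+ N = 0.
Proof. by have := @nilp N 0; rewrite addn0 /word mulmx1 => ->. Qed.

Let full_k : (1%:M <= rows N X0 Y e N)%MS.
Proof.
apply: cyclic => i j; case: (ltnP j N) => h; first exact: word_rows.
by rewrite nilp ?sub0mx // (leq_trans h) ?leq_addl.
Qed.

(** The span V of the words in the new coordinates is stable under X and Y, hence under X0 = X - eps
    Y. So it contains all words in X0 and Y, and these generate already over k. *)
Let full_K : (1%:M <= rows N XK YK eK N)%MS.
Proof.
set V := rows _ _ _ _ _.
have hY (v : 'rV_l) : (v <= V)%MS -> (v *m YK <= V)%MS.
  move=> h; apply: submx_trans (rows_mulY XNK h) _; apply: rows_sub => i j _.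
  case: (ltnP j N) => hj; first exact: word_rows.
  by rewrite wK_nilp ?sub0mx // (leq_trans hj) ?leq_addl.
have hX (v : 'rV_l) : (v <= V)%MS -> (v *m XK <= V)%MS by exact: rows_mulX.
pose X0K := map_mx toK (map_mx polyC X0).
have X0E : X0K = XK - toK 'X *: YK.
  by rewrite /XK /Xp /pencil map_mxD map_mxZ addrK.
have hw i j : (word X0K YK eK i j <= V)%MS.
  have hi : (eK *m X0K ^+ i <= V)%MS.
    elim: i => [|i IH].
      have e00 : eK *m X0K ^+ 0 = word XK YK eK 0 0 by rewrite /word !mulmx1.
      rewrite e00; have [N0|Npos] := posnP N; last exact: word_rows.
      by rewrite wK_nilp ?sub0mx // N0.
    rewrite mulmx_exprS mulmxA {2}X0E mulmxBr -scalemxAr.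
    by apply: addmx_sub; [exact: hX IH | rewrite eqmx_opp scalemx_sub //; exact: hY IH].
  rewrite /word; elim: j => [|j IH]; first by rewrite mulmx1.
  by rewrite mulmx_exprS mulmxA hY.
apply/row_subP => i; rewrite row1.
have /rowsP [c ec] := row_subP full_k i.
have -> : delta_mx 0 i = map_mx toK (map_mx polyC (row i 1%:M)) :> 'rV[K]_l.
  by rewrite row1 !map_delta_mx.
rewrite ec !raddf_sum /=; apply: summx_sub => j _.
rewrite !raddf_sum /=; apply: summx_sub => s _.
by rewrite !map_mxZ scalemx_sub // !map_word; exact: hw.
Qed.

Let n := width YK XNK.

(** Denominators are cleared because the relation is differentiated, and later specialised, with
    coefficients in k[eps]. *)
Let relation b : exists2 q : R, q != 0 & exists g : nat -> nat -> R,
  q *: wp (n b) b = \sum_(j < b) \sum_(i < N) g i j *: wp i j.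
Proof.
have /rowsP [c ec] := widthP YK XNK b.
have [q q0 [g hg]] := frac_common_denom (fun p : 'I_N * 'I_b => c p.1 p.2).
exists q => //; exists (fun i j => if insub i is Some iN then
  if insub j is Some jb then g (iN, jb) else 0 else 0).
have inj (m : nat) (u v : 'rV[R]_m) : map_mx toK u = map_mx toK v -> u = v.
  move=> /rowP h; apply/rowP => i; apply/eqP; rewrite -tofrac_eq; apply/eqP.
  by have := h i; rewrite !mxE.
apply: inj; rewrite map_mxZ wpK ec scaler_sumr raddf_sum; apply: eq_bigr => j _.
rewrite scaler_sumr raddf_sum; apply: eq_bigr => i _.
by rewrite /= map_mxZ wpK !valK scalerA; congr (_ *: _); exact: (hg (i, j)).
Qed.

Let natK_neq0 m : m.+1%:R != 0 :> K.
Proof.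
rewrite -(rmorph_nat toK) tofrac_eq0 -polyC_natr polyC_eq0.
by have /pcharf0P -> := char0.
Qed.

(* Derivative of the relation for x^(n b) y^b with respect to eps, where
   x = X0 + eps Y, so that x' = y. *)
Let strict_n : strict n.
Proof.
move=> b; have [q q0 [g hg]] := relation b.
(* For an empty row the derivative carries no information; multiplying its relation by Y shows that
   the next row is empty too. *)
have [n0|n0] := posnP (n b).
  rewrite n0; apply: width_min; rewrite -wordY //.
  apply: rows_mulY => //; have := widthP YK XNK b.
  by rewrite -[width _ _ _]/(n b) n0.
apply: width_min.
have hd (a : R) i j : map_mx deriv (a *: wp i j) =
    a^`() *: wp i j + (a * i%:R) *: wp i.-1 j.+1.
  rewrite -mul_scalar_mx derivmxM deriv_wp -scalemxAr !mul_scalar_mx.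
  congr (_ + _); last by rewrite scalerA mulrC.
  rewrite (_ : map_mx deriv a%:M = a^`()%:M) ?mul_scalar_mx //.
  by apply/matrixP => s t; rewrite !mxE; case: eqP; rewrite ?mulr1n ?mulr0n ?deriv0.
have /(congr1 (map_mx toK \o map_mx deriv)) := hg.
rewrite /= hd map_mxD !map_mxZ !wpK => hD.
(* This is the coefficient of the new leading term, where characteristic 0 enters. *)
have c0 : toK (q * (n b)%:R) != 0.
  by rewrite tofracM mulf_neq0 ?tofrac_eq0 // -tofrac_eq0 rmorph_nat -(prednK n0) natK_neq0.
rewrite -[word _ _ _ _ _](scalerK c0) scalemx_sub //.
move/(canRL (addKr _)): hD => ->.
rewrite addmx_sub //.
  rewrite eqmx_opp scalemx_sub //; apply: submx_trans (widthP YK XNK b) _.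
  by apply: rows_sub => i j jb; apply: word_rows => //; exact: ltnW.
rewrite !raddf_sum /=; apply: summx_sub => j _.
rewrite !raddf_sum /=; apply: summx_sub => i _.
rewrite hd map_mxD !map_mxZ !wpK.
by apply: addmx_sub; apply: scalemx_sub; apply: word_rows; rewrite ?ltnS // ltnW.
Qed.

(* The widths are those over k(eps); eps is then specialised outside the zeros
   of the denominators of finitely many relations. *)
Lemma generic_widths : exists (eps : k) (n : nat -> nat),
  let Xe := X0 + eps *: Y in
  [/\ strict n, (n 0 <= N)%N, (\sum_(j < N) n j)%N = l &
   forall b, exists c : nat -> nat -> k,
     word Xe Y e (n b) b = \sum_(j < b) \sum_(i < N) c i j *: word Xe Y e i j].
Proof.
have [q hq0 hq] := fin_all_exists2 (fun b : 'I_N => relation b).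
have q0 : \prod_b q b != 0 by apply/prodf_neq0.
have [eps _ /negP heps] := char0_nonroot char0 q0.
have he b : (q b).[eps] != 0.
  apply/negP => h; apply: heps; rewrite /root horner_prod.
  by apply/prodf_eq0; exists b.
exists eps, n; split => //.
- exact: width_le.
- by rewrite sum_width ?XYK //; apply/eqP; move: full_K; rewrite sub1mx.
move=> b; set Xe := X0 + _; pose ev := horner_eval eps.
have evw i j : map_mx ev (wp i j) = word Xe Y e i j.
  rewrite /wp map_word; congr word.
  - by rewrite /Xp /pencil; apply/matrixP => s t; rewrite !mxE /= /horner_eval !hornerE.
  - by apply/matrixP => s t; rewrite !mxE /= /horner_eval hornerC.
  - by apply/matrixP => s t; rewrite !mxE /= /horner_eval hornerC.
case: (ltnP b N) => bN; last first.
  exists (fun _ _ => 0); rewrite big1 => [|j _]; last by rewrite big1 // => i _; rewrite scale0r.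
  rewrite -evw /wp pencil_nilp ?map_mx0 //.
  by rewrite (leq_trans bN) ?leq_addl.
have [g hg] := hq (Ordinal bN).
exists (fun i j => (g i j).[eps] / (q (Ordinal bN)).[eps]).
have /(congr1 (map_mx ev)) := hg; rewrite map_mxZ evw => hg'.
rewrite -[LHS](scalerK (he (Ordinal bN))) -[(q _).[eps]]/(ev _) {}hg'.
rewrite raddf_sum scaler_sumr; apply: eq_bigr => j _.
rewrite raddf_sum scaler_sumr; apply: eq_bigr => i _ /=.
by rewrite map_mxZ evw scalerA mulrC.
Qed.

End GenericWidth.

(** * Greedy bases on lattice points *)

Section Binomial.
Variable k : fieldType.
Hypothesis char0 : [pchar k] =i pred0.

Let natr_neq0 n : (0 < n)%N -> n%:R != 0 :> k.
Proof. by have /pcharf0P -> := char0; case: n. Qed.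

Lemma horner_ffact (a s : nat) :
  (\prod_(i <- iota 0 s) ('X - (i%:R : k)%:P)).[a%:R] = (a ^_ s)%:R.
Proof.
elim: s => [|s IH]; first by rewrite big_nil hornerC.
rewrite -addn1 iotaD add0n big_cat /= hornerM IH big_seq1 !hornerE addn1 ffactnSr natrM.
case: (leqP s a) => h; first by rewrite natrB.
by rewrite ffact_small // !mul0r.
Qed.

(** In characteristic 0 the binomial 'C(a, s) is a polynomial of degree s in a, so the sum has
    degree less than [size A] and vanishes on A, hence identically. Its values at 0, 1, ... then
    give [h s = 0] one after the other, the system being triangular. *)
Lemma binomial_interp (A : seq nat) (h : nat -> k) : uniq A ->
  (forall a, a \in A -> \sum_(s < size A) 'C(a, s)%:R * h s = 0) ->
  forall s, (s < size A)%N -> h s = 0.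
Proof.
move=> uA hA; set n := size A.
pose q s : {poly k} := (h s / (s`!)%:R) *: \prod_(i <- iota 0 s) ('X - i%:R%:P).
have qE s a : (q s).[a%:R] = 'C(a, s)%:R * h s.
  by rewrite hornerZ horner_ffact -bin_ffact natrM mulrCA divfK // natr_neq0 ?fact_gt0.
have P0 : \sum_(s < n) q s = 0.
  apply: (roots_geq_poly_eq0 (rs := [seq a%:R | a <- A])).
  - apply/allP => _ /mapP [a aA ->]; rewrite /root horner_sum; apply/eqP.
    by under eq_bigr do rewrite qE; exact: hA.
  - by rewrite map_inj_uniq //; exact: char0_natr_inj.
  rewrite size_map (leq_trans (size_sum _ _ _)) //; apply/bigmax_leqP => s _.
  by rewrite (leq_trans (size_scale_leq _ _)) // size_prod_XsubC size_iota ltn_ord.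
elim/ltn_ind => s IH sn.
have := congr1 (fun p => p.[s%:R]) P0; rewrite horner_sum horner0 (bigD1 (Ordinal sn)) //=.
rewrite qE binn mul1r big1 ?addr0 // => i ni; rewrite qE.
case: (ltngtP i s) => [lt|gt|e].
- by rewrite IH ?mulr0.
- by rewrite bin_small // mul0r.
- by rewrite -val_eqE /= e eqxx in ni.
Qed.

Let binmx (A : seq nat) : 'M[k]_(size A) := \matrix_(i, j) 'C(nth 0%N A i, j)%:R.

Let binmx_unit A : uniq A -> binmx A \in unitmx.
Proof.
move=> uA; rewrite -unitmx_tr -row_free_unit; apply: inj_row_free => v hv.
pose h s := if insub s is Some i then v 0 i else 0.
have h0 : forall s, (s < size A)%N -> h s = 0.
  apply: binomial_interp => // a aA; have aA' := aA; rewrite -index_mem in aA'.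
  have := congr1 (fun m : 'rV_ _ => m 0 (Ordinal aA')) hv; rewrite !mxE => e; rewrite -[RHS]e.
  by apply: eq_bigr => s _; rewrite !mxE /h valK /= nth_index // mulrC.
by apply/rowP => i; have := h0 i (ltn_ord i); rewrite /h valK mxE.
Qed.

Lemma binomial_solve (A : seq nat) (f : nat -> k) : uniq A ->
  exists h : nat -> k, forall a, a \in A ->
    \sum_(s < size A) 'C(a, s)%:R * h s = f a.
Proof.
move=> uA; pose v := invmx (binmx A) *m \col_i f (nth 0%N A i).
exists (fun s => if insub s is Some i then v i 0 else 0) => a aA.
have aA' := aA; rewrite -index_mem in aA'.
have : binmx A *m v = \col_i f (nth 0%N A i) by rewrite mulKVmx ?binmx_unit.
move/(congr1 (fun m : 'cV_ _ => m (Ordinal aA') 0)); rewrite !mxE /= nth_index // => <-.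
by apply: eq_bigr => s _; rewrite valK !mxE /= nth_index.
Qed.

Lemma binomial_dual (A : seq nat) (f : nat -> k) : uniq A ->
  exists g : nat -> k, forall s, (s < size A)%N ->
    \sum_(a <- A) g a * 'C(a, s)%:R = f s.
Proof.
move=> uA; pose v := (\row_i f i) *m invmx (binmx A).
exists (fun a => if insub (index a A) is Some i then v 0 i else 0) => s sA.
have : v *m binmx A = \row_i f i by rewrite mulmxKV ?binmx_unit.
move/(congr1 (fun m : 'rV_ _ => m 0 (Ordinal sA))); rewrite !mxE /= => <-.
rewrite (big_nth 0%N) big_mkord; apply: eq_bigr => i _.
by rewrite index_uniq // valK !mxE.
Qed.

End Binomial.

Section Placement.
Variables (k : fieldType) (A : comAlgType k) (x y : A) (N : nat).
Variables (n : nat -> nat) (r : nat -> nat -> nat -> k).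
Hypothesis char0 : [pchar k] =i pred0.

(* The functionals on A vanishing on an ideal containing x^N, y^N and
   x^(n b) y^b - sum_(j < b, i < N) r b i j x^i y^j for every b. *)
Definition dual_functional (H : A -> k) :=
  [/\ forall c p q, H (c *: p + q) = c * H p + H q,
      forall p, H (x ^+ N * p) = 0, forall p, H (y ^+ N * p) = 0
    & forall b p, H (x ^+ n b * y ^+ b * p) =
        \sum_(j < b) \sum_(i < N) r b i j * H (x ^+ i * y ^+ j * p)].

Definition kills b (H : A -> k) := forall i j, (j < b)%N -> H (x ^+ i * y ^+ j) = 0.

Lemma dual_functional_mul s H : dual_functional H ->
  dual_functional (fun p => H (s * p)).
Proof.
case=> h1 h2 h3 h4; split=> [c p q|p|p|b p]; rewrite ?mulrDr -?scalerAr ?h1 //.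
- by rewrite mulrCA h2.
- by rewrite mulrCA h3.
rewrite mulrCA h4; apply: eq_bigr => j _; apply: eq_bigr => i _.
by rewrite [s * _]mulrCA.
Qed.

Section Functional.
Variable H : A -> k.
Hypothesis dH : dual_functional H.

Lemma functional0 : H 0 = 0.
Proof.
case: dH => h _ _ _; have := h 1 0 0; rewrite scaler0 addr0 mul1r => e.
by apply: (addrI (H 0)); rewrite addr0 -e.
Qed.

Lemma functionalD p q : H (p + q) = H p + H q.
Proof. by case: dH => h _ _ _; rewrite -[p]scale1r h mul1r scale1r. Qed.

Lemma functionalZ c p : H (c *: p) = c * H p.
Proof. by case: dH => h _ _ _; rewrite -[c *: p]addr0 h functional0 addr0. Qed.

Lemma functionalMn p m : H (p *+ m) = m%:R * H p.
Proof. by rewrite -functionalZ scaler_nat. Qed.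

Lemma functional_sum (I : Type) (s : seq I) (P : pred I) (f : I -> A) :
  H (\sum_(i <- s | P i) f i) = \sum_(i <- s | P i) H (f i).
Proof. by apply: (big_morph H functionalD functional0). Qed.

Lemma functional_high i p : (N <= i)%N -> H (x ^+ i * p) = 0.
Proof.
by case: dH => _ h _ _ hi; rewrite -(subnKC hi) exprD -mulrA h.
Qed.

Lemma sum_exp_widen a (f : nat -> k) : (forall i, (N <= i)%N -> f i = 0) ->
  \sum_(i < a.+1) 'C(a, i)%:R * f i = \sum_(i < N) 'C(a, i)%:R * f i.
Proof.
move=> hf; rewrite !(big_ord_widen (a.+1 + N) (fun i => 'C(a, i)%:R * f i)) ?leq_addl ?leq_addr //.
rewrite big_mkcond [RHS]big_mkcond; apply: eq_bigr => i _ /=.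
case: ltnP => h1; case: ltnP => h2 //.
  by rewrite hf // mulr0.
by rewrite bin_small ?mul0r.
Qed.

Lemma functional_exp a p :
  H ((1 + x) ^+ a * p) = \sum_(i < N) 'C(a, i)%:R * H (x ^+ i * p).
Proof.
rewrite exprDn mulr_suml functional_sum -(sum_exp_widen a (f := fun i => H (x ^+ i * p))).
  by apply: eq_bigr => i _; rewrite expr1n mul1r [X in H X]mulrnAl functionalMn.
by move=> i; exact: functional_high.
Qed.

Lemma kills_lower c d b : kills b H ->
  forall s m j, (j < b)%N -> H (x ^+ s * ((1 + c *: x ^+ d) ^+ m * y ^+ j)) = 0.
Proof.
move=> hb s m j jb; rewrite exprDn mulr_suml mulr_sumr functional_sum big1 // => i _.
rewrite expr1n mul1r exprZn -exprM [X in H (_ * X)]mulrnAl [X in H X]mulrnAr functionalMn.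
by rewrite -scalerAl -scalerAr functionalZ [X in H X]mulrA -exprD hb ?mulr0.
Qed.

(** All other terms of the binomial expansion contain a power of y below b, so the coordinate change
    is invisible on the first row not yet killed. *)
Lemma kills_leading c d b s : kills b H ->
  H (x ^+ s * (1 + y + c *: x ^+ d) ^+ b) = H (x ^+ s * y ^+ b).
Proof.
move=> hb; rewrite addrAC exprDn mulr_sumr functional_sum big_ord_recr /=.
rewrite big1 ?add0r => [|i _].
  by rewrite subnn expr0 mul1r binn mulr1n.
by rewrite [X in H X]mulrnAr functionalMn (kills_lower _ _ hb) ?mulr0.
Qed.

Lemma kills_widthP b t : kills b H -> H (x ^+ (n b + t) * y ^+ b) = 0.
Proof.
case: dH => _ _ _ h hb; rewrite exprD mulrAC h big1 // => j _; rewrite big1 // => i _.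
by rewrite mulrAC -exprD hb ?mulr0.
Qed.

(** The relation of row b reduces x^s y^b with s >= n b to killed rows. On the remaining n b unknown
    values, the n b conditions from S form an invertible system of binomials, whatever the set S. *)
Lemma kills_row c d b (S : seq nat) : (n b <= N)%N ->
  kills b H -> uniq S -> size S = n b ->
  (forall a, a \in S -> H ((1 + x) ^+ a * (1 + y + c *: x ^+ d) ^+ b) = 0) ->
  kills b.+1 H.
Proof.
move=> nN hb uS sS hS.
have row s : H (x ^+ s * y ^+ b) = 0.
  case: (ltnP s (n b)) => hs; last by rewrite -(subnKC hs) kills_widthP.
  apply: (@binomial_interp _ char0 S (fun s => H (x ^+ s * y ^+ b))) => //; last by rewrite sS.
  move=> a aS; rewrite -[RHS](hS a aS) functional_exp sS.
  rewrite (big_ord_widen N (fun i => 'C(a, i)%:R * H (x ^+ i * y ^+ b))) // big_mkcond.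
  apply: eq_bigr => i _; rewrite kills_leading //; case: ltnP => // h.
  by rewrite -(subnKC h) kills_widthP // mulr0.
by move=> i j; rewrite ltnS leq_eqVlt => /orP [/eqP ->|]; [exact: row | exact: hb].
Qed.

Lemma kills_all c d b a : kills b.+1 H -> H ((1 + x) ^+ a * (1 + y + c *: x ^+ d) ^+ b) = 0.
Proof.
move=> hb; rewrite functional_exp big1 // => i _.
rewrite kills_leading; first by rewrite hb ?mulr0.
by move=> s j jb; rewrite hb // ltnW.
Qed.

End Functional.

(* H(x^s) is a multiple of h := H(x^(n 0 - 1)) by the conditions on S0, and a
   combination of those on S1 reads (c - c0) h = 0. *)
Lemma kills_shifted (S0 S1 : seq nat) : (n 1 < n 0)%N -> (n 0 <= N)%N ->
  uniq S0 -> uniq S1 -> size S0 = (n 0).-1 -> size S1 = (n 1).+1 ->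
  exists c0, forall c H, c != c0 -> dual_functional H ->
    (forall a, a \in S0 -> H ((1 + x) ^+ a) = 0) ->
    (forall a, a \in S1 -> H ((1 + x) ^+ a * (1 + y + c *: x ^+ ((n 0).-1 - n 1))) = 0) ->
    kills 1 H.
Proof.
move=> n10 n0N u0 u1 s0 s1.
have [h0 hh0] := binomial_solve char0 (fun a => - 'C(a, (n 0).-1)%:R) u0.
pose kap s := if (s < (n 0).-1)%N then h0 s else (s == (n 0).-1)%:R.
(* For s >= n 1 the relation of row 1 expresses x^s y through row 0; for s < n 1 its value is
   unknown. The weights [g] cancel these unknown terms and give the term s = n 1 the coefficient
   1. *)
have [g hg] := binomial_dual char0 (fun s => (s == n 1)%:R) u1.
pose sg s := \sum_(a <- S1) g a * 'C(a, s)%:R.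
pose D := \sum_(s < N) sg (n 1 + s)%N *
   (kap (n 1 + s)%N + \sum_(i < N) r 1 i 0 * kap (i + s)%N).
exists (- D) => c H cD dH H0 H1.
have [lin hxN hyN rel] := dH.
pose h s := H (x ^+ s).
have h_high s : (n 0 <= s)%N -> h s = 0.
  by move=> hs; rewrite /h -(subnKC hs) -[x ^+ _]mulr1 -(expr0 y) kills_widthP.
have hkap s : h s = kap s * h (n 0).-1.
  rewrite /kap; case: ltnP => hs; last first.
    case: eqP => [->|ne]; rewrite ?mul1r // mul0r h_high //; lia.
  apply/eqP; rewrite -subr_eq0; apply/eqP.
  apply: (@binomial_interp _ char0 S0 (fun s => h s - h0 s * h (n 0).-1)) => //; last by rewrite s0.
  move=> a aS; under eq_bigr do rewrite mulrBr mulrA.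
  rewrite sumrB -mulr_suml hh0 // mulNr opprK.
  rewrite -[RHS](H0 a aS) -[(1 + x) ^+ a]mulr1 (functional_exp dH) s0.
  under [RHS]eq_bigr do rewrite mulr1 -/(h _).
  rewrite -(big_ord_recr (n 0).-1 (fun i => 'C(a, i)%:R * h i)) prednK; last by lia.
  rewrite (big_ord_widen N (fun i => 'C(a, i)%:R * h i)) // big_mkcond.
  by apply: eq_bigr => i _; case: ltnP => // hi; rewrite h_high // mulr0.
set d := ((n 0).-1 - n 1)%N in H1.
have row1 s : H (x ^+ (n 1 + s) * (1 + y + c *: x ^+ d)) =
    h (n 1 + s)%N + \sum_(i < N) r 1 i 0 * h (i + s)%N + c * h ((n 0).-1 + s)%N.
  rewrite !mulrDr mulr1 !(functionalD dH) -scalerAr (functionalZ dH) -exprD.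
  congr (_ + _ + c * h _); last by rewrite /d; lia.
  rewrite exprD mulrAC -[y in LHS]expr1 rel big_ord1; apply: eq_bigr => i _.
  by rewrite mulr1 -exprD.
have total : \sum_(s < N) sg (n 1 + s)%N * H (x ^+ (n 1 + s) * (1 + y + c *: x ^+ d)) = 0.
  have : \sum_(a <- S1) g a * H ((1 + x) ^+ a * (1 + y + c *: x ^+ d)) = 0.
    by rewrite big_seq big1 // => a /H1 ->; rewrite mulr0.
  move=> e0; rewrite -[RHS]e0; under [RHS]eq_bigr do rewrite (functional_exp dH) mulr_sumr.
  rewrite exchange_big /=; under [RHS]eq_bigr do
    (under eq_bigr do rewrite mulrA; rewrite -mulr_suml).
  pose F s := sg s * H (x ^+ s * (1 + y + c *: x ^+ d)).
  rewrite -[LHS]/(\sum_(s < N) F (n 1 + s)%N) -[RHS]/(\sum_(s < N) F s).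
  have Fhigh s : (N <= s)%N -> F s = 0 by move=> hs; rewrite /F (functional_high dH) // mulr0.
  have Flow s : (s < n 1)%N -> F s = 0.
    move=> hs; rewrite /F /sg hg; last by lia.
    by rewrite (_ : (s == n 1) = false) ?mul0r //; lia.
  have -> : \sum_(s < N) F s = \sum_(s < n 1 + N) F s.
    by rewrite addnC big_split_ord /= [X in _ + X]big1 ?addr0 // => i _; rewrite Fhigh ?leq_addr.
  by rewrite big_split_ord /= [X in _ = X + _]big1 ?add0r // => i _; rewrite Flow.
have key : (D + c) * h (n 0).-1 = 0.
  rewrite -[RHS]total mulrDl; under [RHS]eq_bigr do rewrite row1 mulrDr.
  rewrite big_split /=; congr (_ + _).
    rewrite /D mulr_suml; apply: eq_bigr => s _; rewrite -mulrA; congr (_ * _).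
    rewrite mulrDl -hkap mulr_suml; congr (_ + _); apply: eq_bigr => i _.
    by rewrite -mulrA -hkap.
  have N0 : (0 < N)%N by lia.
  (* By the choice of d, the term in c carries [h ((n 0).-1 + s)], which is zero unless s = 0; hence
     c appears with coefficient 1. *)
  rewrite (bigD1 (Ordinal N0)) //= !addn0 big1 ?addr0.
    by rewrite /sg hg ?eqxx ?mul1r // s1.
  move=> s s_ne; rewrite h_high ?mulr0 //.
  by move: s_ne; rewrite -val_eqE /=; lia.
have hz : h (n 0).-1 = 0.
  move/eqP: key; rewrite mulf_eq0 => /orP [|/eqP //].
  by rewrite addrC addr_eq0 (negbTE cD).
move=> i j; rewrite ltnS leqn0 => /eqP ->; rewrite expr0 mulr1.
by rewrite -/(h i) hkap hz mulr0.
Qed.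

End Placement.

(** * Torus degeneration *)

Section FreeRows.
Variable k : fieldType.
Hypothesis char0 : [pchar k] =i pred0.

Definition free_family (I C : finType) (f : I -> C -> k) :=
  forall z : I -> k, (forall c, \sum_i z i * f i c = 0) -> forall i, z i = 0.

Let mx_of (R : nzRingType) (I C : finType) (f : I -> C -> R) : 'M[R]_(#|I|, #|C|) :=
  \matrix_(i, c) f (enum_val i) (enum_val c).

Lemma free_familyP (I C : finType) (f : I -> C -> k) :
  free_family f <-> row_free (mx_of f).
Proof.
split=> [h|/row_free_inj h z hz i].
  apply: inj_row_free => v hv; apply/rowP => i; rewrite mxE.
  rewrite -[i]enum_valK; apply: (h (fun i => v 0 (enum_rank i))) => c.
  have := congr1 (fun m : 'rV_ _ => m 0 (enum_rank c)) hv; rewrite !mxE => e.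
  rewrite -[RHS]e (reindex (@enum_val I I)) /=; last exact/onW_bij/enum_val_bij.
  by apply: eq_bigr => s _; rewrite mxE enum_rankK enum_valK.
have e0 : (\row_i z (enum_val i)) = 0 :> 'rV_#|I|.
  apply: h; rewrite mul0mx; apply/rowP => c; rewrite !mxE.
  have e := hz (enum_val c).
  rewrite -[RHS]e [RHS](reindex (@enum_val I I)) /=; last exact/onW_bij/enum_val_bij.
  by apply: eq_bigr => s _; rewrite !mxE.
by have := congr1 (fun m : 'rV_ _ => m 0 (enum_rank i)) e0; rewrite !mxE enum_rankK.
Qed.

(** A right inverse B of the matrix at 0 turns independence into the non-vanishing of one
    determinant, a polynomial in x with value 1 at 0. *)
Lemma free_family_generic (I C : finType) (G : I -> C -> {poly k}) :
  free_family (fun i c => (G i c).[0]) ->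
  exists2 x, x != 0 & free_family (fun i c => (G i c).[x]).
Proof.
move=> /free_familyP /row_freeP [B hB].
pose P := \det (mx_of G *m map_mx polyC B).
have PE x : P.[x] = \det (mx_of (fun i c => (G i c).[x]) *m B).
  rewrite -[P.[x]]/(horner_eval x P) -det_map_mx map_mxM; congr (\det (_ *m _)).
    by apply/matrixP => i c; rewrite !mxE.
  by apply/matrixP => i c; rewrite !mxE /= /horner_eval hornerC.
have P0 : P != 0.
  apply/eqP => h; have := PE 0; rewrite h horner0 hB det1 => /esym/eqP.
  by rewrite oner_eq0.
have [x x0 hx] := char0_nonroot char0 P0.
exists x => //; apply/free_familyP/row_freeP.
have u : mx_of (fun i c => (G i c).[x]) *m B \in unitmx.
  by rewrite unitmxE -PE unitfE.
by exists (B *m invmx (mx_of (fun i c => (G i c).[x]) *m B)); rewrite mulmxA mulmxV.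
Qed.

End FreeRows.

Section Lattice.
Variables (k : fieldType) (t : nat).
Hypothesis char0 : [pchar k] =i pred0.
Implicit Types (D : nat -> nat -> bool) (S : nat -> seq nat).

Definition pairing l (z : nat -> k) (v : nat -> k) := \sum_(i < l) z i * v i.

(* [v a b] is the vector of values, on the monomial x^a y^b, of the l functionals
   attached to a scheme of length l; the points of S in the rows b0, b0 + 1, ...
   carry l independent columns, and from row b0 + q0 on they span
   all the columns seen so far. *)
Definition captures l (v : nat -> nat -> nat -> k) b0 q0 S :=
  (forall z q, (q0 <= q)%N ->
     (forall i a, (i <= q)%N -> a \in S i -> pairing l z (v a (b0 + i)%N) = 0) ->
     forall a, pairing l z (v a (b0 + q)%N) = 0) /\
  (forall z, (forall i a, a \in S i -> pairing l z (v a (b0 + i)%N) = 0) ->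
     forall i, (i < l)%N -> z i = 0).

(** On points with a <= t this is the lexicographic order, by row first: the leftmost points of the
    lowest rows come first. *)
Definition weight a b := (a + t.+1 * b)%N.

Section Step.
Variables (P : eqType) (s : seq P) (V : P -> nat -> nat -> k).

Definition free_rows D :=
  forall z : P -> k,
    (forall a b, D a b -> \sum_(p <- s) z p * V p a b = 0) ->
  forall p, p \in s -> z p = 0.

Variables (l N : nat) (v : nat -> nat -> nat -> k) (b0 q0 : nat) (D : nat -> nat -> bool).
Variable S : nat -> seq nat.
Hypothesis vS : captures l v b0 q0 S.
Hypothesis sizeS : (\sum_(i < N) size (S i) = l)%N.
Hypothesis highS : forall i, (N <= i)%N -> S i = [::].
Hypothesis D_bound : forall a b, D a b -> (a <= t)%N && (b <= t)%N.
Hypothesis D_low : forall a b, D a b -> (b0 <= b)%N.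
Hypothesis DS : forall i a, a \in S i -> D a (b0 + i)%N.
Hypothesis D_left : forall i a a', D a (b0 + i)%N -> a \notin S i -> a' \in S i -> (a' < a)%N.
Hypothesis D_full : forall i a, (i < q0)%N -> D a (b0 + i)%N -> a \in S i.

Definition placed a b := (b0 <= b)%N && (a \in S (b - b0)).

Let pts := [seq (a, (b0 + i)%N) | i <- iota 0 N, a <- S i].

Let size_pts : size pts = l.
Proof.
rewrite size_allpairs_dep -sizeS sumnE big_map -{1}[N]subn0 -/(index_iota 0 N).
by rewrite big_mkord.
Qed.

Let mem_pts a b : ((a, b) \in pts) = placed a b.
Proof.
apply/allpairsPdep/idP => [[i [c [hi hc [-> ->]]]]|/andP [hb ha]].
  by rewrite /placed leq_addr addKn.
exists (b - b0)%N, a; split => //; last by rewrite subnKC.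
rewrite mem_iota /= add0n; case: ltnP => // /highS e.
by rewrite e in ha.
Qed.

Let pt (i : 'I_l) := nth (0, 0)%N pts i.

Let pt_in i : placed (pt i).1 (pt i).2.
Proof. by rewrite -mem_pts -surjective_pairing mem_nth // size_pts. Qed.

Let A1 : 'M[k]_l := \matrix_(i, j) v (pt j).1 (pt j).2 i.

Let to_z (x : 'rV[k]_l) (i : nat) := if insub i is Some j then x 0 j else 0.

Let pairing_to_z (x : 'rV[k]_l) w : pairing l (to_z x) w = \sum_i x 0 i * w i.
Proof. by apply: eq_bigr => i _; rewrite /to_z valK. Qed.

Let ptP a b : placed a b -> exists i, (a, b) = pt i.
Proof.
rewrite -mem_pts => h; have hi := h; rewrite -index_mem size_pts in hi.
by exists (Ordinal hi); rewrite /pt nth_index.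
Qed.

Let A1_unit : A1 \in unitmx.
Proof.
rewrite -row_free_unit; apply: inj_row_free => x hx; apply/rowP => i.
have [_ h] := vS; have := h (to_z x) _ i (ltn_ord i).
rewrite {2}/to_z valK mxE; apply => b a ha.
have [|c e] := @ptP a (b0 + b)%N; first by rewrite /placed leq_addr addKn.
have := congr1 (fun m : 'rV_ _ => m 0 c) hx; rewrite !mxE => e0.
rewrite -[RHS]e0 pairing_to_z; apply: eq_bigr => j _.
by rewrite mxE -e.
Qed.

Let q (i : 'I_l) a b := \sum_j invmx A1 i j * v a b j.

Let q_pt i j : q i (pt j).1 (pt j).2 = (i == j)%:R.
Proof.
have := mulVmx A1_unit => /(congr1 (fun m : 'M_l => m i j)); rewrite !mxE => <-.
by apply: eq_bigr => c _; rewrite mxE.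
Qed.

Let v_q a b (i : 'I_l) : v a b i = \sum_j A1 i j * q j a b.
Proof.
have e : A1 *m (invmx A1 *m \col_j v a b j) = \col_j v a b j by rewrite mulKVmx ?A1_unit.
have := congr1 (fun m : 'cV_l => m i 0) e; rewrite !mxE => <-.
apply: eq_bigr => j _; congr (_ * _); rewrite mxE; apply: eq_bigr => c _.
by rewrite mxE.
Qed.

(** Suppose that the i-th placed point does not come before (a, b). Placed points of the row of (a,
    b) lie to its left, and those of earlier rows have smaller weight, so [q i] vanishes on all
    placed points up to this row. The first clause of [captures] then makes it vanish on the whole
    row; this clause applies since rows before q0 have no unplaced point. *)
Let weight_lt a b i : D a b -> ~~ placed a b -> q i a b != 0 ->
  (weight (pt i).1 (pt i).2 < weight a b)%N.
Proof.
move=> Dab nab; apply: contraNT; rewrite -leqNgt => hw.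
have hb := D_low Dab; pose r := (b - b0)%N.
have eb : b = (b0 + r)%N by rewrite subnKC.
have aS : a \notin S r by apply: contra nab => h; rewrite /placed hb.
have hr : (q0 <= r)%N.
  by rewrite leqNgt; apply: contra aS => h; apply: D_full; rewrite -?eb.
have [h _] := vS.
have := h (fun j => if insub j is Some j' then invmx A1 i j' else 0) r hr.
have qE a' b' : pairing l (fun j => if insub j is Some j' then invmx A1 i j' else 0)
    (v a' b') = q i a' b'.
  by apply: eq_bigr => j _; rewrite valK.
move=> h'; rewrite -qE eb; apply/eqP/h' => {h'} i' a' hi' ha'; rewrite qE.
have [|j ej] := @ptP a' (b0 + i')%N; first by rewrite /placed leq_addr addKn.
have := q_pt i j; rewrite -ej /= => ->; case: eqP => // eij.
move: hw; rewrite eij -ej /weight /= => hw.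
have Da' := DS ha'; have /andP [a't _] := D_bound Da'.
have /andP [at' _] := D_bound Dab.
have : (a' < a)%N \/ (i' < r)%N.
  move: hi'; rewrite leq_eqVlt => /orP [/eqP e|]; last by right.
  by left; apply: (@D_left r); rewrite -?eb // -e.
by rewrite eb !mulnDr in hw; move: hw => /[swap] -[]; nia.
Qed.

Hypothesis us : uniq s.
Hypothesis free_rest : free_rows (fun a b => D a b && ~~ placed a b).

(* Choose the basis q of the functionals dual to the placed points: q i vanishes
   on the other points of D of weight at most that of the i-th placed one.  The
   i-th row can thus be divided by x^(this weight), and then the matrix is block
   triangular at x = 0. *)
Lemma free_rows_step : exists2 x : k, x != 0 & forall (z : nat -> k) (y : P -> k),
  (forall a b, D a b -> pairing l z (fun i => x ^+ weight a b * v a b i)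
     + \sum_(p <- s) y p * V p a b = 0) ->
  (forall i, (i < l)%N -> z i = 0) /\ (forall p, p \in s -> y p = 0).
Proof.
pose I := ('I_l + 'I_(size s))%type; pose C := ('I_t.+1 * 'I_t.+1)%type.
pose sp (i : 'I_(size s)) := tnth (in_tuple s) i.
pose G (i : I) (c : C) : {poly k} := if D c.1 c.2 then
    match i with
    | inl i => (q i c.1 c.2)%:P * 'X^(weight c.1 c.2 - weight (pt i).1 (pt i).2)
    | inr i => (V (sp i) c.1 c.2)%:P
    end else 0.
have sumI (z : I -> k) (f : I -> k) : \sum_i z i * f i =
    \sum_i z (inl i) * f (inl i) + \sum_i z (inr i) * f (inr i).
  by rewrite (big_sumType _ _ (fun i => z i * f i)).
have sumP (y : 'I_(size s) -> k) (f : P -> k) :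
  exists y' : P -> k, (forall i, y' (sp i) = y i) /\
    \sum_i y i * f (sp i) = \sum_(p <- s) y' p * f p.
  exists (fun p => if insub (index p s) is Some i then y i else 0).
  have e i : (if insub (index (sp i) s) is Some i then y i else 0) = y i.
    rewrite /sp (tnth_nth (sp i)) index_uniq ?valK //.
  by split => //; rewrite [RHS]big_tnth; apply: eq_bigr => i _; rewrite e.
have [|x x0 hx] := @free_family_generic _ char0 I C G.
  move=> z hz.
  have z2 i : z (inr i) = 0.
    have [y' [ey _]] := sumP (fun i => z (inr i)) (fun _ => 0).
    rewrite -ey; apply: free_rest; last exact: mem_tnth.
    move=> a b /andP [Dab nab]; have /andP [ha hb] := D_bound Dab.
    have := hz (Ordinal (ha : (a < t.+1)%N), Ordinal (hb : (b < t.+1)%N)).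
    rewrite sumI big1 ?add0r => [e|j _]; last first.
      rewrite /G /= Dab; have [->|qn0] := eqVneq (q j a b) 0.
        by rewrite mul0r horner0 mulr0.
      rewrite hornerM hornerXn expr0n subn_eq0 leqNgt weight_lt //= mulr0 mulr0 //.
    rewrite -[RHS]e big_tnth; apply: eq_bigr => j _.
    by rewrite -/(sp j) ey /G /= Dab hornerC.
  case=> // i.
  have Dp : D (pt i).1 (pt i).2.
    have /andP [h1 h2] := pt_in i; by rewrite -(subnKC h1) DS.
  have /andP [ha hb] := D_bound Dp.
  have := hz (Ordinal (ha : ((pt i).1 < t.+1)%N), Ordinal (hb : ((pt i).2 < t.+1)%N)).
  rewrite sumI [X in _ + X]big1 ?addr0 => [|j _]; last by rewrite z2 mul0r.
  rewrite (bigD1 i) //= big1 ?addr0 => [|j ji].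
    by rewrite /G /= Dp q_pt eqxx subnn expr0 mulr1 hornerC mulr1.
  by rewrite /G /= Dp q_pt (negbTE ji) mul0r horner0 mulr0.
exists x => // z y h.
(* The coefficients in the basis [q], multiplied by the powers of x by which the rows of G were
   divided: in these terms the given relation is one between the rows of G at x. *)
pose zq i := x ^+ weight (pt i).1 (pt i).2 * \sum_j z (val j) * A1 j i.
have h0 := hx (fun i => match i with inl i => zq i | inr i => y (sp i) end).
have {}h0 : forall i, match i with inl i => zq i | inr i => y (sp i) end = 0.
  apply: h0 => -[a b]; rewrite sumI; case Dab: (D a b); last first.
    by rewrite !big1 ?addr0 // => i _; rewrite /G /= Dab horner0 mulr0.
  rewrite -[RHS](h _ _ Dab); congr (_ + _); last first.
    by rewrite [RHS]big_tnth; apply: eq_bigr => i _; rewrite /G /= Dab hornerC.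
  rewrite /pairing; under [RHS]eq_bigr do rewrite v_q mulr_sumr mulr_sumr.
  rewrite exchange_big /=; apply: eq_bigr => i _; rewrite /G /= Dab.
  have [->|qn0] := eqVneq (q i a b) 0.
    by rewrite mul0r horner0 mulr0 big1 // => j _; rewrite !mulr0.
  have hw : (weight (pt i).1 (pt i).2 <= weight a b)%N.
    case pab: (placed a b); last by apply/ltnW/weight_lt => //; rewrite pab.
    have [j ej] := ptP pab; have e := q_pt i j; rewrite -ej /= in e.
    by move: qn0; rewrite e; case: (i =P j) => [-> _|]; rewrite ?eqxx // -ej.
  rewrite hornerM hornerC hornerXn /zq; move: (q i a b) => qi.
  transitivity (x ^+ weight a b * (\sum_(j < l) z j * A1 j i) * qi).
    by rewrite -[in RHS](subnK hw) exprD; ring.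
  by rewrite [x ^+ _ * _]mulr_sumr mulr_suml; apply: eq_bigr => j _; ring.
split=> [i hi|p hp].
  have e0 : (\row_(j < l) z j) *m A1 = 0.
    apply/rowP => j; have /eqP := h0 (inl j); rewrite /zq mulf_eq0 expf_eq0 (negbTE x0) andbF /=.
    by move/eqP=> e; rewrite !mxE -[RHS]e; apply: eq_bigr => c _; rewrite mxE.
  have := row_free_inj; have := A1_unit; rewrite -row_free_unit => fA /(_ _ _ _ _ _ fA) inj.
  have := inj 1%N (\row_(j < l) z j) 0; rewrite mul0mx => /(_ e0).
  by move/rowP/(_ (Ordinal hi)); rewrite !mxE.
have hp' := hp; rewrite -index_mem in hp'.
have := h0 (inr (Ordinal hp')); rewrite /sp (tnth_nth p) /=.
by rewrite nth_index.
Qed.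

End Step.
End Lattice.

(** All that the filling needs to know of a scheme; only the number of points in each row matters,
    not their position. A shifted piece has one point too few in its first row to span the columns
    there, whence the 1 in [captures]. The last clause is stability under the torus element acting
    on x^a y^b by x^(a + (t + 1) b). *)
Definition fillable (k : fieldType) t N (lam : nat -> nat) l
    (Fam : (nat -> nat -> nat -> k) -> Prop) :=
  [/\ mass N lam = l, forall i, (N <= i)%N -> lam i = 0%N,
   forall b0 S, (forall i, uniq (S i)) -> (forall i, size (S i) = lam i) ->
     exists2 v, Fam v & captures l v b0 0 S,
   (lam 1 < lam 0)%N -> forall b0 S, (forall i, uniq (S i)) ->
     (forall i, size (S i) = shifted lam i) ->
     exists2 v, Fam v & captures l v b0 1 S
   & forall v x, x != 0 -> Fam v -> Fam (fun a b i => x ^+ weight t a b * v a b i)].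

Section Fill.
Variables (k : fieldType) (t N : nat) (J : eqType).
Variables (lam : J -> nat -> nat) (l : J -> nat).
Variable Fam : J -> (nat -> nat -> nat -> k) -> Prop.
Hypothesis char0 : [pchar k] =i pred0.
Hypothesis N2 : (1 < N)%N.

Implicit Types (D : nat -> nat -> bool) (S : nat -> seq nat).

Local Notation fillable j := (fillable t N (lam j) (l j) (Fam j)).

Definition row_of (D : nat -> nat -> bool) b := [seq a <- iota 0 t.+1 | D a b].

Definition slots (L : seq J) := [seq (j, i) | j <- L, i <- iota 0 (l j)].

Lemma uniq_slots L : uniq L -> uniq (slots L).
Proof.
move=> uL; apply: allpairs_uniq_dep => // [j _|]; first exact: iota_uniq.
by move=> [j i] [j' i'] _ _ /= [-> ->].
Qed.

Lemma mem_slots L j i : ((j, i) \in slots L) = (j \in L) && (i < l j)%N.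
Proof.
apply/allpairsPdep/andP => [[j' [i' [hj hi [-> ->]]]]|[hj hi]].
  by rewrite mem_iota in hi.
by exists j, i; rewrite mem_iota.
Qed.

Lemma row_of_uniq D b : uniq (row_of D b).
Proof. by rewrite filter_uniq // iota_uniq. Qed.

Lemma mem_row_of D a b : (forall a b, D a b -> (a <= t)%N && (b <= t)%N) ->
  (a \in row_of D b) = D a b.
Proof.
move=> h; rewrite mem_filter mem_iota /= add0n ltnS.
by case Dab: (D a b) => //=; have /andP [] := h _ _ Dab.
Qed.

Lemma take_row_left D b m a a' :
  a \in row_of D b -> a \notin take m (row_of D b) -> a' \in take m (row_of D b) ->
  (a' < a)%N.
Proof.
have srt : sorted ltn (row_of D b).
  by apply: sorted_filter; [exact: ltn_trans | exact: iota_ltn_sorted].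
rewrite -{1}(cat_take_drop m (row_of D b)) mem_cat => /orP [-> //|ha] _ ha'.
rewrite (sorted_pairwise ltn_trans) -(cat_take_drop m (row_of D b)) pairwise_cat in srt.
by have /and3P [/allrelP h _ _] := srt; exact: h.
Qed.

Lemma size_row_minus D b m :
  size [seq a <- row_of D b | a \notin take m (row_of D b)] = (size (row_of D b) - m)%N.
Proof.
have := take_subseq (row_of D b) m => /(subseq_uniqP (row_of_uniq D b)) e.
have := count_predC (mem (take m (row_of D b))) (row_of D b).
rewrite -!size_filter -e => h.
rewrite (eq_filter (a2 := predC (mem (take m (row_of D b))))) //.
rewrite -[LHS](addKn (size (take m (row_of D b)))) h size_take.
by case: ltnP => // hm; rewrite subnn; apply/esym/eqP; rewrite subn_eq0.
Qed.

(** The piece takes the leftmost free points of each row, so that unplaced points come later in the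
    order. The other pieces are first made independent on the points left over, and then this one is
    added by [free_rows_step]. For q0 = 1 the first row must be exhausted, which is the equality
    required in [packs_shift]. *)
Lemma fill_step (n : nat -> nat) q0 j L D b0 s u v0 :
  uniq (j :: L) -> (forall a b, D a b -> (a <= t)%N && (b <= t)%N) ->
  (forall a b, D a b -> (b0 <= b)%N) ->
  (forall i, size (row_of D (b0 + i)) = s - i - u i)%N ->
  (forall i, n i <= s - i - u i)%N -> mass N n = l j ->
  (forall i, (N <= i)%N -> n i = 0%N) ->
  (forall i, (i < q0)%N -> n i = s - i - u i)%N ->
  captures (l j) v0 b0 q0 (fun i => take (n i) (row_of D (b0 + i))) ->
  Fam j v0 -> fillable j ->
  (forall D', (forall a b, D' a b -> (a <= t)%N && (b <= t)%N) ->
     (forall a b, D' a b -> (b0 <= b)%N) ->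
     (forall i, size (row_of D' (b0 + i)) = s - i - (u i + n i))%N ->
     exists2 v, (forall j, j \in L -> Fam j (v j)) &
       free_rows (slots L) (fun p a b => v p.1 a b p.2) D') ->
  exists2 v, (forall j', j' \in j :: L -> Fam j' (v j')) &
    free_rows (slots (j :: L)) (fun p a b => v p.1 a b p.2) D.
Proof.
move=> ujL Db Dlow szD nle ntot nhigh nq cap Fv0 fj IH.
set S := fun i => take (n i) (row_of D (b0 + i)).
have szS i : size (S i) = n i by rewrite size_takel // szD.
have SD i a : a \in S i -> D a (b0 + i)%N by move/mem_take; rewrite mem_row_of.
pose D' a b := D a b && ~~ placed b0 S a b.
have [|||v Fv fv] := IH D'.
- by move=> a b /andP [/Db].
- by move=> a b /andP [/Dlow].
- move=> i; have -> : row_of D' (b0 + i) = [seq a <- row_of D (b0 + i) | a \notin S i].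
    rewrite /row_of -filter_predI; apply: eq_filter => a.
    by rewrite /= /D' /placed leq_addr addKn andbC.
  by rewrite size_row_minus szD subnDA.
have totS : (\sum_(i < N) size (S i) = l j)%N by rewrite -ntot; apply: eq_bigr => i _.
have highS i : (N <= i)%N -> S i = [::].
  by move=> hi; apply: size0nil; rewrite szS nhigh.
have leftS i a a' : D a (b0 + i)%N -> a \notin S i -> a' \in S i -> (a' < a)%N.
  by move=> Da; apply: take_row_left; rewrite mem_row_of.
have fullS i a : (i < q0)%N -> D a (b0 + i)%N -> a \in S i.
  by move=> hi Da; rewrite /S nq // -szD take_size mem_row_of.
have uL : uniq (slots L) by apply: uniq_slots; case/andP: ujL.
have [x x0 hx] := free_rows_step char0 cap totS highS Db Dlow SD leftS fullS uL fv.
exists (fun j' => if j' == j then (fun a b i => x ^+ weight t a b * v0 a b i) else v j').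
  move=> j'; rewrite inE; case: eqP => [-> _|_ /=]; last exact: Fv.
  by case: fj => _ _ _ _ h; exact: h.
move=> z hz.
have nj : j \notin L by case/andP: ujL.
have [] := hx (fun i => z (j, i)) z.
  move=> a b Dab; have e := hz a b Dab; rewrite -[RHS]e /slots /= big_cat big_map /=.
  congr (_ + _).
    have -> : iota 0 (l j) = index_iota 0 (l j) by rewrite /index_iota subn0.
    by rewrite big_mkord; apply: eq_bigr => i _; rewrite /= eqxx.
  rewrite big_seq [RHS]big_seq; apply: eq_bigr => -[j' i']; rewrite mem_slots => /andP [hj' _] /=.
  by case: eqP hj' => // ->; rewrite (negbTE nj).
move=> h1 h2 [j' i]; rewrite mem_slots inE => /andP [/orP [/eqP ->|hj'] hi]; first exact: h1.
by apply: h2; rewrite mem_slots hj'.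
Qed.

Lemma packs_free_rows s u L : packs lam s u L -> uniq L ->
  (forall j, j \in L -> fillable j) ->
  forall D b0, (b0 + s = t.+1)%N ->
  (forall a b, D a b -> (a <= t)%N && (b <= t)%N) ->
  (forall a b, D a b -> (b0 <= b)%N) ->
  (forall i, size (row_of D (b0 + i)) = s - i - u i)%N ->
  exists2 v, (forall j, j \in L -> Fam j (v j)) &
    free_rows (slots L) (fun p a b => v p.1 a b p.2) D.
Proof.
elim=> {s u L} [s u|s u L su _ IH|s u j L hn _ IH|s u j L l10 l0 hn _ IH] uL fL D b0 hb Db Dlow szD.
- by exists (fun _ _ _ _ => 0) => // z _ p.
- apply: (IH uL fL D b0.+1) => //; first by lia.
    move=> a b Dab; have := Dlow a b Dab; rewrite leq_eqVlt => /orP [/eqP e|//].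
    (* The row b0 is full, so D has no point left in it. *)
    have := szD 0%N; rewrite addn0 (_ : s.+1 - 0 - u 0 = 0)%N; last by lia.
    by move/size0nil => r0; have := mem_row_of a b Db; rewrite -{1}e r0 Dab.
  by move=> i; rewrite addSnnS szD; lia.
- have fj : fillable j by apply: fL; rewrite inE eqxx.
  have uL' : uniq L by case/andP: uL.
  have [tot high normal _ _] := fj.
  have [||v0 Fv0 cap] := normal b0 (fun i => take (lam j i) (row_of D (b0 + i))).
  + by move=> i; rewrite take_uniq ?row_of_uniq.
  + by move=> i; rewrite size_takel // szD.
  apply: (fill_step (q0 := 0) uL Db Dlow szD hn tot high _ cap Fv0 fj) => // D' Db' Dlow' szD'.
  by apply: (IH uL' _ D' b0) => // j' hj'; apply: fL; rewrite inE hj' orbT.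
have fj : fillable j by apply: fL; rewrite inE eqxx.
have uL' : uniq L by case/andP: uL.
have [tot high _ shift _] := fj.
have [||v0 Fv0 cap] := shift l10 b0 (fun i => take (shifted (lam j) i) (row_of D (b0 + i))).
+ by move=> i; rewrite take_uniq ?row_of_uniq.
+ by move=> i; rewrite size_takel // szD.
have tot' : mass N (shifted (lam j)) = l j by rewrite mass_shifted //; lia.
apply: (fill_step (q0 := 1) uL Db Dlow szD hn tot' _ _ cap Fv0 fj).
- by case=> [|[|i]] hi; [lia | lia | exact: high].
- by case=> //= _; rewrite l0; lia.
move=> D' Db' Dlow' szD'.
by apply: (IH uL' _ D' b0) => // j' hj'; apply: fL; rewrite inE hj' orbT.
Qed.

End Fill.

(** * Germs and double points as pieces *)

Section NormalForm.
Variables (k : fieldType) (Z : germ_scheme k).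
Local Notation P := {mpoly k[2]}.

Lemma lengthP : exists b : 'I_(length Z) -> P, basis_mod Z b.
Proof. by rewrite /length; case: ex_minnP => l /asboolP. Qed.

Lemma ex_nf : exists nf : P -> 'rV[k]_(length Z),
  [/\ forall c f g, nf (c *: f + g) = c *: nf f + nf g,
      forall f, nf f = 0 <-> f \in Z & forall v, exists f, nf f = v].
Proof.
have [b [sb fb]] := lengthP.
have [c hc] := choice sb.
exists (fun f => \row_i c f i).
have uniq_c f d : f - \sum_i d i *: b i \in Z -> forall i, d i = c f i.
  move=> hd i; apply/eqP; rewrite -subr_eq0; apply/eqP.
  apply: (fb (fun i => d i - c f i)).
  under eq_bigr do rewrite scalerBl; rewrite sumrB.
  have -> : \sum_i d i *: b i - \sum_i c f i *: b i =
    (f - \sum_i c f i *: b i) + (-1) * (f - \sum_i d i *: b i) by ring.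
  by rewrite germD // germM.
split.
- move=> a f g; apply/rowP => i; rewrite !mxE; apply/esym/(uniq_c _ (fun i => a * c f i + c g i)).
  under eq_bigr do rewrite scalerDl -scalerA; rewrite big_split /= -scaler_sumr.
  have -> : a *: f + g - (a *: \sum_i c f i *: b i + \sum_i c g i *: b i) =
     a *: (f - \sum_i c f i *: b i) + (g - \sum_i c g i *: b i) by rewrite scalerBr; ring.
  by rewrite germD ?germZ.
- move=> f; split=> [/rowP h|hf].
    have := hc f; rewrite big1 ?subr0 // => i _.
    by have := h i; rewrite !mxE => ->; rewrite scale0r.
  apply/rowP => i; rewrite !mxE; apply/esym/(uniq_c _ (fun=> 0)).
  by rewrite big1 ?subr0 // => j _; rewrite scale0r.
move=> v; exists (\sum_i v 0 i *: b i); apply/rowP => i; rewrite mxE.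
by apply/esym/(uniq_c _ (fun i => v 0 i)); rewrite subrr germ0.
Qed.

Definition nf : P -> 'rV[k]_(length Z) := sval (cid ex_nf).

Lemma nf_lin c f g : nf (c *: f + g) = c *: nf f + nf g.
Proof. by rewrite /nf; case: cid => /= ? []. Qed.

Lemma nf_eq0 f : nf f = 0 <-> f \in Z.
Proof. by rewrite /nf; case: cid => /= ? []. Qed.

Lemma nf_surj v : exists f, nf f = v.
Proof. by rewrite /nf; case: cid => /= ? []. Qed.

HB.instance Definition _ := GRing.isLinear.Build k P 'rV[k]_(length Z) *:%R nf nf_lin.

Lemma nf_congr f g : f - g \in Z -> nf f = nf g.
Proof. by move=> /nf_eq0; rewrite linearB /= => /subr0_eq. Qed.

Lemma nf_mul f g h : nf f = nf g -> nf (h * f) = nf (h * g).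
Proof.
move=> e; apply: nf_congr; rewrite -mulrBr germM //.
by apply/nf_eq0; rewrite linearB /= e subrr.
Qed.

Let rep i := sval (cid (nf_surj (delta_mx 0 i))).

Let repE i : nf (rep i) = delta_mx 0 i.
Proof. by rewrite /rep; case: cid. Qed.

Definition mult_mx h : 'M[k]_(length Z) := \matrix_i nf (h * rep i).

Lemma nf_mult_mx h f : nf (h * f) = nf f *m mult_mx h.
Proof.
have e : nf f = nf (\sum_i nf f 0 i *: rep i).
  by rewrite linear_sum {1}[nf f]row_sum_delta; apply: eq_bigr => i _; rewrite linearZ /= repE.
rewrite (nf_mul h e) mulr_sumr linear_sum mulmx_sum_row; apply: eq_bigr => i _.
by rewrite -scalerAr linearZ /= rowK.
Qed.

Lemma mult_mx_exp h i f : nf f *m mult_mx h ^+ i = nf (h ^+ i * f).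
Proof.
elim: i => [|i IH]; first by rewrite !expr0 mul1r mulmx1.
by rewrite mulmx_exprS mulmxA IH -nf_mult_mx exprS mulrA.
Qed.

Lemma mult_mx_word g h i j :
  word (mult_mx g) (mult_mx h) (nf 1) i j = nf (g ^+ i * h ^+ j).
Proof. by rewrite /word !mult_mx_exp mulr1 mulrC. Qed.

Lemma mult_mx_comm g h : mult_mx g *m mult_mx h = mult_mx h *m mult_mx g.
Proof.
apply/row_matrixP => i; rewrite !rowE !mulmxA -repE -!nf_mult_mx.
by rewrite mulrCA.
Qed.

Lemma mult_mxD g h c : mult_mx g + c *: mult_mx h = mult_mx (g + c *: h).
Proof.
by apply/row_matrixP => i; rewrite linearD linearZ /= !rowK mulrDl linearD -scalerAl linearZ.
Qed.

Lemma in_fat_multP : in_fat Z (mult Z).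
Proof. by rewrite /mult; case: ex_minnP. Qed.

Lemma mult_gt0 : (0 < mult Z)%N.
Proof.
rewrite /mult; case: ex_minnP => -[|//] /asboolP h _.
have : 1 \in Z.
  apply: h; rewrite inE; apply/asboolP; exists 1%N, (fun=> 1), (fun _ _ => 0).
  by split; [move=> i [] | rewrite big_ord1 big_ord0 mulr1].
by case: (germ_idealP Z) => _ h1 _; rewrite (negbTE h1).
Qed.

Lemma origin_exp_in g m : (mult Z <= m)%N -> g.@[origin] = 0 -> g ^+ m \in Z.
Proof.
move=> hm g0; rewrite -(subnKC hm) exprD mulrC germM //.
have /asboolP h := in_fat_multP; apply: h; rewrite inE; apply/asboolP.
exists 1%N, (fun=> 1), (fun _ _ => g); split=> [_ _|]; first by rewrite inE g0.
by rewrite big_ord1 mul1r prodr_const card_ord.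
Qed.

(** Up to a constant f is 1 - h with h vanishing at the origin, hence nilpotent modulo Z, and the
    geometric series inverts it. *)
Lemma germ_unit f : f.@[origin] != 0 -> exists g, f * g - 1 \in Z.
Proof.
move=> f0; pose h := 1 - (f.@[origin])^-1 *: f.
have h0 : h.@[origin] = 0 by rewrite mevalB meval1 mevalZ mulVf ?subrr.
exists ((f.@[origin])^-1 *: \sum_(i < mult Z) h ^+ i).
rewrite -scalerAr scalerAl (_ : _ *: f = 1 - h); last by rewrite /h; ring.
have -> : (1 - h) * \sum_(i < mult Z) h ^+ i - 1 = (-1) * h ^+ mult Z.
  by rewrite -(opprB h 1) [in LHS]mulNr -subrX1 opprB addrAC subrr add0r mulN1r.
by rewrite germM // origin_exp_in.
Qed.

Lemma mpoly2_mon (m : 'X_{1..2}) : 'X_[m] = 'X_0 ^+ m ord0 * 'X_1 ^+ m (lift ord0 ord0) :> P.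
Proof.
rewrite mpolyXE_id !big_ord_recl big_ord0 mulr1.
by congr ('X_ _ ^+ _ * 'X_ _ ^+ _); apply: val_inj.
Qed.

Lemma nilp_mon i j : (mult Z <= i + j)%N -> nf ('X_0 ^+ i * 'X_1 ^+ j) = 0.
Proof.
move=> h; apply/nf_eq0; apply: (in_fat_high in_fat_multP) => m.
have -> : 'X_0 ^+ i * 'X_1 ^+ j = 'X_[U_(0) *+ i + U_(1) *+ j] :> P.
  by rewrite mpolyXD !mpolyXn.
rewrite mcoeffX; case: (_ =P m) => [<- _|_]; last by rewrite eqxx.
by rewrite mdegD !mdegMn !mdeg1 !mul1n.
Qed.

End NormalForm.

Section GermPiece.
Variables (k : fieldType) (Z : germ_scheme k).
Hypothesis char0 : [pchar k] =i pred0.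
Local Notation P := {mpoly k[2]}.
Local Notation nf := (nf Z).

Lemma germ_widths : exists eps (n : nat -> nat) (r : nat -> nat -> nat -> k),
  let x := 'X_0 + eps *: 'X_1 : P in
  [/\ strict n, (n 0 <= mult Z)%N, (\sum_(j < mult Z) n j)%N = length Z &
   forall b, nf (x ^+ n b * 'X_1 ^+ b) =
     \sum_(j < b) \sum_(i < mult Z) r b i j *: nf (x ^+ i * 'X_1 ^+ j)].
Proof.
have [||||eps [n [sn n0 tn hr]]] :=
  @generic_widths k (length Z) (mult Z) (mult_mx Z 'X_0) (mult_mx Z 'X_1) (nf 1).
- exact: char0.
- exact: mult_mx_comm.
- by move=> i j h; rewrite mult_mx_word nilp_mon.
- move=> V hV; have inV f : (nf f <= V)%MS.
    rewrite (mpolyE f) linear_sum; apply: summx_sub => m _.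
    by rewrite linearZ scalemx_sub //= mpoly2_mon -mult_mx_word hV.
  by apply/row_subP => i; rewrite row1; have [f <-] := nf_surj (Z := Z) (delta_mx 0 i).
have [r rP] := choice hr.
exists eps, n, r; split => // b; have := rP b.
rewrite mult_mxD mult_mx_word => ->; apply: eq_bigr => j _; apply: eq_bigr => i _.
by rewrite mult_mx_word.
Qed.

Definition vecfun l (v : 'rV[k]_l) (i : nat) := if insub i is Some j then v 0 j else 0.

Lemma pairing_vecfun l z (v : 'rV[k]_l) : pairing l z (vecfun v) = \sum_(i < l) z i * v 0 i.
Proof. by apply: eq_bigr => i _; rewrite /vecfun valK. Qed.

Lemma pairing_lin l z c (v w : 'rV[k]_l) :
  pairing l z (vecfun (c *: v + w)) = c * pairing l z (vecfun v) + pairing l z (vecfun w).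
Proof.
rewrite !pairing_vecfun mulr_sumr -big_split; apply: eq_bigr => i _ /=.
by rewrite !mxE mulrDr mulrCA.
Qed.

Lemma pairing0 l z : pairing l z (vecfun (0 : 'rV[k]_l)) = 0.
Proof. by rewrite pairing_vecfun big1 // => i _; rewrite mxE mulr0. Qed.

Variables (eps : k) (n : nat -> nat) (r : nat -> nat -> nat -> k).
Let x : P := 'X_0 + eps *: 'X_1.
Hypothesis strict_n : strict n.
Hypothesis n0_le : (n 0 <= mult Z)%N.
Hypothesis total_n : (\sum_(j < mult Z) n j)%N = length Z.
Hypothesis rel : forall b, nf (x ^+ n b * 'X_1 ^+ b) =
     \sum_(j < b) \sum_(i < mult Z) r b i j *: nf (x ^+ i * 'X_1 ^+ j).

Let dual H := dual_functional x ('X_1 : P) (mult Z) n r H.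

Let x0 : x.@[origin] = 0.
Proof. by rewrite mevalD mevalZ !mevalXU /origin mulr0 addr0. Qed.

Lemma germ_dual z : dual (fun p => pairing (length Z) z (vecfun (nf p))).
Proof.
have nf0 f p : f \in Z -> nf (f * p) = 0 by move=> hf; apply/nf_eq0; rewrite mulrC germM.
have y0 : ('X_1 : P).@[origin] = 0 by rewrite mevalXU.
split=> [c p q|p|p|b p].
- by rewrite linearP pairing_lin.
- by rewrite nf0 ?pairing0 // origin_exp_in.
- by rewrite nf0 ?pairing0 // origin_exp_in.
have -> : nf (x ^+ n b * 'X_1 ^+ b * p) =
   \sum_(j < b) \sum_(i < mult Z) r b i j *: nf (x ^+ i * 'X_1 ^+ j * p).
  have e : nf (x ^+ n b * 'X_1 ^+ b) =
      nf (\sum_(j < b) \sum_(i < mult Z) r b i j *: (x ^+ i * 'X_1 ^+ j)).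
    rewrite rel linear_sum; apply: eq_bigr => j _; rewrite linear_sum.
    by apply: eq_bigr => i _; rewrite linearZ.
  rewrite mulrC (nf_mul p e) mulr_sumr linear_sum; apply: eq_bigr => j _.
  rewrite mulr_sumr linear_sum; apply: eq_bigr => i _.
  by rewrite /= -scalerAr linearZ mulrC.
pose G (v : 'rV_(length Z)) := pairing (length Z) z (vecfun v).
have GD v w : G (v + w) = G v + G w by rewrite -[v]scale1r /G pairing_lin mul1r scale1r.
have G0 : G 0 = 0 by exact: pairing0.
have GZ c v : G (c *: v) = c * G v by rewrite -[c *: v]addr0 /G pairing_lin pairing0 addr0.
rewrite -/(G _) (big_morph G GD G0); apply: eq_bigr => j _.
by rewrite (big_morph G GD G0); apply: eq_bigr => i _; rewrite GZ.
Qed.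

Lemma kills_span H : dual H -> (forall b, kills x ('X_1 : P) b H) -> forall p, H p = 0.
Proof.
move=> dH kH p; rewrite (mpolyE p) (functional_sum dH) big1 // => m _.
rewrite (functionalZ dH) mpoly2_mon.
have -> : 'X_0 = - eps *: 'X_1 + x :> P by rewrite /x scaleNr addrC addrK.
rewrite exprDn mulr_suml (functional_sum dH) big1 ?mulr0 // => i _.
rewrite mulrnAl (functionalMn dH) exprZn -scalerAl -scalerAl (functionalZ dH).
by rewrite [X in H X]mulrAC -exprD [X in H X]mulrC (kH _ _ _ (ltnSn _)) !mulr0.
Qed.

(** The map (x, y) -> [1 : 1 + x : zeta] pulls the affine monomial of exponents (a, b) back to (1 +
    x)^a zeta^b, whose normal form is the column at (a, b). *)
Let zeta c d : P := 1 + 'X_1 + c *: x ^+ d.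
Let vec c d a b i := vecfun (nf ((1 + x) ^+ a * zeta c d ^+ b)) i.

Let n_le b : (n b <= mult Z)%N.
Proof. by apply: leq_trans n0_le; have := strict_le b strict_n; lia. Qed.

(** Starting at row b0 multiplies everything by zeta^b0. Precomposing a functional with this product
    keeps it dual, and zeta is a unit modulo Z, so nothing is lost: the problem is the one for b0 =
    0. *)
Lemma captures_vec c d b0 q0 S : (zeta c d).@[origin] != 0 ->
  (forall H, dual H -> forall q, (q0 <= q)%N ->
      (forall i a, (i <= q)%N -> a \in S i -> H ((1 + x) ^+ a * zeta c d ^+ i) = 0) ->
      kills x ('X_1 : P) q.+1 H) ->
  captures (length Z) (vec c d) b0 q0 S.
Proof.
move=> z0 hk.
pose H z p := pairing (length Z) z (vecfun (nf (zeta c d ^+ b0 * p))).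
have dH z : dual (H z) by exact: (dual_functional_mul (zeta c d ^+ b0) (germ_dual z)).
have vecE z a b : pairing (length Z) z (vec c d a (b0 + b)%N) =
    H z ((1 + x) ^+ a * zeta c d ^+ b).
  by rewrite /vec /H exprD mulrCA.
split=> [z q q0q hz a|z hz i hi].
  rewrite vecE; apply: (kills_all (dH z)).
  by apply: hk => // i a' hi ha'; rewrite -vecE hz.
have kz b : kills x ('X_1 : P) b (H z).
  move=> s j jb; apply: (hk _ (dH z) (q0 + b)%N) => //; first exact: leq_addr.
    by move=> i' a' _ ha'; rewrite -vecE hz.
  by rewrite ltnS (leq_trans (ltnW jb)) ?leq_addl.
have [g hg] : exists g, zeta c d ^+ b0 * g - 1 \in Z.
  by apply: germ_unit; rewrite rmorphXn expf_neq0.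
have Hall := kills_span (dH z) kz.
have [f hf] := nf_surj (Z := Z) (delta_mx 0 (Ordinal hi)).
have e : nf (zeta c d ^+ b0 * (g * f)) = nf f.
  by rewrite mulrA -[in RHS](mul1r f) ![_ * f]mulrC; apply: nf_mul; exact: nf_congr.
have := Hall (g * f); rewrite /H e hf pairing_vecfun (bigD1 (Ordinal hi)) //= big1 ?addr0.
  by rewrite !mxE !eqxx mulr1.
by move=> j ji; rewrite mxE eqxx (negbTE ji) mulr0.
Qed.

(** The size bounds say that the jets of length m, which the parameter space provides, represent f
    and g exactly. The remaining homogeneous coordinate is 1. *)
Definition germ_vectors m (v : nat -> nat -> nat -> k) :=
  exists f g : P, [/\ (msize f <= m)%N, (msize g <= m)%N &
    forall a b i, v a b i = vecfun (nf (f ^+ a * g ^+ b)) i].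

Lemma msize_linear (a b c : k) : (msize (a%:MP + b *: 'X_0 + c *: 'X_1 : P)%R <= 2)%N.
Proof.
apply: leq_trans (mmeasureD_le _ _ _) _; rewrite geq_max; apply/andP; split; last first.
  by apply: leq_trans (msizeZ_le _ _) _; rewrite msizeX mdeg1.
apply: leq_trans (mmeasureD_le _ _ _) _; rewrite geq_max; apply/andP; split.
  by rewrite mmeasureC; case: (a != 0).
by apply: leq_trans (msizeZ_le _ _) _; rewrite msizeX mdeg1.
Qed.

Lemma msize_xexp d : (msize (x ^+ d)%R <= d.+1)%N.
Proof.
elim: d => [|d IH]; first by rewrite expr0 msize1.
have x2 : (msize x <= 2)%N.
  by have := msize_linear 0 1 eps; rewrite mpolyC0 add0r scale1r.
rewrite exprS; have [->|xn0] := eqVneq x 0; first by rewrite mul0r mmeasure0.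
rewrite msizeM // ?expf_neq0 //.
by move: (msize x) (msize (x ^+ d)) x2 IH => p q; lia.
Qed.

Lemma germ_fillable_aux t m N : (1 < m)%N -> (mult Z <= m)%N -> (mult Z <= N)%N ->
  fillable t N n (length Z) (germ_vectors m).
Proof.
move=> m1 Zm ZN.
have nhigh i : (mult Z <= i)%N -> n i = 0%N by move=> hi; have := strict_le i strict_n; lia.
have size_f : (msize (1 + x)%R <= m)%N.
  apply: leq_trans m1; have := msize_linear 1 1 eps.
  by rewrite mpolyC1 scale1r addrA.
have size_g c d : (d < mult Z)%N -> (msize (zeta c d) <= m)%N.
  move=> hd; apply: leq_trans (mmeasureD_le _ _ _) _; rewrite geq_max; apply/andP; split.
    apply: leq_trans m1; have := msize_linear 1 0 1.
    by rewrite mpolyC1 scale1r scale0r addr0.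
  by apply: leq_trans (msizeZ_le _ _) _; apply: leq_trans (msize_xexp d) _; lia.
have Fvec c d : (d < mult Z)%N -> germ_vectors m (vec c d).
  by move=> hd; exists (1 + x), (zeta c d); split => //; exact: size_g.
have Zpos := mult_gt0 Z.
have zetaE c d : (zeta c d).@[origin] = 1 + c * (d == 0%N)%:R.
  rewrite /zeta !mevalD meval1 mevalXU mevalZ rmorphXn /= x0 addr0.
  by rewrite expr0n.
(* Once q rows are killed, [kills_row] proceeds row by row with the first [n i] points of [S i]. In
   the shifted case q = 1, and row 1 has one point more than it needs. *)
have from_row c d S q : (forall i, uniq (S i)) -> (forall i, (q <= i)%N -> (n i <= size (S i))%N) ->
  forall H, dual H -> kills x ('X_1 : P) q H -> forall q', (q <= q')%N ->
  (forall i a, (i < q')%N -> a \in S i -> H ((1 + x) ^+ a * zeta c d ^+ i) = 0) ->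
  kills x ('X_1 : P) q' H.
  move=> uS nS H dH kq; elim=> [|q' IH]; first by rewrite leqn0 => /eqP q0; subst q.
  rewrite leq_eqVlt => /orP [/eqP <- //|hq] hS.
  apply: (@kills_row _ _ _ _ _ _ _ char0 H dH c d q' (take (n q') (S q'))) => //.
  - by apply: IH => // i a hi; apply: hS; exact: ltnW.
  - by rewrite take_uniq.
  - by rewrite size_takel // nS.
  - by move=> a /mem_take; exact: hS.
split.
- rewrite /mass -total_n [RHS](big_ord_widen N n) // [RHS]big_mkcond /=; apply: eq_bigr => i _.
  by case: ltnP => // /nhigh.
- by move=> i hi; apply: nhigh; exact: leq_trans hi.
- move=> b0 S uS szS; exists (vec 0 0); first exact: Fvec.
  apply: captures_vec; first by rewrite zetaE mul0r addr0 oner_neq0.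
  move=> H dH q _ hS; apply: (from_row 0 0%N S 0%N) => //.
  by move=> i _; rewrite szS.
- move=> n10 b0 S uS szS.
  have [c0 hc0] := @kills_shifted k {mpoly k[2]} x 'X_1 (mult Z) n r char0 (S 0%N) (S 1%N)
    n10 n0_le (uS 0%N) (uS 1%N) (szS 0%N) (szS 1%N).
  set d := ((n 0).-1 - n 1)%N in hc0.
  (* Besides the bad value c0 of [kills_shifted], c must avoid -1: if d = 0, then zeta takes the
     value 1 + c at the origin and has to be a unit. *)
  have [c cc0 c1] : exists2 c : k, c != c0 & 1 + c != 0.
    have p0 : ('X - c0%:P) * ('X + 1%:P) != 0 :> {poly k}.
      by rewrite mulf_neq0 ?polyXsubC_eq0 // -[1%:P]opprK -polyCN polyXsubC_eq0.
    have [c _] := char0_nonroot char0 p0; rewrite rootM negb_or root_XsubC => /andP [h1 h2].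
    exists c => //; move: h2; rewrite /root hornerD hornerX hornerC addrC //.
  exists (vec c d); first by apply: Fvec; rewrite /d; lia.
  apply: captures_vec.
    by rewrite zetaE; case: (d == 0%N); rewrite ?mulr1 ?mulr0 ?addr0 ?oner_neq0.
  move=> H dH q q1 hS; apply: (from_row c d S 1%N) => //.
    by case=> [|[|i]] //= _; rewrite szS //=.
  apply: (hc0 c) => // a ha.
    by have := hS 0%N a; rewrite expr0 mulr1; apply.
  by have := hS 1%N a; rewrite expr1; apply.
move=> v y y0 [f [g [hf hg hv]]].
(* The torus element with weights (1, t + 1) rescales the two affine coordinates of the map. *)
exists (y *: f), (y ^+ t.+1 *: g); split.
- by apply: leq_trans (msizeZ_le _ _) _.
- by apply: leq_trans (msizeZ_le _ _) _.
move=> a b i; rewrite hv !exprZn -scalerAl -scalerAr scalerA -exprM -exprD linearZ /=.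
by rewrite /vecfun; case: insub => [j|]; rewrite ?mxE ?mulr0.
Qed.

End GermPiece.

Lemma germ_fillable (k : fieldType) (Z : germ_scheme k) t m N :
  [pchar k] =i pred0 -> (1 < m)%N -> (mult Z <= m)%N -> (mult Z <= N)%N ->
  exists lam, [/\ strict lam, (0 < lam 0 <= mult Z)%N &
    fillable t N lam (length Z) (germ_vectors Z m)].
Proof.
move=> char0 m1 Zm ZN; have [eps [n [r [sn n0 tn rel]]]] := germ_widths Z char0.
exists n; split => //; last exact: (germ_fillable_aux char0 sn n0 tn rel).
rewrite n0 andbT lt0n; apply/eqP => e.
have lZ : length Z = 0%N.
  rewrite -tn big1 // => i _; have := strict_le i sn; lia.
have : nf Z 1 = 0 by apply/rowP => i; have := ltn_ord i; rewrite {2}lZ.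
by move/nf_eq0; case: (germ_idealP Z) => _ /negP h _ /h.
Qed.

Section DoublePiece.
Variable k : fieldType.
Hypothesis char0 : [pchar k] =i pred0.

Definition double_widths i := match i with 0 => 2 | 1 => 1 | _ => 0 end%N.

Lemma double_widthsP : is_double double_widths. Proof. by split. Qed.

(** The value of x^a y^b and of its derivatives x d/dx and y d/dy at a point of the torus. Up to
    scaling, functionals are the affine functions of (a, b), so three lattice points carry
    independent columns exactly when they are not collinear; both (2, 1) and (1, 2) in consecutive
    rows are such. *)
Definition double_vectors (v : nat -> nat -> nat -> k) :=
  exists x y : k, [/\ x != 0, y != 0 &
    forall a b i, v a b i = x ^+ a * y ^+ b * nth 0 [:: 1; a%:R; b%:R] i].

Let v0 a b i : k := 1 ^+ a * 1 ^+ b * nth 0 [:: 1; a%:R; b%:R] i.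

Let v0E z a b : pairing 3 z (v0 a b) = z 0%N + z 1%N * a%:R + z 2%N * b%:R.
Proof. by rewrite /pairing !big_ord_recl big_ord0 /v0 /= !expr1n !mul1r mulr1 addr0 addrA. Qed.

Let slope z a a' b : a != a' ->
  pairing 3 z (v0 a b) = 0 -> pairing 3 z (v0 a' b) = 0 -> z 1%N = 0.
Proof.
rewrite !v0E => ne h1 h2; have : z 1%N * (a%:R - a'%:R) = 0.
  by rewrite -[RHS](subrr (0 : k)) -{1}h1 -h2; ring.
move/eqP; rewrite mulf_eq0 => /orP [/eqP //|]; rewrite subr_eq0.
by move/eqP/(char0_natr_inj char0)/eqP; rewrite (negbTE ne).
Qed.

Let no_slope z b b' a a' : z 1%N = 0 -> b != b' ->
  pairing 3 z (v0 a b) = 0 -> pairing 3 z (v0 a' b') = 0 ->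
  forall i, (i < 3)%N -> z i = 0.
Proof.
rewrite !v0E => z1 ne; rewrite z1 !mul0r !addr0 => h1 h2.
have z2 : z 2%N = 0.
  have : z 2%N * (b%:R - b'%:R) = 0 by rewrite -[RHS](subrr (0 : k)) -{1}h1 -h2; ring.
  move/eqP; rewrite mulf_eq0 => /orP [/eqP //|]; rewrite subr_eq0.
  by move/eqP/(char0_natr_inj char0)/eqP; rewrite (negbTE ne).
by move: h1; rewrite z2 mul0r addr0 => z0 [|[|[|]]].
Qed.

Let zero_pairing z a b : (forall i, (i < 3)%N -> z i = 0) -> pairing 3 z (v0 a b) = 0.
Proof. by move=> h; rewrite /pairing big1 // => i _; rewrite h ?mul0r. Qed.

Lemma double_fillable t N : (1 < N)%N ->
  fillable t N double_widths 3 double_vectors.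
Proof.
move=> N1; have Fv0 : double_vectors v0.
  by exists 1, 1; split; rewrite ?oner_neq0.
split.
- by apply: mass_double => //; exact: double_widthsP.
- by case: N N1 => [|[|N]] // _ [|[|i]].
- move=> b0 S uS szS; exists v0 => //.
  have [a0 [a1 e0]] : exists a0 a1, S 0%N = [:: a0; a1].
    by move: (szS 0%N); case: (S 0%N) => [|a0 [|a1 [|]]] // _; exists a0, a1.
  have [a2 e1] : exists a2, S 1%N = [:: a2].
    by move: (szS 1%N); case: (S 1%N) => [|a2 [|]] // _; exists a2.
  have ne : a0 != a1 by have := uS 0%N; rewrite e0 /= inE andbT.
  have all0 z : (forall i a, (i <= 1)%N -> a \in S i -> pairing 3 z (v0 a (b0 + i)%N) = 0) ->
      forall i, (i < 3)%N -> z i = 0.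
    move=> hz.
    have z1 : z 1%N = 0.
      by apply: (slope (b := b0 + 0) ne); apply: hz; rewrite // e0 !inE eqxx ?orbT.
    apply: (no_slope (b := b0 + 0) (b' := b0 + 1) (a := a0) (a' := a2) z1).
    + by rewrite eqn_add2l.
    + by apply: hz; rewrite // e0 inE eqxx.
    + by apply: hz; rewrite // e1 inE eqxx.
  split=> [z [|q] _ hz a|z hz].
  + have z1 : z 1%N = 0.
      by apply: (slope (b := b0 + 0) ne); apply: hz; rewrite // e0 !inE eqxx ?orbT.
    have := hz 0%N a0 isT; rewrite e0 inE eqxx => /(_ isT).
    by rewrite !v0E z1 !mul0r.
  + by apply: zero_pairing; apply: all0 => i a' hi; apply: hz; exact: leq_trans hi _.
  + by apply: all0 => i a _; exact: hz.
- move=> _ b0 S uS szS; exists v0 => //.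
  have [a2 e0] : exists a2, S 0%N = [:: a2].
    by move: (szS 0%N); case: (S 0%N) => [|a2 [|]] // _; exists a2.
  have [a0 [a1 e1]] : exists a0 a1, S 1%N = [:: a0; a1].
    by move: (szS 1%N); case: (S 1%N) => [|a0 [|a1 [|]]] // _; exists a0, a1.
  have ne : a0 != a1 by have := uS 1%N; rewrite e1 /= inE andbT.
  have all0 z : (forall i a, (i <= 1)%N -> a \in S i -> pairing 3 z (v0 a (b0 + i)%N) = 0) ->
      forall i, (i < 3)%N -> z i = 0.
    move=> hz.
    have z1 : z 1%N = 0.
      by apply: (slope (b := b0 + 1) ne); apply: hz; rewrite // e1 !inE eqxx ?orbT.
    apply: (no_slope (b := b0 + 0) (b' := b0 + 1) (a := a2) (a' := a0) z1).
    + by rewrite eqn_add2l.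
    + by apply: hz; rewrite // e0 inE eqxx.
    + by apply: hz; rewrite // e1 inE eqxx.
  split=> [z q q1 hz a|z hz].
    by apply: zero_pairing; apply: all0 => i a' hi; apply: hz; exact: leq_trans hi _.
  by apply: all0 => i a _; exact: hz.
move=> v y y0 [x [x' [x0 x'0 hv]]]; exists (y * x), (y ^+ t.+1 * x').
split; rewrite ?mulf_neq0 ?expf_neq0 // => a b i.
by rewrite hv /weight exprD exprM !exprMn -!mulrA; congr (_ * _); rewrite mulrCA.
Qed.

End DoublePiece.

Lemma size_row_triangle t i :
  size (row_of t (fun a b => (a + b <= t)%N) i) = (t.+1 - i)%N.
Proof.
rewrite size_filter; case: (leqP i t.+1) => hi; last first.
  rewrite (_ : t.+1 - i = 0)%N; last by lia.
  by apply/eqP; rewrite -leqn0 leqNgt -has_count; apply/hasPn => a _; lia.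
rewrite -{1}(subnK hi) iotaD count_cat.
rewrite (@eq_in_count _ _ predT) => [|a]; last by rewrite mem_iota /=; lia.
rewrite count_predT size_iota (@eq_in_count _ _ pred0) ?count_pred0 ?addn0 // => a.
by rewrite mem_iota /=; lia.
Qed.

Section ExistsFree.
Variables (k : fieldType) (t r e m : nat) (Z : 'I_r -> germ_scheme k).
Hypothesis char0 : [pchar k] =i pred0.
Hypothesis m1 : (1 < m)%N.
Hypothesis Zm : forall j, (mult (Z j) <= m)%N.
Hypothesis area : (2 * (1 + 3 * e + \sum_(j < r) length (Z j)) <= (t + 2) * (t + 1))%N.
Hypothesis budget : ((m - 1) * (t - 1) <= 2 * e)%N.

Definition piece_length (j : 'I_e + 'I_r) :=
  match j with inl _ => 3 | inr j => length (Z j) end.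

Definition piece_vectors (j : 'I_e + 'I_r) :=
  match j with inl _ => @double_vectors k | inr j => germ_vectors (Z j) m end.

Lemma exists_free : exists v : 'I_e + 'I_r -> nat -> nat -> nat -> k,
  (forall j, piece_vectors j (v j)) /\
  forall z : 'I_e + 'I_r -> nat -> k,
    (forall a b, (a + b <= t)%N -> \sum_j \sum_(i < piece_length j) z j i * v j a b i = 0) ->
    forall j i, (i < piece_length j)%N -> z j i = 0.
Proof.
pose N := (t + m + 3)%N.
have N1 : (1 < N)%N by lia.
have mN : (m <= N)%N by rewrite /N; lia.
have [w wP] := choice (fun j => germ_fillable t char0 m1 (Zm j) (leq_trans (Zm j) mN)).
pose J := ('I_e + 'I_r)%type.
pose lam (j : J) := match j with inl _ => double_widths | inr j => w j end.
pose le_desc (i j : J) := (lam j 0 <= lam i 0)%N.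
pose Zs := sort le_desc [seq inr j : J | j <- enum 'I_r].
pose ds := [seq inl i : J | i <- enum 'I_e].
have fj j : fillable t N (lam j) (piece_length j) (piece_vectors j).
  by case: j => j; [exact: double_fillable | have [] := wP j].
have desc_total : total le_desc by move=> i j; exact: leq_total.
(* The triangle starts with a row of s = t + 1 points, so the budget (m - 1) (s - 2) is the
   hypothesis on e. *)
have [|||||||||L pL kL] := @pack_big J lam N m t.+1 (fun=> 0%N) Zs ds m1 => //.
- by rewrite /N; lia.
- exact: sort_sorted.
- move=> j; rewrite mem_sort => /mapP [j' _ ->] /=.
  by have [sw /andP [w0 wm] _] := wP j'; rewrite w0 (leq_trans wm).
- by move=> j /mapP [i _ ->].
- by rewrite size_map size_enum_ord subSS.
- have -> : mass N (fun=> 0%N) = 0%N by rewrite /mass big1.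
  rewrite size_map size_enum_ord.
  have -> : (\sum_(j <- Zs) mass N (lam j) = \sum_(j < r) length (Z j))%N.
    rewrite (perm_big [seq inr j : J | j <- enum 'I_r]) /=; last by rewrite perm_sort.
    by rewrite big_map big_enum; apply: eq_bigr => j _; have [_ _ []] := wP j.
  by move: area; rewrite addn1 addn2; lia.
have memL j : j \in L.
  rewrite (perm_mem pL) mem_cat mem_sort; case: j => i; apply/orP; [right|left];
  by apply/map_f; rewrite mem_enum.
have uL : uniq L.
  have uZ : uniq Zs by rewrite sort_uniq map_inj_uniq ?enum_uniq // => i j [].
  have ud : uniq ds by rewrite map_inj_uniq ?enum_uniq // => i j [].
  rewrite (perm_uniq pL) cat_uniq uZ ud andbT; apply/hasPn => _ /mapP [i _ ->].
  by rewrite mem_sort; apply/mapP => -[].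
pose D a b := (a + b <= t)%N.
have [|||i|v Fv fv] :=
  packs_free_rows (t := t) char0 N1 kL uL (fun j _ => fj j) (D := D) (b0 := 0) => //.
- by move=> a b; rewrite /D; lia.
- by rewrite size_row_triangle; lia.
exists v; split=> [j|z hz j i hi]; first exact: Fv.
apply: (fv (fun p => z p.1 p.2) _ (j, i)); last by rewrite mem_slots memL.
move=> a b Dab; rewrite -[RHS](hz a b Dab).
have pJ : perm_eq L (index_enum J).
  by apply: uniq_perm; rewrite ?index_enum_uniq // => j'; rewrite memL mem_index_enum.
rewrite /slots big_allpairs_dep /= (perm_big _ pJ) /=; apply: eq_bigr => j' _.
by rewrite -{1}[piece_length j']subn0 -/(index_iota 0 (piece_length j')) big_mkord.
Qed.
End ExistsFree.

(** * The open set of parameters *)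

Section PolynomialFunctions.
Variables (k : fieldType) (T : finType).
Implicit Types (f g : (T -> k) -> k) (a b : T -> k).

Definition polyfun f :=
  exists g : {mpoly k[#|T|]}, forall a, f a = g.@[fun i => a (enum_val i)].

Lemma polyfun_const c : polyfun (fun=> c).
Proof. by exists c%:MP => a; rewrite mevalC. Qed.

Lemma polyfun_coord x : polyfun (fun a => a x).
Proof. by exists 'X_(enum_rank x) => a; rewrite mevalXU enum_rankK. Qed.

Lemma polyfunD f g : polyfun f -> polyfun g -> polyfun (fun a => f a + g a).
Proof. by move=> [p hp] [q hq]; exists (p + q) => a; rewrite hp hq mevalD. Qed.

Lemma polyfunM f g : polyfun f -> polyfun g -> polyfun (fun a => f a * g a).
Proof. by move=> [p hp] [q hq]; exists (p * q) => a; rewrite hp hq mevalM. Qed.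

Lemma polyfun_ext f g : (forall a, f a = g a) -> polyfun f -> polyfun g.
Proof. by move=> e [p hp]; exists p => a; rewrite -e. Qed.

Lemma polyfun_sum (I : Type) (s : seq I) (P : pred I) (F : I -> (T -> k) -> k) :
  (forall i, polyfun (F i)) -> polyfun (fun a => \sum_(i <- s | P i) F i a).
Proof.
move=> h; elim: s => [|i s IH].
  by apply: polyfun_ext (polyfun_const 0) => a; rewrite big_nil.
case Pi: (P i).
  by apply: polyfun_ext (polyfunD (h i) IH) => a; rewrite big_cons Pi.
by apply: polyfun_ext IH => a; rewrite big_cons Pi.
Qed.

Lemma polyfun_prod (I : Type) (s : seq I) (P : pred I) (F : I -> (T -> k) -> k) :
  (forall i, polyfun (F i)) -> polyfun (fun a => \prod_(i <- s | P i) F i a).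
Proof.
move=> h; elim: s => [|i s IH].
  by apply: polyfun_ext (polyfun_const 1) => a; rewrite big_nil.
case Pi: (P i).
  by apply: polyfun_ext (polyfunM (h i) IH) => a; rewrite big_cons Pi.
by apply: polyfun_ext IH => a; rewrite big_cons Pi.
Qed.

Lemma polyfun_det n (A : (T -> k) -> 'M[k]_n) :
  (forall i j, polyfun (fun a => A a i j)) -> polyfun (fun a => \det (A a)).
Proof.
move=> h; apply: polyfun_sum => s; apply: polyfunM; first exact: polyfun_const.
exact: polyfun_prod.
Qed.

Lemma polyfun_line f a b : polyfun f ->
  exists p : {poly k}, forall s, f (fun x => a x + s * (b x - a x)) = p.[s].
Proof.
move=> [g hg].
exists (\sum_(m <- msupp g) g@_m *: \prod_i ((a (enum_val i))%:P +
   (b (enum_val i) - a (enum_val i)) *: 'X) ^+ m i) => s.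
rewrite hg mevalE horner_sum; apply: eq_bigr => m _.
rewrite hornerZ horner_prod; congr (_ * _); apply: eq_bigr => i _.
by rewrite horner_exp hornerD hornerC hornerZ hornerX mulrC.
Qed.

Hypothesis char0 : [pchar k] =i pred0.

(** On the line joining the two points both functions become non-zero polynomials in one variable,
    with a common non-root in characteristic 0. This plays the part of the irreducibility of the
    parameter space. *)
Lemma polyfun_common2 f g : polyfun f -> polyfun g ->
  (exists a, f a != 0) -> (exists a, g a != 0) -> exists a, (f a != 0) && (g a != 0).
Proof.
move=> pf pg [a fa] [b gb].
have [p hp] := polyfun_line a b pf; have [q hq] := polyfun_line a b pg.
have p0 : p != 0.
  apply: contra fa => /eqP e; have := hp 0; rewrite e horner0 => <-.
  by apply/eqP; congr f; apply/funext => x; rewrite mul0r addr0.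
have q0 : q != 0.
  apply: contra gb => /eqP e; have := hq 1; rewrite e horner0 => <-.
  by apply/eqP; congr g; apply/funext => x; rewrite mul1r addrC subrK.
have [s _] := char0_nonroot char0 (mulf_neq0 p0 q0).
rewrite rootM negb_or => /andP [h1 h2].
by exists (fun x => a x + s * (b x - a x)); rewrite hp hq h1 h2.
Qed.

Lemma polyfun_common (I : Type) (s : seq I) (F : I -> (T -> k) -> k) :
  (forall i, polyfun (F i)) -> (forall i, exists a, F i a != 0) ->
  exists a, \prod_(i <- s) F i a != 0.
Proof.
move=> pF nF; elim: s => [|i s IH]; first by exists (fun=> 0); rewrite big_nil oner_neq0.
have [a /andP [h1 h2]] := polyfun_common2 (pF i) (polyfun_prod s xpredT pF) (nF i) IH.
by exists a; rewrite big_cons mulf_neq0.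
Qed.

Definition polyfam n (h : (T -> k) -> {mpoly k[n]}) :=
  exists (I : finType) (c : I -> (T -> k) -> k) (w : I -> {mpoly k[n]}),
    (forall i, polyfun (c i)) /\ forall a, h a = \sum_i c i a *: w i.

Lemma polyfam_const n (w : {mpoly k[n]}) : polyfam (fun=> w).
Proof.
exists unit, (fun _ _ => 1), (fun=> w); split=> [_|a]; first exact: polyfun_const.
by rewrite (big_pred1 tt) ?scale1r // => -[].
Qed.

Lemma polyfamM n (h h' : (T -> k) -> {mpoly k[n]}) :
  polyfam h -> polyfam h' -> polyfam (fun a => h a * h' a).
Proof.
move=> [I [c [w [pc hw]]]] [I' [c' [w' [pc' hw']]]].
exists (I * I')%type, (fun i a => c i.1 a * c' i.2 a), (fun i => w i.1 * w' i.2).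
split=> [i|a]; first exact: polyfunM.
rewrite hw hw' big_distrlr pair_bigA /=; apply: eq_bigr => i _.
by rewrite -scalerAl -scalerAr scalerA.
Qed.

Lemma polyfam_prod n (I : Type) (s : seq I) (h : I -> (T -> k) -> {mpoly k[n]}) :
  (forall i, polyfam (h i)) -> polyfam (fun a => \prod_(i <- s) h i a).
Proof.
move=> hh; elim: s => [|i s IH].
  have := polyfam_const (1 : {mpoly k[n]}); congr polyfam.
  by apply/funext => a; rewrite big_nil.
have := polyfamM (hh i) IH; congr polyfam.
by apply/funext => a; rewrite big_cons.
Qed.

Lemma polyfamX n (h : (T -> k) -> {mpoly k[n]}) d :
  polyfam h -> polyfam (fun a => h a ^+ d).
Proof.
move=> hh; elim: d => [|d IH]; first exact: polyfam_const.
have := polyfamM hh IH; congr polyfam.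
by apply/funext => a; rewrite exprS.
Qed.

Lemma polyfam_linear n (h : (T -> k) -> {mpoly k[n]}) (L : {mpoly k[n]} -> k) :
  (forall c p q, L (c *: p + q) = c * L p + L q) -> polyfam h ->
  polyfun (fun a => L (h a)).
Proof.
move=> hL [I [c [w [pc hw]]]].
have LD p q : L (p + q) = L p + L q by rewrite -[p]scale1r hL mul1r scale1r.
have L0 : L 0 = 0 by apply: (addrI (L 0)); rewrite -LD !addr0.
have LZ c' p : L (c' *: p) = c' * L p by rewrite -[_ *: p]addr0 hL L0 addr0.
apply: (polyfun_ext (f := fun a => \sum_i c i a * L (w i))).
  by move=> a; rewrite hw (big_morph L LD L0); apply: eq_bigr => i _; rewrite LZ.
by apply: polyfun_sum => i; apply: polyfunM => //; exact: polyfun_const.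
Qed.

End PolynomialFunctions.

Definition o0 : 'I_3 := @Ordinal 3 0 isT.
Definition o1 : 'I_3 := @Ordinal 3 1 isT.
Definition o2 : 'I_3 := @Ordinal 3 2 isT.

Lemma ord3P (P : 'I_3 -> Prop) : P o0 -> P o1 -> P o2 -> forall i, P i.
Proof.
move=> h0 h1 h2 [[|[|[|//]]] hi].
- by rewrite (_ : Ordinal hi = o0) //; apply: val_inj.
- by rewrite (_ : Ordinal hi = o1) //; apply: val_inj.
- by rewrite (_ : Ordinal hi = o2) //; apply: val_inj.
Qed.

Lemma prod_ord3 (R : comNzRingType) (F : 'I_3 -> R) : \prod_i F i = F o0 * F o1 * F o2.
Proof.
rewrite !big_ord_recl big_ord0 mulr1 mulrA.
by congr (F _ * F _ * F _); apply: val_inj.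
Qed.

Section Functionals.
Variables (k : fieldType) (t r e m : nat) (Z : 'I_r -> germ_scheme k).
Local Notation S := {mpoly k[3]}.
Local Notation J := ('I_e + 'I_r)%type.
Local Notation T := (coords e r m).
Local Notation len := (@piece_length k r e Z).

(** Multiplied by the coordinates of p, the derivatives act on monomials by their exponents, as in
    [double_vectors]. For a form vanishing at p with non-zero coordinates, Euler's relation recovers
    the derivative along x_0. *)
Definition double_functional (p : 'I_3 -> k) (F : S) (i : nat) : k :=
  nth 0 [:: F.@[p]; p o1 * (F^`M(o1)).@[p]; p o2 * (F^`M(o2)).@[p]] i.

Definition functional (a : T -> k) (j : J) (F : S) (i : nat) : k :=
  match j with
  | inl i0 => double_functional (double_center a i0) F i
  | inr j0 => vecfun (nf (Z j0) (F \mPo [tuple germ_map a j0 l | l < 3])) i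
  end.

Lemma functional_lin a j i c F G :
  functional a j (c *: F + G) i = c * functional a j F i + functional a j G i.
Proof.
case: j => [i0|j0] /=.
  rewrite /double_functional !mderivD !mderivZ !mevalD !mevalZ.
  by case: i => [|[|[|i]]] //=; rewrite ?nth_nil ?mulr0 ?addr0 // mulrDr mulrCA.
rewrite comp_mpolyD comp_mpolyZ linearP /vecfun.
by case: insub => [s|]; rewrite ?mxE ?mulr0 ?addr0.
Qed.

Definition mono (a b : nat) : S :=
  'X_[ [multinom nth 0%N [:: (t - (a + b))%N; a; b] i | i < 3] ].

Lemma mono_homog a b : (a + b <= t)%N -> mono a b \is t.-homog.
Proof.
move=> h; rewrite dhomogX -[X in X == _]/(mdeg _) mdegE !big_ord_recl big_ord0 !mnmE /=.
by apply/eqP; lia.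
Qed.

Hypothesis char0 : [pchar k] =i pred0.
Hypothesis m1 : (1 < m)%N.

Lemma euler_mon (p : 'I_3 -> k) (mo : 'X_{1..3}) i :
  p i * ('X_[mo]^`M(i)).@[p] = (mo i)%:R * ('X_[mo] : S).@[p].
Proof.
rewrite mderivX mevalZ; case: (posnP (mo i)) => [->|hi]; first by rewrite !mul0r mulr0.
have U : (U_(i) <= mo)%MM by rewrite lep1mP -lt0n.
by rewrite -{4}(submK U) mpolyXD mevalM mevalXU mulrCA [p i * _]mulrC.
Qed.

Lemma functional_polyfun j F i : polyfun (fun a => functional a j F i).
Proof.
case: j => [i0|j0] /=.
  have pe G : polyfun (fun a : T -> k => G.@[double_center a i0]).
    apply: (polyfun_ext (f := fun a =>
      \sum_(mo <- msupp G) G@_mo * \prod_l (double_center a i0 l) ^+ mo l)).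
      by move=> a; rewrite mevalE.
    apply: polyfun_sum => mo; apply: polyfunM; first exact: polyfun_const.
    apply: polyfun_prod => l; elim: (mo l) => [|d IH]; first exact: polyfun_const.
    apply: (polyfun_ext (f := fun a => a (inl (i0, l)) * double_center a i0 l ^+ d)).
      by move=> a; rewrite exprS.
    by apply: polyfunM => //; exact: polyfun_coord.
  rewrite /double_functional; case: i => [|[|[|i]]] /=.
  - exact: pe.
  - by apply: polyfunM => //; exact: polyfun_coord.
  - by apply: polyfunM => //; exact: polyfun_coord.
  - by apply: polyfun_ext (polyfun_const _ 0) => a; rewrite nth_nil.
have pm l : polyfam (fun a : T -> k => germ_map a j0 l).
  exists _, (fun mo a => a (inr (j0, l, mo))), (fun mo : 'X_{1..2 < m} => 'X_[mo]).
  by split=> // mo; exact: polyfun_coord.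
have pF : forall a : T -> k, vecfun (nf (Z j0) (F \mPo [tuple germ_map a j0 l | l < 3])) i =
   \sum_(mo <- msupp F) F@_mo * vecfun (nf (Z j0) (\prod_l germ_map a j0 l ^+ mo l)) i.
  move=> a; rewrite comp_mpolyE linear_sum /vecfun.
  case: insub => [s|]; last by rewrite big1 // => mo _; rewrite mulr0.
  rewrite summxE; apply: eq_bigr => mo _ /=.
  rewrite linearZ /= mxE; congr (_ * nf _ _ _ _).
  by apply: eq_bigr => l _; rewrite tnth_mktuple.
apply: (polyfun_ext (fun a => esym (pF a))); apply: polyfun_sum => mo.
apply: polyfunM; first exact: polyfun_const.
apply: (polyfam_linear (L := fun p => vecfun (nf (Z j0) p) i)).
  move=> c p q; rewrite linearP /vecfun.
  by case: insub => [s|]; rewrite ?mxE ?mulr0 ?addr0.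
by apply: polyfam_prod => l; exact: polyfamX.
Qed.

Lemma jet_polyE (f : {mpoly k[2]}) : (msize f <= m)%N ->
  jet_poly (fun mo : 'X_{1..2 < m} => f@_mo) = f.
Proof.
move=> h; apply/mpolyP => mo; case: (ltnP (mdeg mo) m) => hmo; first exact: trunc_coef.
rewrite [RHS]memN_msupp_eq0; last by apply: msize_mdeg_ge; exact: leq_trans hmo.
rewrite /jet_poly linear_sum big1 // => mo' _; rewrite /= mcoeffZ mcoeffX.
case: eqP => [e'|]; last by rewrite mulr0.
by have := bmdeg mo'; rewrite e' ltnNge hmo.
Qed.

Definition rows_index : finType := {j : J & 'I_(len j)}.
Definition cols_index : finType := ('I_t.+1 * 'I_t.+1)%type.

Definition entry (a : T -> k) (x : rows_index) (c : cols_index) : k :=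
  if (c.1 + c.2 <= t)%N then functional a (tag x) (mono c.1 c.2) (tagged x) else 0.

Lemma sum_rows (F : forall j, 'I_(len j) -> k) :
  \sum_(x : rows_index) F (tag x) (tagged x) = \sum_j \sum_(i < len j) F j i.
Proof. by rewrite sig_big_dep. Qed.

Hypothesis Zm : forall j, (mult (Z j) <= m)%N.
Hypothesis area : (2 * (1 + 3 * e + \sum_(j < r) length (Z j)) <= (t + 2) * (t + 1))%N.
Hypothesis budget : ((m - 1) * (t - 1) <= 2 * e)%N.

(** The configuration of [exists_free], written with first homogeneous coordinate 1. Nothing is said
    here about distinct supports or admissibility; [good_set_nonempty] adds these open
    conditions. *)
Lemma exists_free_entry : exists a, free_family (entry a).
Proof.
have [v [Fv fv]] := exists_free char0 m1 Zm area budget.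
have hin (i : 'I_e) : exists xy : k * k, forall a b l,
    v (inl i) a b l = xy.1 ^+ a * xy.2 ^+ b * nth 0 [:: 1; a%:R; b%:R] l.
  by have [x [y [_ _ h]]] := Fv (inl i); exists (x, y).
have hir (j : 'I_r) : exists fg : {mpoly k[2]} * {mpoly k[2]},
    [/\ (msize fg.1 <= m)%N, (msize fg.2 <= m)%N &
    forall a b i, v (inr j) a b i = vecfun (nf (Z j) (fg.1 ^+ a * fg.2 ^+ b)) i].
  by have [f [g h]] := Fv (inr j); exists (f, g).
have [xy hxy] := choice hin; have [fg hfg] := choice hir.
pose a (c : T) : k := match c with
  | inl (i, l) => nth 0 [:: 1; (xy i).1; (xy i).2] l
  | inr (j, l, mo) => (nth 0 [:: 1; (fg j).1; (fg j).2] l)@_mo end.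
exists a.
have fE j p q i : (p + q <= t)%N -> (i < len j)%N -> functional a j (mono p q) i = v j p q i.
  move=> pq; case: j => [i0|j0] /= hi.
    rewrite hxy /double_functional !euler_mon.
    have -> : (mono p q).@[double_center a i0] = (xy i0).1 ^+ p * (xy i0).2 ^+ q.
      by rewrite /mono mevalX prod_ord3 !mnmE /= expr1n mul1r.
    by rewrite !mnmE /=; case: i hi => [|[|[|i]]] //= _; rewrite ?mulr1 // mulrC.
  have [sf sg ->] := hfg j0; congr (vecfun (nf _ _) _).
  rewrite /mono comp_mpolyX prod_ord3 !tnth_mktuple !mnmE /=.
  have -> : germ_map a j0 o0 = 1.
    by rewrite /germ_map /= jet_polyE ?msize1 // ltnW.
  have -> : germ_map a j0 o1 = (fg j0).1 by rewrite /germ_map /= jet_polyE.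
  have -> : germ_map a j0 o2 = (fg j0).2 by rewrite /germ_map /= jet_polyE.
  by rewrite expr1n mul1r.
move=> z hz.
pose z' j i := if insub i is Some s then z (Tagged (fun j => 'I_(len j)) (s : 'I_(len j))) else 0.
have hz' : forall j i, (i < len j)%N -> z' j i = 0.
  apply: fv => p q pq.
  have hp : (p < t.+1)%N by rewrite ltnS (leq_trans _ pq) ?leq_addr.
  have hq : (q < t.+1)%N by rewrite ltnS (leq_trans _ pq) ?leq_addl.
  rewrite -[RHS](hz (Ordinal hp, Ordinal hq)).
  rewrite -(sum_rows (fun j i => z' j i * v j p q i)); apply: eq_bigr => -[j i] _.
  by rewrite /entry /= pq fE // /z' valK.
by move=> [j i]; have := hz' j i (ltn_ord i); rewrite /z' valK.
Qed.

Lemma mdeg0_lt : (mdeg (0%MM : 'X_{1..2}) < m)%N.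
Proof. by rewrite mdeg0 ltnW. Qed.

Definition zero_mon : 'X_{1..2 < m} := BMultinom mdeg0_lt.

Definition support_coord (u : J) (l : 'I_3) : T :=
  match u with inl i => inl (i, l) | inr j => inr (j, l, zero_mon) end.

Lemma supportE (a : T -> k) u l : Defs.support a u l = a (support_coord u l).
Proof.
case: u => [i|j] //=; rewrite /center eval_origin /germ_map.
rewrite /jet_poly linear_sum (bigD1 zero_mon) //= mcoeffZ mcoeffX eqxx mulr1 big1 ?addr0 //.
move=> mo hmo; rewrite mcoeffZ mcoeffX; case: eqP => [E|_]; last by rewrite mulr0.
by case/eqP: hmo; apply: val_inj.
Qed.

Lemma support_coord_inj u v l l' : support_coord u l = support_coord v l' -> u = v /\ l = l'.
Proof. by case: u => u; case: v => v //= [-> ->]. Qed.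

(** With non-zero coordinates at all supports, every x_l is invertible on the scheme, and the
    functionals of a double point detect its ideal. *)
Definition good_param (a : T -> k) :=
  free_family (entry a) /\ forall u l, Defs.support a u l != 0.

Definition cross (p q : 'I_3 -> k) := p o0 * q o1 - p o1 * q o0.

Lemma cross_same p q : same_point p q -> cross p q = 0.
Proof. by move=> [c _ h]; rewrite /cross !h; ring. Qed.

Definition germ_det (phi : 'I_3 -> {mpoly k[2]}) : k :=
  \det (\matrix_(i < 3, j < 3)
    ([:: phi i; (phi i)^`M(0); (phi i)^`M(1)]`_j).@[origin]).

Lemma germ_det_polyfun j : polyfun (fun a : T -> k => germ_det (germ_map a j)).
Proof.
apply: polyfun_det => i s.
apply: (polyfun_ext (f := fun a : T -> k => \sum_(mo : 'X_{1..2 < m})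
   a (inr (j, i, mo)) * ([:: 'X_[mo]; 'X_[mo]^`M(0); 'X_[mo]^`M(1)]`_s).@[origin])).
  move=> a; rewrite mxE /germ_map /jet_poly; case: s => [[|[|[|//]]] hs] /=.
  - by rewrite rmorph_sum; apply: eq_bigr => mo _; rewrite /= mevalZ.
  - rewrite [X in X.@[_]]linear_sum rmorph_sum; apply: eq_bigr => mo _.
    by rewrite /= mderivZ mevalZ.
  - rewrite [X in X.@[_]]linear_sum rmorph_sum; apply: eq_bigr => mo _.
    by rewrite /= mderivZ mevalZ.
apply: polyfun_sum => mo; apply: polyfunM; [exact: polyfun_coord | exact: polyfun_const].
Qed.

Lemma germ_det_neq0 j : exists a : T -> k, germ_det (germ_map a j) != 0.
Proof.
pose phi (l : 'I_3) : {mpoly k[2]} := nth 0 [:: 1; 'X_0; 'X_1] l.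
pose a (c : T) : k := match c with inl _ => 0 | inr (_, l, mo) => (phi l)@_mo end.
exists a; have -> : germ_map a j = phi.
  apply/funext => l; rewrite /germ_map jet_polyE //.
  by case: l => [[|[|[|//]]] hl]; rewrite /phi /= ?msize1 ?msizeX ?mdeg1 // ltnW.
rewrite /germ_det (_ : \matrix_(i, j) _ = 1%:M) ?det1 ?oner_neq0 //.
apply/matrixP; apply: ord3P => [||]; apply: ord3P => [||]; rewrite !mxE /phi /=;
  rewrite ?mderivX ?mderivC ?mevalC ?mevalXU ?meval1 //.
all: by rewrite mevalZ mnm1E /= ?mul0r ?mul1r // -[X in (X - _)%MM]add0m addmK mpolyX0 meval1.
Qed.

Definition entry_mx (a : T -> k) : 'M[k]_(#|rows_index|, #|cols_index|) :=
  \matrix_(i, c) entry a (enum_val i) (enum_val c).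

Definition coord_prod (a : T -> k) := \prod_(x : J * 'I_3) Defs.support a x.1 x.2.

(** The rows of [entry_mx a] are independent exactly when the determinant is non-zero for some B.
    Letting B vary replaces the choice of a maximal minor and exhibits [good_set] as a union of
    basic open sets. *)
Definition minor_coord (B : 'M[k]_(#|cols_index|, #|rows_index|)) (a : T -> k) :=
  \det (entry_mx a *m B) * coord_prod a.

Lemma coord_polyfun u l : polyfun (fun a : T -> k => Defs.support a u l).
Proof. by apply: polyfun_ext (polyfun_coord _ (support_coord u l)) => a; rewrite supportE. Qed.

Lemma coord_prod_polyfun : polyfun coord_prod.
Proof. by apply: polyfun_prod => x; exact: coord_polyfun. Qed.

Lemma minor_polyfun B : polyfun (fun a => \det (entry_mx a *m B)).
Proof.
apply: polyfun_det => i s.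
apply: (polyfun_ext (f := fun a => \sum_c entry_mx a i c * B c s)).
  by move=> a; rewrite mxE.
apply: polyfun_sum => c; apply: polyfunM; last exact: polyfun_const.
apply: (polyfun_ext (f := fun a => entry a (enum_val i) (enum_val c))).
  by move=> a; rewrite mxE.
rewrite /entry; case: ((enum_val c).1 + (enum_val c).2 <= t)%N; last exact: polyfun_const.
exact: functional_polyfun.
Qed.

Lemma minor_coord_polyfun B : polyfun (minor_coord B).
Proof. exact: polyfunM (minor_polyfun B) coord_prod_polyfun. Qed.

Definition good_set (a : T -> k) := exists B, minor_coord B a != 0.

Lemma good_set_open : @zariski_open k T good_set.
Proof.
exists (fun g => exists B, forall a, minor_coord B a = g.@[fun i => a (enum_val i)]).
move=> a; split=> [[B hB]|[g [B hB] ga]].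
  by have [g hg] := minor_coord_polyfun B; exists g; [exists B | rewrite -hg].
by exists B; rewrite hB.
Qed.

Lemma good_setP a : good_set a -> good_param a.
Proof.
move=> [B]; rewrite /minor_coord mulf_eq0 negb_or => /andP [hd hc]; split.
  apply/free_familyP/row_freeP.
  have u : entry_mx a *m B \in unitmx by rewrite unitmxE unitfE.
  by exists (B *m invmx (entry_mx a *m B)); rewrite mulmxA mulmxV.
by move=> u l; move/prodf_neq0: hc => /(_ (u, l) isT).
Qed.

Lemma good_set_nonempty : exists2 a, @admissible k e r m a & good_set a.
Proof.
have [a0 /free_familyP /row_freeP [B hB]] := exists_free_entry.
(* One polynomial function for each open condition: independence, coordinates, germ isomorphisms,
   distinct supports. Each is non-zero somewhere, so they are non-zero together at some
   parameter. *)
pose F (x : option (option ('I_r + J * J))) (a : T -> k) : k :=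
  match x with
  | None => \det (entry_mx a *m B)
  | Some None => coord_prod a
  | Some (Some (inl j)) => germ_det (germ_map a j)
  | Some (Some (inr (u, v))) => if u == v then 1 else cross (Defs.support a u) (Defs.support a v)
  end.
have pF x : polyfun (F x).
  case: x => [[[j|[u v]]|]|] /=.
  - exact: germ_det_polyfun.
  - rewrite /F; case: (u == v); first exact: polyfun_const.
    rewrite /cross; apply: polyfunD; first by apply: polyfunM; exact: coord_polyfun.
    apply: (polyfun_ext (f := fun a : T -> k =>
      -1 * (Defs.support a u o1 * Defs.support a v o0))); first by move=> a; rewrite mulN1r.
    apply: polyfunM; first exact: polyfun_const.
    by apply: polyfunM; exact: coord_polyfun.
  - exact: coord_prod_polyfun.
  - exact: minor_polyfun.
have nF x : exists a, F x a != 0.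
  case: x => [[[j|[u v]]|]|] /=.
  - exact: germ_det_neq0.
  - case: eqP => uv; first by exists (fun=> 0); exact: oner_neq0.
    exists (fun x => ((x == support_coord u o0) || (x == support_coord v o1))%:R).
    rewrite /cross !supportE !eqxx orbT mul1r.
    have -> : (support_coord u o1 == support_coord u o0) = false.
      by apply/eqP => /support_coord_inj [_].
    have -> : (support_coord u o1 == support_coord v o1) = false.
      by apply/eqP => /support_coord_inj [/uv].
    by rewrite mul0r subr0 oner_neq0.
  - exists (fun=> 1); rewrite /coord_prod big1 ?oner_neq0 // => x _.
    by rewrite supportE.
  - exists a0; rewrite (_ : entry_mx a0 *m B = 1%:M) ?det1 ?oner_neq0 //.
have [a ha] := polyfun_common char0 (index_enum _) pF nF.
move/prodf_neq0: ha => ha.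
have h1 := ha None isT; have h2 := ha (Some None) isT.
exists a; last by exists B; rewrite /minor_coord mulf_neq0.
split.
- move=> i; exists o0; move/prodf_neq0: h2 => /(_ (inl i, o0) isT).
  by rewrite supportE.
- by move=> j; exact: (ha (Some (Some (inl j))) isT).
move=> u v uv /cross_same e0; have := ha (Some (Some (inr (u, v)))) isT.
by rewrite /= (negbTE uv) e0 eqxx.
Qed.

End Functionals.

(** * The ideal of a union *)

Section FatPoints.
Variables (k : fieldType).
Local Notation S := {mpoly k[3]}.
Implicit Types (F G : S) (p : 'I_3 -> k).

Lemma hcomp_homog d d' F : F \is d.-homog -> hcomp d' F = if d' == d then F else 0.
Proof.
move=> hF; rewrite /hcomp; case: eqP => [->|/eqP ne]; first exact: pihomog_dE.
by rewrite (pihomog_ne0 _ hF) // eq_sym.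
Qed.

Lemma point_ideal_homog p d F : F \is d.-homog -> F.@[p] = 0 -> F \in point_ideal p.
Proof.
move=> hF F0; rewrite inE; apply/asboolP => d'; rewrite (hcomp_homog d' hF).
by case: eqP => // _; rewrite meval0.
Qed.

Lemma point_ideal_eval p F : F \in point_ideal p -> F.@[p] = 0.
Proof.
rewrite inE => /asboolP h.
have -> : F = \sum_(d < msize F) hcomp d F by rewrite -pihomog_partitionE.
by rewrite rmorph_sum big1 // => d _; rewrite /= h.
Qed.

Definition double_zero p F := forall i, (i < 3)%N -> double_functional p F i = 0.

Lemma double_zeroP p F : (forall l, p l != 0) ->
  double_zero p F <-> [/\ F.@[p] = 0, (F^`M(o1)).@[p] = 0 & (F^`M(o2)).@[p] = 0].
Proof.
move=> p0; split=> [h|[h0 h1 h2] [|[|[|i]]] //=].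
- have /eqP := h 1%N isT; have /eqP := h 2%N isT; have := h 0%N isT.
  rewrite /double_functional /= !mulf_eq0 !(negbTE (p0 _)) /=.
  by move=> -> /eqP -> /eqP ->.
- by rewrite /double_functional /= h1 mulr0.
- by rewrite /double_functional /= h2 mulr0.
Qed.

Lemma fat_double_zero p F : (forall l, p l != 0) ->
  F \in fat_point_ideal 2 p -> double_zero p F.
Proof.
move=> p0; rewrite inE => /asboolP [n [a [g [hg ->]]]].
have g0 i j : (g i j).@[p] = 0 by apply: point_ideal_eval.
apply/double_zeroP => //.
have dz l : ((\sum_i a i * \prod_(j < 2) g i j)^`M(l)).@[p] = 0.
  rewrite [X in X.@[_]]linear_sum rmorph_sum big1 // => i _ /=.
  rewrite !big_ord_recl big_ord0 mulr1 !mderivM !mevalD !mevalM !mevalD !mevalM !g0.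
  by rewrite !(mulr0, mul0r, addr0).
split=> //; rewrite rmorph_sum big1 // => i _ /=.
by rewrite !big_ord_recl big_ord0 mulr1 !mevalM !g0 !mulr0.
Qed.

Let lin p (l : 'I_3) : S := p o0 *: 'X_l - p l *: 'X_o0.

Let lin_point p l : lin p l \in point_ideal p.
Proof.
apply: (@point_ideal_homog _ 1).
  by rewrite rpredB // rpredZ // dhomogX -[X in X == _]/(mdeg _) mdeg1.
by rewrite /lin mevalB !mevalZ !mevalXU mulrC subrr.
Qed.

(** Each x_l is congruent to a multiple of x_0 modulo the linear forms [lin], which cut out the
    point. Keeping track of degrees makes the cofactors homogeneous, so that they belong to the
    point ideal as soon as they vanish at p; the third clause covers degree 0, where [.-1]
    truncates. *)
Let expand_mon p mo : exists A h1 h2,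
  [/\ h1 \is (mdeg mo).-1.-homog, h2 \is (mdeg mo).-1.-homog,
      mdeg mo = 0%N -> h1 = 0 /\ h2 = 0 &
   p o0 ^+ mdeg mo *: 'X_[mo] = A *: 'X_o0 ^+ mdeg mo + h1 * lin p o1 + h2 * lin p o2].
Proof.
have [d hd] : exists d, mdeg mo = d by eexists.
rewrite hd; elim: d mo hd => [|d IH] mo hd.
  exists 1, 0, 0; split; rewrite ?rpred0 //.
  have -> : mo = 0%MM by apply/eqP; rewrite -mdeg_eq0 hd.
  by rewrite mpolyX0 !expr0 !mul0r !addr0.
have [l hl] : exists l, mo l != 0%N.
  apply/existsP; rewrite -negb_forall; apply/negP => /forallP h0.
  by move: hd; rewrite mdegE big1 // => i _; apply/eqP; exact: h0.
have U : (U_(l) <= mo)%MM by rewrite lep1mP.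
have hd' : mdeg (mo - U_(l)) = d by move: hd; rewrite -{1}(submK U) mdegD mdeg1; lia.
have [A [h1 [h2 [H1 H2 hz e]]]] := IH _ hd'.
have X1 i : ('X_i : S) \is 1.-homog by rewrite dhomogX -[X in X == _]/(mdeg _) mdeg1.
have Xd : ('X_o0 ^+ d : S) \is d.-homog by have := dhomogMn d (X1 o0); rewrite mul1n.
have mulX h i : h \is d.-1.-homog -> (d = 0%N -> h = 0) -> ('X_i * h : S) \is d.-homog.
  move=> hh; case: d {IH hd hd' H1 H2 hz e Xd} hh => [|d] hh h0.
    by rewrite h0 // mulr0 rpred0.
  by have := dhomogM (X1 i) hh; rewrite add1n.
have key i (B1 B2 C : k) : p o0 *: 'X_i = C *: 'X_o0 + B1 *: lin p o1 + B2 *: lin p o2 ->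
   p o0 ^+ d.+1 *: ('X_i * 'X_[mo - U_(l)]) =
     (C * A) *: 'X_o0 ^+ d.+1 + (p o0 *: ('X_i * h1) + (B1 * A) *: 'X_o0 ^+ d) * lin p o1
       + (p o0 *: ('X_i * h2) + (B2 * A) *: 'X_o0 ^+ d) * lin p o2.
  move=> ei; have -> : p o0 ^+ d.+1 *: ('X_i * 'X_[mo - U_(l)]) =
     (p o0 *: 'X_i) * (p o0 ^+ d *: 'X_[mo - U_(l)]) :> S.
    by rewrite -scalerAl -scalerAr scalerA exprS.
  move: ei; rewrite e; move: (lin p o1) (lin p o2) => w1 w2 ei.
  have -> : p o0 *: 'X_i * (A *: 'X_o0 ^+ d + h1 * w1 + h2 * w2) =
    (A *: 'X_o0 ^+ d) * (p o0 *: 'X_i) + (p o0 *: 'X_i) * (h1 * w1 + h2 * w2) by ring.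
  rewrite {1}ei exprS -!mul_mpolyC !mpolyCM.
  by ring.
exists (match val l with 0 => p o0 | 1 => p o1 | _ => p o2 end * A).
exists (p o0 *: ('X_l * h1) + ((l == o1)%:R * A) *: 'X_o0 ^+ d).
exists (p o0 *: ('X_l * h2) + ((l == o2)%:R * A) *: 'X_o0 ^+ d).
split=> //.
- by rewrite rpredD ?rpredZ ?mulX // => /hz [].
- by rewrite rpredD ?rpredZ ?mulX // => /hz [].
have -> : 'X_[mo] = 'X_l * 'X_[mo - U_(l)] :> S by rewrite -mpolyXD addmC submK.
apply: key; move: (l); apply: ord3P; rewrite /lin /=.
- by rewrite !scale0r !addr0.
- by rewrite scale1r scale0r addr0 addrC subrK.
- by rewrite scale1r scale0r addr0 addrC subrK.
Qed.

(** In the expansion along the two linear forms, F(p) = 0 removes the power of x_0, and the two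
    derivatives at p show that the cofactors vanish there. So F is a sum of products of two elements
    of the point ideal. *)
Lemma fat_double_homog p d F : (forall l, p l != 0) -> F \is d.-homog ->
  double_zero p F -> F \in fat_point_ideal 2 p.
Proof.
move=> p0 hF zF.
have [A [h1 [h2 [H1 H2 e]]]] : exists A h1 h2, [/\ h1 \is d.-1.-homog, h2 \is d.-1.-homog &
   p o0 ^+ d *: F = A *: 'X_o0 ^+ d + h1 * lin p o1 + h2 * lin p o2].
  have : forall mo, mo \in msupp F -> mdeg mo = d by apply/dhomogP.
  rewrite {2}(mpolyE F); elim: (msupp F) => [|mo s IH] hs.
    by exists 0, 0, 0; rewrite !rpred0 big_nil scaler0 !mul0r !addr0 scale0r.
  have [|A [h1 [h2 [H1 H2 e]]]] := IH; first by move=> mo' h; apply: hs; rewrite inE h orbT.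
  have [A' [h1' [h2' [H1' H2' _ e']]]] := expand_mon p mo.
  have dm : mdeg mo = d by apply: hs; rewrite inE eqxx.
  rewrite dm in H1' H2' e'.
  exists (F@_mo * A' + A), (F@_mo *: h1' + h1), (F@_mo *: h2' + h2).
  split; rewrite ?rpredD ?rpredZ //.
  rewrite big_cons scalerDr e scalerA mulrC -scalerA e'.
  rewrite -!mul_mpolyC !mpolyCD !mpolyCM; ring.
have [z0 z1 z2] := (double_zeroP F p0).1 zF.
have lin0 l : (lin p l).@[p] = 0 by exact/point_ideal_eval/lin_point.
have A0 : A = 0.
  have /(congr1 (meval p)) := e.
  rewrite !mevalD !mevalZ !mevalM !lin0 !mulr0 !addr0 z0 mulr0 rmorphXn /= mevalXU => /esym/eqP.
  by rewrite mulf_eq0 expf_eq0 (negbTE (p0 _)) andbF orbF => /eqP.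
have dlin (l s : 'I_3) : s != o0 -> ((lin p l)^`M(s)).@[p] = p o0 *+ (l == s).
  move=> s0; rewrite /lin mderivB !mderivZ !mderivX !mnm1E mevalB !mevalZ.
  rewrite [o0 == s]eq_sym (negbTE s0) mul0r mulr0 subr0.
  case: eqP => [->|_]; last by rewrite mul0r mulr0.
  by rewrite -[X in (X - _)%MM]add0m addmK mpolyX0 meval1 !mulr1.
have hp (l : 'I_3) : l != o0 ->
    h1.@[p] * (p o0 *+ (o1 == l)) + h2.@[p] * (p o0 *+ (o2 == l)) = p o0 ^+ d * (F^`M(l)).@[p].
  move=> l0; have /(congr1 (fun G => (G^`M(l)).@[p])) := e.
  rewrite A0 scale0r add0r mderivZ mevalZ mderivD !mderivM !mevalD !mevalM !lin0.
  rewrite !mulr0 !add0r => ->.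
  by rewrite !dlin.
have h10 : h1.@[p] = 0.
  have := hp o1 isT; rewrite z1 mulr0 eqxx mulr0 addr0 => /eqP.
  by rewrite mulf_eq0 (negbTE (p0 _)) orbF => /eqP.
have h20 : h2.@[p] = 0.
  have := hp o2 isT; rewrite z2 mulr0 eqxx mulr0 add0r => /eqP.
  by rewrite mulf_eq0 (negbTE (p0 _)) orbF => /eqP.
rewrite inE; apply/asboolP.
exists 2%N, (fun=> (p o0 ^- d)%:MP).
exists (fun i j => nth 0 (nth [::] [:: [:: h1; lin p o1]; [:: h2; lin p o2]] i) j).
split.
  move=> [[|[|//]] hi] [[|[|//]] hj] /=; try exact: lin_point.
    exact: point_ideal_homog H1 h10.
  exact: point_ideal_homog H2 h20.
have -> : F = p o0 ^- d *: (p o0 ^+ d *: F).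
  by rewrite scalerA mulVf ?scale1r // expf_neq0.
rewrite e A0 scale0r add0r !big_ord_recl !big_ord0 /= -mul_mpolyC.
by ring.
Qed.

End FatPoints.

Lemma free_family_solve (k : fieldType) (I C : finType) (f : I -> C -> k) :
  free_family f -> forall w : I -> k, exists y : C -> k,
  forall i, \sum_c f i c * y c = w i.
Proof.
move=> /free_familyP /row_freeP [B hB] w.
exists (fun c => \sum_s B (enum_rank c) s * w (enum_val s)) => i.
have := congr1 (fun m : 'M_(_, 1) => m (enum_rank i) 0)
  (mulmxA (\matrix_(i, c) f (enum_val i) (enum_val c)) B (\col_s w (enum_val s))).
rewrite hB mul1mx !mxE enum_rankK => <-.
rewrite (reindex (@enum_val C C)) /=; last exact/onW_bij/enum_val_bij.
apply: eq_bigr => c _; rewrite !mxE !enum_rankK enum_valK; congr (_ * _).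
by apply: eq_bigr => s _; rewrite !mxE.
Qed.

Section Vanishing.
Variables (k : fieldType) (t r e m : nat) (Z : 'I_r -> germ_scheme k).
Local Notation S := {mpoly k[3]}.
Local Notation J := ('I_e + 'I_r)%type.
Local Notation T := (coords e r m).
Local Notation len := (@piece_length k r e Z).
Variable a : T -> k.
Local Notation pull j F := (F \mPo [tuple germ_map a j l | l < 3]).

Definition vanish (F : S) :=
  forall j i, (i < len j)%N -> functional Z a j F i = 0.

Hypothesis coords0 : forall u l, Defs.support a u l != 0.

Lemma vecfun_eq0 l (v : 'rV[k]_l) : (forall i, (i < l)%N -> vecfun v i = 0) <-> v = 0.
Proof.
split=> [h|-> i hi]; last by rewrite /vecfun; case: insub => // s; rewrite mxE.
by apply/rowP => i; have := h i (ltn_ord i); rewrite /vecfun valK mxE.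
Qed.

Lemma vanishP F : vanish F <->
  (forall i, double_zero (double_center a i) F) /\ (forall j, pull j F \in Z j).
Proof.
split=> [h|[hd hg] [i|j] l hl].
- split=> [i l hl|j]; first exact: (h (inl i)).
  by apply/nf_eq0/vecfun_eq0 => l hl; exact: (h (inr j)).
- exact: hd.
by move: l hl; apply/vecfun_eq0/nf_eq0.
Qed.

Lemma union_ideal_homog d F : F \is d.-homog ->
  (F \in union_ideal Z a) <-> vanish F.
Proof.
move=> hF; rewrite vanishP inE; split.
  case/andP => /forallP hd /forallP hg; split=> [i|j].
    by apply: fat_double_zero => //; exact: (coords0 (inl i)).
  by have := hg j; rewrite inE => /asboolP /(_ d); rewrite (hcomp_homog _ hF) eqxx.
move=> [hd hg]; apply/andP; split; apply/forallP => i.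
  by apply: fat_double_homog hF _ => //; exact: (coords0 (inl i)).
rewrite inE; apply/asboolP => d'; rewrite (hcomp_homog _ hF).
by case: eqP => // _; rewrite comp_mpoly0 germ0.
Qed.

Lemma vanishD F G : vanish F -> vanish G -> vanish (F + G).
Proof.
by move=> hF hG j i hi; rewrite -[F]scale1r functional_lin hF ?hG // mulr0 addr0.
Qed.

Lemma vanishM B F : vanish F -> vanish (B * F).
Proof.
move=> /vanishP [hd hg]; apply/vanishP; split=> [i|j].
  have c0 := coords0 (inl i).
  have [h0 h1 h2] := (double_zeroP F c0).1 (hd i).
  by apply/(double_zeroP _ c0); rewrite !mderivM !mevalD !mevalM h0 h1 h2 !mulr0 addr0.
by rewrite rmorphM /= germM.
Qed.

(** At a double point x_l is non-zero, and Leibniz' rule passes the vanishing on to F; on a germ,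
    x_l pulls back to a unit modulo Z. *)
Lemma vanishXn_cancel l n F : vanish ('X_l ^+ n * F) -> vanish F.
Proof.
elim: n => [|n IH]; first by rewrite expr0 mul1r.
rewrite exprS -mulrA => h; apply: IH; move: h; move: ('X_l ^+ n * F) => {}F.
move=> /vanishP [hd hg]; apply/vanishP; split=> [i|j].
  have c0 := coords0 (inl i).
  have [h0 h1 h2] := (double_zeroP _ c0).1 (hd i).
  have F0 : F.@[double_center a i] = 0.
    by move/eqP: h0; rewrite mevalM mevalXU mulf_eq0 (negbTE (c0 l)) => /eqP.
  apply/(double_zeroP _ c0); move: h1 h2.
  rewrite !mderivM !mevalD !mevalM F0 !mulr0 !add0r !mevalXU => /eqP h1 /eqP h2.
  by move: h1 h2; rewrite !mulf_eq0 !(negbTE (c0 l)) => /eqP -> /eqP ->.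
have [g hgl] : exists g, germ_map a j l * g - 1 \in Z j.
  by apply: germ_unit; exact: (coords0 (inr j) l).
have e1 : pull j ('X_l * F) = germ_map a j l * pull j F.
  by rewrite rmorphM /= comp_mpolyXU -tnth_nth tnth_mktuple.
have -> : pull j F = g * pull j ('X_l * F) + (- pull j F) * (germ_map a j l * g - 1).
  by rewrite e1; ring.
by rewrite germD // germM // hg.
Qed.

Hypothesis entry_free : free_family (@entry k t r e m Z a).

Lemma functional_solve (w : J -> nat -> k) : exists2 F, F \is t.-homog &
  forall j i, (i < len j)%N -> functional Z a j F i = w j i.
Proof.
have [y hy] := free_family_solve entry_free (fun x => w (tag x) (tagged x)).
have f0 j i : functional Z a j 0 i = 0.
  by have := functional_lin Z a j i (-1) 0 0; rewrite scaler0 addr0 mulN1r addNr.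
exists (\sum_(c : cols_index t | (c.1 + c.2 <= t)%N) y c *: mono k t c.1 c.2).
  by apply: rpred_sum => c hc; rewrite rpredZ // mono_homog.
move=> j i hi; pose x : rows_index e Z := Tagged (fun j => 'I_(len j)) (Ordinal hi).
pose H F := functional Z a j F i.
have HD F G : H (F + G) = H F + H G by rewrite -[F]scale1r /H functional_lin mul1r scale1r.
rewrite -[RHS](hy x) -[LHS]/(H _) (big_morph H HD (f0 j i)).
rewrite big_mkcond; apply: eq_bigr => c _; rewrite /entry.
case: ifP => _; last by rewrite mul0r.
by rewrite /H -[_ *: _]addr0 functional_lin f0 addr0 mulrC.
Qed.

(** Independence makes the forms of degree t take arbitrary values on the scheme, in particular
    those of -L / x_0^n, which is regular there because x_0 is invertible on it. *)
Lemma vanish_lift n L : exists2 F, F \is t.-homog & vanish ('X_o0 ^+ n * F + L).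
Proof.
have ex_psi j : exists psi, germ_map a j o0 ^+ n * psi - 1 \in Z j.
  by apply: germ_unit; rewrite rmorphXn expf_neq0 //; exact: (coords0 (inr j) o0).
have [psi hpsi] := choice ex_psi.
pose p i := double_center a i.
have p0 i : p i o0 ^+ n != 0 by rewrite expf_neq0 //; exact: (coords0 (inl i)).
pose w (j : J) i := match j with
  | inl i0 => - (double_functional (p i0) L i / p i0 o0 ^+ n)
  | inr j0 => vecfun (nf (Z j0) (- psi j0 * pull j0 L)) i end.
have [F hF wF] := functional_solve w.
exists F => //; apply/vanishP; split=> [i|j].
  have c0 := coords0 (inl i).
  have F0 := wF (inl i) 0%N isT; have F1 := wF (inl i) 1%N isT; have F2 := wF (inl i) 2%N isT.
  move: F0 F1 F2; rewrite /= /double_functional /= -/(p i) => F0 F1 F2.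
  (* Powers of x_0 have no derivative along x_1 and x_2, so multiplying by x_0^n merely scales the
     functionals of a double point. *)
  have c1 s : s != o0 -> (('X_o0 ^+ n : S)^`M(s)).@[p i] = 0.
    move=> s0; elim: (n) => [|n' IH]; first by rewrite expr0 -mpolyC1 mderivC meval0.
    rewrite exprS mderivM mevalD !mevalM IH mulr0 addr0 mderivX mevalZ mnm1E.
    by rewrite eq_sym (negbTE s0) !mul0r.
  have dE s : s != o0 -> p i s != 0 ->
    p i s * F^`M(s).@[p i] = - (p i s * L^`M(s).@[p i] / p i o0 ^+ n) ->
    (('X_o0 ^+ n * F + L)^`M(s)).@[p i] = 0.
    move=> s0 ps hs; rewrite mderivD mderivM !mevalD !mevalM c1 // mul0r add0r.
    apply: (mulfI ps); rewrite mulr0 mulrDr rmorphXn /= mevalXU mulrCA hs.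
    by rewrite mulrN mulrC divfK // addNr.
  apply/(double_zeroP _ c0); split.
  - by rewrite mevalD mevalM rmorphXn /= mevalXU F0 mulrN mulrC divfK // addNr.
  - by apply: dE => //; exact: c0.
  - by apply: dE => //; exact: c0.
have eF : nf (Z j) (pull j F) = nf (Z j) (- psi j * pull j L).
  apply/subr0_eq/vecfun_eq0 => i hi; have := wF (inr j) i hi; rewrite /= /vecfun.
  by case: insub => // s; rewrite !mxE => ->; rewrite subrr.
apply/nf_eq0; rewrite rmorphD rmorphM rmorphXn /= comp_mpolyXU -tnth_nth tnth_mktuple.
rewrite linearD /= (nf_mul _ eF) -linearD; apply/nf_eq0.
have -> : germ_map a j o0 ^+ n * (- psi j * pull j L) + pull j L =
   - pull j L * (germ_map a j o0 ^+ n * psi j - 1) by ring.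
by rewrite germM.
Qed.

End Vanishing.

(** * Splitting Cech cocycles *)

Section MonomialDivision.
Variable k : fieldType.
Local Notation S := {mpoly k[3]}.
Implicit Types (F G : S) (w mo : 'X_{1..3}).

Lemma homogXn (i : 'I_3) n d F : F \is d.-homog -> 'X_i ^+ n * F \is (n + d).-homog.
Proof.
move=> hF; apply: dhomogM hF; rewrite -[n in n.-homog]mul1n; apply: dhomogMn.
by rewrite dhomogX -[X in X == _]/(mdeg _) mdeg1.
Qed.

Definition low (i : 'I_3) n G : S := \sum_(mo <- msupp G | (mo i < n)%N) G@_mo *: 'X_[mo].

Lemma mcoeff_low i n G mo : (low i n G)@_mo = if (mo i < n)%N then G@_mo else 0.
Proof.
rewrite /low linear_sum /=; case: ifP => hn; last first.
  rewrite big1 // => mo' hmo'; rewrite mcoeffZ mcoeffX; case: eqP => [e|_]; last exact: mulr0.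
  by rewrite e hn in hmo'.
case: (boolP (mo \in msupp G)) => hmo; last first.
  rewrite (memN_msupp_eq0 hmo) big_seq_cond big1 // => mo' /andP [hmo' _].
  rewrite mcoeffZ mcoeffX; case: eqP => [e|_]; last exact: mulr0.
  by rewrite -e hmo' in hmo.
rewrite -big_filter (bigD1_seq mo) /=; last by rewrite filter_uniq ?msupp_uniq.
  rewrite mcoeffZ mcoeffX eqxx mulr1 big1 ?addr0 // => mo' ne.
  by rewrite mcoeffZ mcoeffX (negbTE ne) mulr0.
by rewrite mem_filter hn.
Qed.

Lemma low_homog i n d G : G \is d.-homog -> low i n G \is d.-homog.
Proof.
move=> /dhomogP hG; rewrite /low big_seq_cond; apply: rpred_sum => mo /andP [hmo _].
by rewrite rpredZ // dhomogX; apply/eqP; exact: hG.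
Qed.

Lemma lowD i n F G : low i n (F + G) = low i n F + low i n G.
Proof.
by apply/mpolyP => mo; rewrite mcoeffD !mcoeff_low mcoeffD; case: ifP; rewrite ?addr0.
Qed.

Lemma msupp_Xn i n F mo : mo \in msupp ('X_i ^+ n * F) -> (n <= mo i)%N.
Proof.
have -> : 'X_i ^+ n = 'X_[U_(i) *+ n] :> S by rewrite mpolyXn.
move=> /msuppM_le /allpairsP [[w mo'] /= [hw _ ->]].
by move: hw; rewrite msuppX inE => /eqP ->; rewrite mnmDE mulmnE mnm1E eqxx mul1n leq_addr.
Qed.

Lemma low_Xn i n F : low i n ('X_i ^+ n * F) = 0.
Proof.
apply/mpolyP => mo; rewrite mcoeff_low mcoeff0; case: ltnP => // h.
apply: memN_msupp_eq0; apply: contraL h; rewrite -leqNgt; exact: msupp_Xn.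
Qed.

Lemma mono_div w d G : G \is (mdeg w + d).-homog ->
  (forall mo, mo \in msupp G -> (w <= mo)%MM) ->
  exists2 L, L \is d.-homog & G = 'X_[w] * L.
Proof.
move=> /dhomogP hG hw; exists (\sum_(mo <- msupp G) G@_mo *: 'X_[mo - w]).
  rewrite big_seq; apply: rpred_sum => mo hmo; rewrite rpredZ // dhomogX.
  have := hG _ hmo; rewrite -{1}(submK (hw _ hmo)) /= mdegD addnC => /eqP.
  by rewrite eqn_add2l.
rewrite {1}(mpolyE G) mulr_sumr [LHS]big_seq [RHS]big_seq; apply: eq_bigr => mo hmo.
by rewrite -scalerAr -mpolyXD addmC submK ?hw.
Qed.

Lemma two_div (i j : 'I_3) n d G : i != j -> G \is (n + n + d).-homog ->
  (forall mo, mo \in msupp G -> (n <= mo i)%N /\ (n <= mo j)%N) ->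
  exists2 L, L \is d.-homog & G = 'X_i ^+ n * 'X_j ^+ n * L.
Proof.
move=> ij hG hs.
have [||L hL e] := @mono_div (U_(i) *+ n + U_(j) *+ n)%MM d G.
- by rewrite mdegD !mdegMn !mdeg1 !mul1n.
- move=> mo /hs [hi hj]; apply/mnm_lepP => l; rewrite mnmDE !mulmnE !mnm1E.
  case: (i =P l) => [<-|_]; first by rewrite eq_sym (negbTE ij) mul1n mul0n addn0.
  by case: (j =P l) => [<-|_]; rewrite mul0n ?mul1n ?mul0n add0n.
by exists L => //; rewrite e mpolyXD !mpolyXn.
Qed.

End MonomialDivision.

Lemma frac_expand (K : fieldType) (x y f : K) p n : x != 0 -> y != 0 -> (p <= n)%N ->
  f / (x * y) ^+ p = x ^+ (n - p) * (y ^+ (n - p) * f) / (x ^+ n * y ^+ n).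
Proof.
move=> x0 y0 h; rewrite -{3 4}(subnK h) !exprD exprMn.
by field; rewrite !expf_neq0.
Qed.

Lemma frac_glue (K : fieldType) (x y z f g h : K) : x != 0 -> y != 0 -> z != 0 ->
  g / (x * z) = f / (x * y) + h / (y * z) -> y * g = z * f + x * h.
Proof.
move=> x0 y0 z0 e; have -> : y * g = (g / (x * z)) * (x * y * z) by field; rewrite ?x0 ?y0 ?z0.
by rewrite e; field; rewrite ?x0 ?y0 ?z0.
Qed.

Lemma frac_split (K : fieldType) (x y z f u v : K) : x != 0 -> y != 0 -> z != 0 ->
  x * (z * v) = z * f + y * z * u -> f / (x * y) = v / y - u / x.
Proof.
move=> x0 y0 z0 e; have -> : f = x * v - y * u.
  apply: (mulfI z0); rewrite mulrBr mulrCA e; ring.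
by field; rewrite ?x0 ?y0 ?z0.
Qed.

Section Cech.
Variables (k : fieldType) (t : nat) (I : {pred {mpoly k[3]}}) (V : {mpoly k[3]} -> Prop).
Local Notation S := {mpoly k[3]}.
Hypothesis I_V : forall d F, F \is d.-homog -> F \in I <-> V F.
Hypothesis V_D : forall F G, V F -> V G -> V (F + G).
Hypothesis V_M : forall B F, V F -> V (B * F).
Hypothesis V_cancel : forall l n F, V ('X_l ^+ n * F) -> V F.
Hypothesis V_lift : forall n L, exists2 F, F \is t.-homog & V ('X_o0 ^+ n * F + L).

Let X0 (i : 'I_3) : ('X_i : S) != 0.
Proof. by rewrite -msize_poly_eq0 msizeX mdeg1. Qed.

(** The exponent of the denominator can be raised at will, so that the three components of the
    cocycle share one n. *)
Lemma section_pair i j c : section I t ('X_i * 'X_j) c ->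
  exists n0, forall n, (n0 <= n)%N -> exists F : S,
  [/\ V F, F \is (n + (n + t)).-homog &
   c = tofrac F / (tofrac 'X_i ^+ n * tofrac 'X_j ^+ n)].
Proof.
case=> n0 [F [FI hF ->]]; exists n0 => n hn.
exists ('X_i ^+ (n - n0) * ('X_j ^+ (n - n0) * F)); split.
- by do 2!apply: V_M; apply/(I_V hF).
- have := homogXn i (n - n0) (homogXn j (n - n0) hF).
  rewrite msizeM // !msizeX !mdeg1 /=; congr (_ \is _.-homog); lia.
rewrite !tofracM !tofracXn; apply: frac_expand => //; by rewrite tofrac_eq0.
Qed.

Lemma cech_vanishing : H1_eq0 I t.
Proof.
move=> c hc cocycle.
have c00 i : c i i = 0.
  by apply: (addrI (c i i)); rewrite addr0 -cocycle.
have [n1 h1] := section_pair (hc o0 o1); have [n2 h2] := section_pair (hc o0 o2).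
have [n3 h3] := section_pair (hc o1 o2).
pose n := maxn n1 (maxn n2 n3).
have [|F1 [VF1 hF1 e1]] := h1 n; first by rewrite /n; lia.
have [|F2 [VF2 hF2 e2]] := h2 n; first by rewrite /n; lia.
have [|F3 [_ _ e3]] := h3 n; first by rewrite /n; lia.
move: n hF1 e1 hF2 e2 e3 {h1 h2 h3} => n hF1 e1 hF2 e2 e3.
have x0 i : tofrac ('X_i : S) ^+ n != 0 by rewrite expf_neq0 // tofrac_eq0.
have glue : 'X_o1 ^+ n * F2 = 'X_o2 ^+ n * F1 + 'X_o0 ^+ n * F3.
  apply/eqP; rewrite -tofrac_eq tofracD !tofracM !tofracXn; apply/eqP.
  have := cocycle o0 o1 o2; rewrite e1 e2 e3.
  exact: frac_glue.
pose G1 := 'X_o2 ^+ n * F1; pose G2 := 'X_o1 ^+ n * F2.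
(* Brought to the denominator (x_0 x_1 x_2)^n, the components c_01 and c_02 have the same part with
   a pole along x_0 = 0. Being low in both numerators, it is divisible by x_1^n and by x_2^n, and
   reduces to L / x_0^n. *)
have lowE : low o0 n G1 = low o0 n G2 by rewrite /G2 glue lowD low_Xn addr0.
have hG1 : G1 \is (n + n + (n + t)).-homog.
  by have := homogXn o2 n hF1; congr (_ \is _.-homog); lia.
have hG2 : G2 \is (n + n + (n + t)).-homog.
  by have := homogXn o1 n hF2; congr (_ \is _.-homog); lia.
have lowP (G : S) mo : mo \in msupp (low o0 n G) -> mo \in msupp G.
  by rewrite !mcoeff_msupp mcoeff_low; case: ifP; rewrite ?eqxx.
have highP (G : S) mo : mo \in msupp (G - low o0 n G) -> mo \in msupp G /\ (n <= mo o0)%N.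
  by rewrite !mcoeff_msupp mcoeffB mcoeff_low; case: ltnP; rewrite ?subrr ?eqxx ?subr0.
have [|||L hL eL] := @two_div k o1 o2 n (n + t) (low o0 n G1) => //; first exact: low_homog.
  move=> mo hmo; split; last by apply: msupp_Xn (lowP _ _ hmo).
  by rewrite lowE in hmo; apply: msupp_Xn (lowP _ _ hmo).
have [|||H1 hH1 eH1] := @two_div k o0 o2 n (n + t) (G1 - low o0 n G1) => //.
- by rewrite rpredB ?low_homog.
- by move=> mo /highP [hmo ?]; split=> //; apply: msupp_Xn hmo.
have [|||H2 hH2 eH2] := @two_div k o0 o1 n (n + t) (G2 - low o0 n G2) => //.
- by rewrite rpredB ?low_homog.
- by move=> mo /highP [hmo ?]; split=> //; apply: msupp_Xn hmo.
rewrite -lowE eL in eH2; rewrite eL in eH1.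
have [F hF VF] := V_lift n L.
(* The cochain (-L / x_0^n, H1 / x_1^n, H2 / x_2^n) splits the cocycle in the structure sheaf;
   subtracting the global form F from every component preserves this. F makes the first numerator
   vanish on the scheme, and E1, E2 with cancellation give the others. *)
pose N0 := - ('X_o0 ^+ n * F + L).
pose N1 := H1 - 'X_o1 ^+ n * F; pose N2 := H2 - 'X_o2 ^+ n * F.
have VN0 : V N0 by rewrite /N0 -mulN1r; exact: V_M.
have E1 : 'X_o0 ^+ n * ('X_o2 ^+ n * N1) = 'X_o2 ^+ n * F1 + 'X_o1 ^+ n * 'X_o2 ^+ n * N0.
  rewrite mulrA mulrBr -eH1 /G1 /N0; ring.
have E2 : 'X_o0 ^+ n * ('X_o1 ^+ n * N2) = 'X_o1 ^+ n * F2 + 'X_o2 ^+ n * 'X_o1 ^+ n * N0.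
  rewrite mulrA mulrBr -eH2 /G2 /N0; ring.
have VN1 : V N1.
  apply: (V_cancel (l := o2) (n := n)); apply: (V_cancel (l := o0) (n := n)).
  by rewrite E1; apply: V_D; apply: V_M.
have VN2 : V N2.
  apply: (V_cancel (l := o1) (n := n)); apply: (V_cancel (l := o0) (n := n)).
  by rewrite E2; apply: V_D; apply: V_M.
have hXF i : 'X_i ^+ n * F \is (n + t).-homog by exact: homogXn.
have hN0 : N0 \is (n + t).-homog by rewrite rpredN rpredD.
have hN1 : N1 \is (n + t).-homog by rewrite /N1 rpredB //; exact: hXF.
have hN2 : N2 \is (n + t).-homog by rewrite /N2 rpredB //; exact: hXF.
pose N (i : 'I_3) := nth 0 [:: N0; N1; N2] i.
pose b (i : 'I_3) : {fraction S} := tofrac (N i) / tofrac 'X_i ^+ n.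
have hb : forall i, c o0 i = b i - b o0.
  apply: ord3P; first by rewrite c00 subrr.
  - have := congr1 (@tofrac _) E1; rewrite tofracD !tofracM !tofracXn e1.
    exact: frac_split.
  - have := congr1 (@tofrac _) E2; rewrite tofracD !tofracM !tofracXn e2.
    exact: frac_split.
exists b => [i|i j].
  exists n, (N i).
  have [VN hN] : V (N i) /\ N i \is (n + t).-homog.
    move: i; apply: ord3P.
    + exact: conj VN0 hN0.
    + exact: conj VN1 hN1.
    + exact: conj VN2 hN2.
  split=> //; first exact/(I_V hN).
  by rewrite msizeX mdeg1 /= muln1 addnC.
have -> : c i j = c o0 j - c o0 i by rewrite (cocycle o0 i j) addrC addKr.
by rewrite !hb opprB addrA subrK.
Qed.

End Cech.

Lemma H1_of_good_param (k : fieldType) (t r e m : nat) (Z : 'I_r -> germ_scheme k)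
    (a : coords e r m -> k) : good_param t Z a -> H1_eq0 (union_ideal Z a) t.
Proof.
move=> [entry_free coords0]; apply: (@cech_vanishing _ _ _ (vanish Z a)).
- by move=> d F hF; exact: (union_ideal_homog Z coords0 hF).
- exact: vanishD.
- move=> B F. exact: (vanishM coords0).
- by move=> l n F; exact: (vanishXn_cancel coords0).
- by move=> n L; exact: (vanish_lift coords0 entry_free).
Qed.

Local Close Scope ring_scope.

Theorem theorem0p3 (k : closedFieldType) (char0 : [pchar k]%R =i pred0)
    (t r e : nat) (t_gt0 : 0 < t) (r_gt0 : 0 < r) (e_gt0 : 0 < e)
    (Z : 'I_r -> germ_scheme k) :
  let m' := \max_(j < r) mult (Z j) in
  let m := maxn m' 2 in
  2 * (1 + 3 * e + \sum_(j < r) length (Z j)) <= (t + 2) * (t + 1) ->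
  (m - 1) * (t - 1) <= 2 * e ->
  for_general_union e m Z (fun I => H1_eq0 I t).
Proof.
move=> m' m area budget.
have m1 : 1 < m by rewrite leq_max orbT.
have Zm j : mult (Z j) <= m by rewrite leq_max (leq_bigmax j).
exists (@good_set k t r e m Z); split.
- exact: good_set_open.
- exact: good_set_nonempty.
- by move=> a _ /good_setP; exact: H1_of_good_param.
Qed.
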